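(* Let $k\ge2$, $a\ge2$, and let $T\in\mathbb{R}^{n_1\times\cdots\times n_k}$. For each $j\in[k]$ let $A^{(j)}=\operatorname{unfold}_j(T)\in\mathbb{R}^{n_j\times N_j}$, $N_j=\prod_{t\ne j}n_t$, assume $\operatorname{rank}(A^{(j)})=r$, with compact SVD $A^{(j)}=U^{(j)}\Sigma^{(j)}(V^{(j)})^\top$, and assume \[ \|U^{(j)}\|_{2,\infty}^2\le\mu_1\frac r{n_j},\qquad\|V^{(j)}\|_{2,\infty}^2\le\mu_2\frac r{N_j}\qquad(j=1,\dots,k). \] Let $\kappa=\max_j\sigma_1(A^{(j)})/\sigma_r(A^{(j)})$, $\lambda_r^{(j)}=\sigma_r(A^{(j)})^2$, $n_{\mathrm{tot}}=\prod_tn_t$, $n_{\max}=\max_tn_t$. For each $j$ let $Z^{(j)}$ be the wedge matrix of $A^{(j)}$ at rate $p$, $\hat U^{(j)}\in\mathbb{R}^{n_j\times r}$ orthonormal eigenvectors of $Z^{(j)}$ for its $r$ largest eigenvalues, and $Q^{(j)}=\hat U^{(j)}(\hat U^{(j)})^\top$. Independently of the wedge samples, let $\Omega$ include each entry of $[n_1]\times\cdots\times[n_k]$ independently with probability $q$, let $Y=q^{-1}\mathcal P_\Omega(T)$, and $\hat T=Y\times_1Q^{(1)}\times_2Q^{(2)}\cdots\times_kQ^{(k)}$. Assume \[ p\ge C_0\kappa^4a\mu_1\mu_2\frac{r^2\log n_{\max}}{n_{\mathrm{tot}}},\qquad q\ge\frac{a(k-1)\log n_{\max}}{n_{\mathrm{tot}}}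 \] for a sufficiently large absolute constant $C_0$, and that $\lambda_r^{(j)}\ge4\|Z^{(j)}-A^{(j)}(A^{(j)})^\top\|$ for all $j$. Then with probability at least $1-O(n_{\max}^{-a})$, \[ \|T-\hat T\|_F\le C\left(k\sqrt r\,\kappa^2\sqrt{\frac{a\mu_1\mu_2r^2\log n_{\max}}{p\,n_{\mathrm{tot}}}}+2^kr^{1.5+k/2}\kappa^{2k}\sqrt{\frac{a(k-1)\mu_1^{k+1}\mu_2\log n_{\max}}{q\,n_{\mathrm{tot}}}}\right)\|T\|_F \] for an absolute constant $C$.
   Context: $\operatorname{unfold}_j(T)$ has entries $[\operatorname{unfold}_j(T)]_{i_j,(i_t)_{t\ne j}}=T_{i_1,\dots,i_k}$. $\|M\|_{2,\infty}=\max_i\|M_{i,\cdot}\|_2$; $\mathcal P_\Omega(T)$ equals $T$ on $\Omega$ and $0$ elsewhere; $\times_j$ is the mode-$j$ tensor–matrix product, so that $\operatorname{unfold}_j(\hat T)=Q^{(j)}\operatorname{unfold}_j(Y)\big(\bigotimes_{t\ne j}Q^{(t)}\big)$. Wedge matrix of $A\in\mathbb{R}^{n\times m}$ at rate $p$: each triple of $\{(i,\ell,j):1\le i\le j\le n,\ \ell\in[m]\}$ is sampled independently with probability $p$ (set $\tilde{\mathcal W}$); with $Z_{i\ell j}=p^{-1}A_{i\ell}A_{j\ell}e_ie_j^\top\mathbf 1\{(i,\ell,j)\in\tilde{\mathcal W}\}$, $Z=\sum_{i<j,\ell}(Z_{i\ell j}+Z_{i\ell j}^\top)+\sum_{i,\ell}Z_{i\ell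 i}$. *)

(* Defs.v *)
From HB Require Import structures.
From mathcomp Require Import all_boot all_order all_algebra.
From mathcomp Require Import boolp classical_sets reals exp.
Set Implicit Arguments. Unset Strict Implicit. Unset Printing Implicit Defensive.
Import Order.TTheory GRing.Theory Num.Theory.
Local Open Scope ring_scope.

Notation idx k n := {dffun forall t : 'I_k, 'I_(n t)}.

Definition setj (k : nat) (n : 'I_k -> nat) (x : idx k n) (j : 'I_k)
  (i : 'I_(n j)) : idx k n :=
  [ffun t => match j =P t with
             | ReflectT e => ecast u 'I_(n u) e i
             | ReflectF _ => x t end].

(* Column index set of the mode-j unfolding: multi-indices (i_t)_{t <> j},
   represented as multi-indices whose j-th coordinate is 0.
   Its cardinality is N_j = prod_{t <> j} n_t (when all n_t > 0). *)
Notation colT k n j := {x : idx k n | nat_of_ord (x j) == 0%N}.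

Section Defs.
Variable R : realType.

(* mode-j unfolding: [unfold_j T]_{i_j, (i_t)_{t<>j}} = T_{i_1..i_k};
   columns are ordered by the canonical enumeration of colT (column order
   does not affect any quantity in the statement). *)
Definition unfold (k : nat) (n : 'I_k -> nat) (T : idx k n -> R) (j : 'I_k)
  : 'M[R]_(n j, #|{: colT k n j}|) :=
  \matrix_(i, c) T (setj (val (enum_val c)) i).

Definition norm2inf (m l : nat) (M : 'M[R]_(m, l)) : R :=
  \big[Num.max/0]_(i < m) Num.sqrt (\sum_(c < l) M i c ^+ 2).

Definition vnorm (m : nat) (x : 'cV[R]_m) : R :=
  Num.sqrt (\sum_(i < m) x i 0 ^+ 2).
Definition opnorm (m l : nat) (M : 'M[R]_(m, l)) : R :=
  sup [set vnorm (M *m x) | x in [set x : 'cV[R]_l | vnorm x = 1]].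

Definition wT (m l : nat) := {w : 'I_m * 'I_l * 'I_m | (w.1.1 <= w.2)%N}.

Definition wedgeZ (m l : nat) (p : R) (A : 'M[R]_(m, l)) (S : {set wT m l})
  (w : wT m l) : 'M[R]_m :=
  if w \in S then
    (p^-1 * A (val w).1.1 (val w).1.2 * A (val w).2 (val w).1.2)
      *: delta_mx (val w).1.1 (val w).2
  else 0.

Definition wedge (m l : nat) (p : R) (A : 'M[R]_(m, l)) (S : {set wT m l})
  : 'M[R]_m :=
  \sum_(w : wT m l | ((val w).1.1 < (val w).2)%N)
     (wedgeZ p A S w + (wedgeZ p A S w)^T)
  + \sum_(w : wT m l | nat_of_ord (val w).1.1 == nat_of_ord (val w).2)
     wedgeZ p A S w.

(* Uh (m x r) consists of orthonormal eigenvectors of Z for its r largest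
   eigenvalues: Uh is the first r columns of an orthogonal eigenbasis W of Z
   whose eigenvalues are sorted nonincreasingly. *)
Definition topeig (m r : nat) (Z : 'M[R]_m) (Uh : 'M[R]_(m, r)) : Prop :=
  exists (W : 'M[R]_m) (lam : 'I_m -> R),
    W^T *m W = 1%:M /\
    Z = W *m diag_mx (\row_i lam i) *m W^T /\
    (forall a b : 'I_m, (a <= b)%N -> lam b <= lam a) /\
    (forall (c : 'I_r) (c' : 'I_m), nat_of_ord c = nat_of_ord c' ->
        forall i, Uh i c = W i c').

Definition bern (X : finType) (p : R) (S : {set X}) : R :=
  \prod_(x : X) (if x \in S then p else 1 - p).

Definition mode_prod (k : nat) (n : 'I_k -> nat) (j : 'I_k) (M : 'M[R]_(n j))
  (Y : idx k n -> R) : idx k n -> R :=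
  fun x => \sum_(i < n j) M (x j) i * Y (setj x i).

Definition multi_mode (k : nat) (n : 'I_k -> nat) (Y : idx k n -> R)
  (Q : forall j : 'I_k, 'M[R]_(n j)) : idx k n -> R :=
  foldl (fun Y' j => mode_prod (Q j) Y') Y (enum 'I_k).

Definition POmega (k : nat) (n : 'I_k -> nat) (Om : {set idx k n})
  (T : idx k n -> R) : idx k n -> R :=
  fun x => if x \in Om then T x else 0.

Definition frob (k : nat) (n : 'I_k -> nat) (T : idx k n -> R) : R :=
  Num.sqrt (\sum_(x : idx k n) T x ^+ 2).

Definition outcome (k : nat) (n : 'I_k -> nat) :=
  ({dffun forall j : 'I_k, {set wT (n j) #|{: colT k n j}|}} * {set idx k n})%type.

Definition prob (k : nat) (n : 'I_k -> nat) (p q : R) (E : outcome n -> Prop)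
  : R :=
  \sum_(w : outcome n | `[< E w >])
     ((\prod_(j < k) bern p (w.1 j)) * bern q w.2).

End Defs.

(* Main.v *)
Require Import Defs.
From HB Require Import structures.
From mathcomp Require Import all_boot all_order all_algebra.
From mathcomp Require Import boolp classical_sets reals exp.
From mathcomp Require Import topology normedtype sequences derive.
From mathcomp Require Import ring lra.
Set Implicit Arguments. Unset Strict Implicit. Unset Printing Implicit Defensive.
Import Order.TTheory GRing.Theory Num.Theory.
Import numFieldNormedType.Exports.
Local Open Scope ring_scope.

(* Write A = unfold_j T, E = Z - A A^T and Q for the projector on the top
   eigenvectors.  On the event 4 ||E|| <= s_r^2 the top r eigenvalues of Z are
   separated from the others, so Q is determined by the wedge samples alone, and
   T - That = (T - T x Q) + (T - Y) x Q.

   The first term is at most sum_j ||(I - Q) A||_F, and comparing entries in an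
   eigenbasis of Z gives ||(I - Q) U||_F <= 4 ||E U||_F / (3 s_r^2).  Hence only
   the Euclidean norm of the random vectors (row of E) * U matters, for which the
   dimension-free Bernstein inequality of Pinelis (through cosh of the norm)
   suffices; convexity of the exponential averages over the modes, so that no
   factor k appears in the probability.

   The second term is again a sum of independent centered vectors once the wedge
   samples are fixed.  Its variance only involves tr Q = r, but the size of its
   summands needs the diagonal entries of Q, i.e. the rows of the eigenvectors.
   These are controlled by leaving out one row and column of E: expanding the
   eigenvector equation in powers of the reduced matrix F, row i of E is
   independent of F ^ t U.  A mode where this fails costs a factor n_max at most;
   when k > n_max the product over the independent modes absorbs such factors,
   and when k <= n_max a union bound excludes them. *)

(** * Hyperbolic functions and the convexity of [t |-> cosh (sqrt t)] *)

Section HyperbolicFunctions.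
Variable R : realType.
Implicit Types x y z p : R.

(** Two features of the statement shape the proof. The number [k] of modes is unrestricted, so a
    failure probability of order [n_max ^ (- a)] with an absolute constant forbids a union bound
    over the modes in general; estimates are therefore kept as exponential moments or moments of
    products, which can be averaged or multiplied over the modes before Markov's inequality is
    applied. And the eigenvectors are chosen inside the bad event, after all samples, so only
    quantities common to every choice may be fixed before the entries are sampled.

    The cosh of a norm serves as moment function because it is even: for a centered Bernoulli
    variable X, the mean of [cosh |a + X v|] exceeds [cosh |a|] by a second-order factor only, in
    any dimension.

    In the leave-one-out argument the event for row [i] compares [row i E] times [F ^ t U] with the
    largest row of [F ^ t U] itself, not with a number. Its probability is thus controlled before
    anything is known about these rows, and the induction on [t] that bounds them is
    deterministic. *)

Definition cosh x := (expR x + expR (- x)) / 2.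
Definition sinh x := (expR x - expR (- x)) / 2.

Lemma is_derive_cosh x : is_derive x 1 cosh (sinh x).
Proof.
rewrite /cosh /sinh; apply: is_derive_eq; rewrite /GRing.scale/=; lra.
Qed.

Lemma is_derive_sinh x : is_derive x 1 sinh (cosh x).
Proof.
rewrite /cosh /sinh; apply: is_derive_eq; rewrite /GRing.scale/=; lra.
Qed.

Lemma derive_ge0_le (f df : R -> R) x y :
  (forall z, is_derive z 1 f (df z)) -> (forall z, x < z < y -> 0 <= df z) ->
  x <= y -> f x <= f y.
Proof.
move=> fdf df0; rewrite le_eqVlt => /predU1P[->//|xy].
have cf : ({within `[x, y], continuous f})%classic.
  apply: derivable_within_continuous => z _.
  exact: (@ex_derive _ _ _ _ _ _ _ (fdf z)).
have [z zxy /eqP] := MVT xy (fun z _ => fdf z) cf.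
rewrite subr_eq => /eqP ->; rewrite lerDr mulr_ge0 ?subr_ge0 ?(ltW xy)//.
by apply: df0; rewrite in_itv/= in zxy.
Qed.

Lemma coshN x : cosh (- x) = cosh x.
Proof. by rewrite /cosh opprK addrC. Qed.

Lemma cosh0 : cosh 0 = 1.
Proof. by rewrite /cosh oppr0 expR0; lra. Qed.

Lemma sinh0 : sinh 0 = 0.
Proof. by rewrite /sinh oppr0 subrr mul0r. Qed.

Lemma cosh_gt0 x : 0 < cosh x.
Proof. by rewrite /cosh divr_gt0// addr_gt0 ?expR_gt0. Qed.

Lemma sinh_le_cosh x : sinh x <= cosh x.
Proof. by rewrite /sinh /cosh; have := expR_gt0 (- x); lra. Qed.

Lemma coshDsinh x : cosh x + sinh x = expR x.
Proof. by rewrite /sinh /cosh; lra. Qed.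

Lemma expR_le_cosh x : expR x <= 2 * cosh x.
Proof. by rewrite /cosh; have := expR_gt0 (- x); lra. Qed.

Lemma cosh_ge1 x : 1 <= cosh x.
Proof.
rewrite /cosh expRN ler_pdivlMr// mul1r; have e0 := expR_gt0 x.
have : 0 <= (expR x - 1) ^+ 2 / expR x by rewrite divr_ge0 ?sqr_ge0 ?ltW.
suff -> : (expR x - 1) ^+ 2 / expR x = expR x + (expR x)^-1 - 2 by lra.
by field; rewrite gt_eqF.
Qed.

Lemma sinh_ge x : 0 <= x -> x <= sinh x.
Proof.
move=> x0; rewrite -subr_ge0.
have D z : is_derive z 1 (fun t : R => sinh t - t) (cosh z - 1).
  by have ? := is_derive_sinh z; apply: is_derive_eq.
have := @derive_ge0_le _ _ 0 x D _ x0; rewrite sinh0 subrr; apply => z _.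
by rewrite subr_ge0 cosh_ge1.
Qed.

Lemma sinh_le_id_cosh x : 0 <= x -> sinh x <= x * cosh x.
Proof.
move=> x0; rewrite -subr_ge0.
have D z : is_derive z 1 (fun t : R => t * cosh t - sinh t) (z * sinh z).
  have ? := is_derive_sinh z; have ? := is_derive_cosh z.
  by apply: is_derive_eq; rewrite /GRing.scale/=; lra.
have := @derive_ge0_le _ _ 0 x D _ x0; rewrite sinh0 subr0 mul0r; apply=> z.
move=> /andP[z0 _]; rewrite mulr_ge0 ?(ltW z0)// (le_trans (ltW z0))// sinh_ge//.
exact: ltW.
Qed.

Lemma cosh_homo x y : 0 <= x -> x <= y -> cosh x <= cosh y.
Proof.
move=> x0; apply: (@derive_ge0_le _ sinh) => [z|z /andP[xz _]].
  exact: is_derive_cosh.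
have z0 : 0 <= z by rewrite (le_trans x0)// ltW.
exact: (le_trans z0 (sinh_ge z0)).
Qed.

(** Monotonicity of [sinh t / t] in product form: this is what makes [t |-> cosh (sqrt t)]
    convex. *)
Lemma sinh_ratio_le x y : 0 < x -> x <= y -> y * sinh x <= x * sinh y.
Proof.
move=> x0 xy; rewrite -subr_ge0.
have D z : is_derive z 1 (fun t : R => x * sinh t - t * sinh x)
    (x * cosh z - sinh x).
  have ? := is_derive_sinh z.
  by apply: is_derive_eq; rewrite /GRing.scale/=; lra.
have := @derive_ge0_le _ _ x y D _ xy; rewrite subrr; apply => z /andP[xz _].
have := sinh_le_id_cosh (ltW x0); have := cosh_homo (ltW x0) (ltW xz).
by move=> h1 h2; rewrite subr_ge0 (le_trans h2)// ler_wpM2l// ltW.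
Qed.

(* Supporting line of the convex function [t |-> cosh (sqrt t)]. *)
Lemma cosh_sqr_tangent y : 0 <= y ->
  exists c, forall z, 0 <= z -> cosh y + c * (z ^+ 2 - y ^+ 2) <= cosh z.
Proof.
rewrite le_eqVlt => /predU1P[<-|y0].
  exists 0 => z z0; rewrite mul0r addr0 cosh0; exact: cosh_ge1.
(* The derivative of [cosh (sqrt t)] at [t = y ^ 2]. *)
exists (sinh y / (2 * y)) => z z0.
set c := _ / _.
have D (t : R) : is_derive t 1 (fun u : R => cosh u - c * u ^+ 2)
    (sinh t - t * (sinh y / y)).
  have ? := is_derive_cosh t.
  apply: is_derive_eq; rewrite /GRing.scale/= /c; field; lra.
suff : cosh y - c * y ^+ 2 <= cosh z - c * z ^+ 2 by lra.
have [yz|/ltW zy] := leP y z.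
  apply: (derive_ge0_le D) => // t /andP[yt _].
  rewrite subr_ge0 mulrA ler_pdivrMr// [leRHS]mulrC.
  by apply: sinh_ratio_le => //; exact: ltW.
rewrite -lerN2.
have DN (t : R) : is_derive t 1 (fun u : R => - (cosh u - c * u ^+ 2))
    (- (sinh t - t * (sinh y / y))).
  by have ? := D t; apply: is_deriveN.
apply: (derive_ge0_le DN) => // t /andP[zt ty].
rewrite oppr_ge0 subr_le0 mulrA ler_pdivlMr// [leLHS]mulrC.
apply: sinh_ratio_le => //; last exact: ltW.
exact: le_lt_trans zt.
Qed.

(** Jensen for [cosh (sqrt t)]: the tangent is taken at the quadratic mean [m] of the [z i], where
    its linear term averages to zero, and monotonicity of [cosh] passes from [m] down to [y]. *)
Lemma cosh_jensen (I : finType) (w z : I -> R) y :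
  (forall i, 0 <= w i) -> \sum_i w i = 1 -> (forall i, 0 <= z i) -> 0 <= y ->
  y ^+ 2 <= \sum_i w i * z i ^+ 2 -> cosh y <= \sum_i w i * cosh (z i).
Proof.
move=> w0 w1 z0 y0 yz.
pose m := Num.sqrt (\sum_i w i * z i ^+ 2).
have m2 : m ^+ 2 = \sum_i w i * z i ^+ 2.
  by rewrite sqr_sqrtr// sumr_ge0// => i _; rewrite mulr_ge0 ?sqr_ge0.
have ym : y <= m by rewrite -(@ler_pXn2r _ 2) ?nnegrE ?sqrtr_ge0// m2.
apply: (le_trans (cosh_homo y0 ym)).
have [c hc] := cosh_sqr_tangent (sqrtr_ge0 _ : 0 <= m).
rewrite -[cosh m]mul1r -w1 mulr_suml.
suff -> : \sum_i w i * cosh m = \sum_i w i * (cosh m + c * (z i ^+ 2 - m ^+ 2)).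
  by apply: ler_sum => i _; rewrite ler_wpM2l// hc.
transitivity (\sum_i w i * cosh m + c * (\sum_i w i * z i ^+ 2 - (\sum_i w i) * m ^+ 2)).
  by rewrite -m2 w1 mul1r subrr mulr0 addr0.
rewrite mulr_suml -sumrB mulr_sumr -big_split; apply: eq_bigr => i _ /=; ring.
Qed.

Lemma expR_le_quad x : 0 <= x <= 1 / 2 -> expR x <= 1 + x + 2 * x ^+ 2.
Proof.
move=> /andP[x0 x1]; have := expR_ge1Dx (- x); rewrite expRN => h.
have e0 := expR_gt0 x; have xx : 0 < 1 - x by lra.
have : expR x <= (1 - x)^-1.
  by rewrite -[leLHS]invrK lef_pV2 ?posrE ?invr_gt0.
move=> h1; apply: (le_trans h1); rewrite -[_^-1]mul1r ler_pdivrMr//.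
have : 0 <= x ^+ 2 * (1 - 2 * x) by rewrite mulr_ge0 ?sqr_ge0; lra.
lra.
Qed.

End HyperbolicFunctions.

(** * Euclidean norm of functions on a finite type *)

Section EuclideanNorm.
Variable R : realType.
Variable I : finType.
Implicit Types f g : I -> R.

Definition l2norm f : R := Num.sqrt (\sum_i f i ^+ 2).

Lemma l2norm_ge0 f : 0 <= l2norm f. Proof. exact: sqrtr_ge0. Qed.

Lemma sqr_l2norm f : l2norm f ^+ 2 = \sum_i f i ^+ 2.
Proof. by rewrite sqr_sqrtr// sumr_ge0// => i _; rewrite sqr_ge0. Qed.

Lemma l2norm_ext f g : f =1 g -> l2norm f = l2norm g.
Proof. by move=> fg; congr Num.sqrt; apply: eq_bigr => i _; rewrite fg. Qed.

Lemma l2norm_sqr_le f c : 0 <= c -> \sum_i f i ^+ 2 <= c ^+ 2 -> l2norm f <= c.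
Proof. by move=> c0 h; rewrite -(@ler_pXn2r _ 2) ?nnegrE ?l2norm_ge0// sqr_l2norm. Qed.

Lemma l2normZ c f : l2norm (fun i => c * f i) = `|c| * l2norm f.
Proof.
rewrite /l2norm -[`|c|]sqrtr_sqr -sqrtrM ?sqr_ge0//; congr Num.sqrt.
by rewrite mulr_sumr; apply: eq_bigr => i _; rewrite exprMn.
Qed.

Lemma l2norm_eq0 f : l2norm f = 0 -> forall i, f i = 0.
Proof.
move=> f0 i; have := sqr_l2norm f; rewrite f0 expr0n/= => /esym/eqP.
rewrite psumr_eq0 => [|j _]; last exact: sqr_ge0.
by move=> /allP/(_ i); rewrite mem_index_enum => /(_ isT)/=; rewrite sqrf_eq0 => /eqP.
Qed.

Lemma norm_le_l2norm f i : `|f i| <= l2norm f.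
Proof.
rewrite -(@ler_pXn2r _ 2) ?nnegrE ?l2norm_ge0// sqr_l2norm real_normK ?num_real//.
by rewrite (bigD1 i)//= lerDl sumr_ge0// => j _; rewrite sqr_ge0.
Qed.

Lemma sqr_dot_le f g :
  (\sum_i f i * g i) ^+ 2 <= (\sum_i f i ^+ 2) * (\sum_i g i ^+ 2).
Proof.
set D := \sum_i _ * _; set F := \sum_i _; set G := \sum_i _.
have G0 : 0 <= G by apply: sumr_ge0 => i _; rewrite sqr_ge0.
have [G00|Gn0] := eqVneq G 0.
  suff -> : D = 0 by rewrite expr0n G00 mulr0.
  rewrite /D big1// => i _.
  have := l2norm_eq0 (f := g); rewrite /l2norm -/G G00 sqrtr0 => -> //.
  by rewrite mulr0.
have : 0 <= \sum_i (f i * G - g i * D) ^+ 2.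
  by apply: sumr_ge0 => i _; rewrite sqr_ge0.
have -> : \sum_i (f i * G - g i * D) ^+ 2 = G * (F * G - D ^+ 2).
  transitivity (F * G ^+ 2 - 2 * D * G * D + G * D ^+ 2); last by ring.
  rewrite [F * _]mulr_suml [2 * D]mulr_sumr !mulr_suml -sumrB -big_split.
  by apply: eq_bigr => i _ /=; ring.
by rewrite pmulr_rge0 ?subr_ge0// lt_def Gn0.
Qed.

Lemma dot_le f g : \sum_i f i * g i <= l2norm f * l2norm g.
Proof.
apply: (le_trans (ler_norm _)).
rewrite -(@ler_pXn2r _ 2) ?nnegrE ?mulr_ge0 ?l2norm_ge0//.
by rewrite real_normK ?num_real// exprMn !sqr_l2norm sqr_dot_le.
Qed.

Lemma l2normD f g : l2norm (fun i => f i + g i) <= l2norm f + l2norm g.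
Proof.
apply: l2norm_sqr_le; first by rewrite addr_ge0 ?l2norm_ge0.
have -> : \sum_i (f i + g i) ^+ 2 =
    \sum_i f i ^+ 2 + \sum_i g i ^+ 2 + 2 * \sum_i f i * g i.
  by rewrite mulr_sumr -!big_split; apply: eq_bigr => i _ /=; ring.
by rewrite -!sqr_l2norm; have := dot_le f g; lra.
Qed.

End EuclideanNorm.

(** * One sampling step for the cosh of a norm *)

Section CoshStep.
Variable R : realType.
Implicit Types s t y p c : R.

Lemma coshD s t : cosh (s + t) = cosh s * cosh t + sinh s * sinh t.
Proof. by rewrite /cosh /sinh opprD !expRD; field. Qed.

Lemma coshB s t : cosh (s - t) = cosh s * cosh t - sinh s * sinh t.
Proof. by rewrite coshD coshN /sinh opprK; field. Qed.

(** The law of cosines, [c] being the cosine of the angle: [y ^ 2] is the mean of [(s + t) ^ 2] and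
    [(s - t) ^ 2] with weights [(1 + c) / 2] and [(1 - c) / 2], so [cosh_jensen] applies. *)
Lemma cosh_chord s t c y : 0 <= s -> 0 <= t -> -1 <= c <= 1 -> 0 <= y ->
  y ^+ 2 = s ^+ 2 + t ^+ 2 + 2 * c * s * t ->
  cosh y <= cosh s * cosh t + c * (sinh s * sinh t).
Proof.
move=> s0 t0 /andP[c1 c2] y0 yst.
pose w (b : bool) := if b then (1 + c) / 2 else (1 - c) / 2.
pose z (b : bool) := if b then s + t else `|s - t|.
have := @cosh_jensen R bool w z y; rewrite !big_bool /w /z/=.
rewrite real_normK ?num_real// yst.
have -> : cosh `|s - t| = cosh (s - t).
  by case: (ger0P (s - t)) => _ //; rewrite coshN.
rewrite coshD coshB => H.
apply: (le_trans (H _ _ _ y0 _)).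
- by case; lra.
- lra.
- by case; rewrite ?normr_ge0 ?addr_ge0.
- lra.
- by rewrite le_eqVlt; apply/orP; left; apply/eqP; field.
Qed.

(** Here [s = |a|], [t = |v|], and [a] moves by [(p^-1 - 1) v] or by [- v]. The moves have mean
    zero, so in the cross term [sinh x] and [sinh t] may be replaced by [sinh x - x] and
    [sinh t - t]; what is left is of second order, with variance at most [t ^ 2 / p]. *)
Lemma cosh_two_point s t c p y1 y0 :
  0 <= s -> 0 <= t -> -1 <= c <= 1 -> 0 < p <= 1 -> t / p <= 1 / 2 ->
  0 <= y1 -> 0 <= y0 ->
  y1 ^+ 2 = s ^+ 2 + ((p^-1 - 1) * t) ^+ 2 + 2 * c * s * ((p^-1 - 1) * t) ->
  y0 ^+ 2 = s ^+ 2 + t ^+ 2 - 2 * c * s * t ->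
  p * cosh y1 + (1 - p) * cosh y0 <= cosh s * expR (4 * (t ^+ 2 / p)).
Proof.
move=> s0 t0 /andP[c1 c2] /andP[p0 p1] tp y10 y00 e1 e0.
have pV1 : 1 <= p^-1 by rewrite invf_ge1.
set x := (p^-1 - 1) * t in e1.
have x0 : 0 <= x by rewrite mulr_ge0 ?subr_ge0.
have xp : p * x = (1 - p) * t by rewrite /x; field; rewrite gt_eqF.
have tx : t / p = t + x by rewrite /x; ring.
have H1 := cosh_chord s0 x0 (introT andP (conj c1 c2)) y10 e1.
have H0 : cosh y0 <= cosh s * cosh t - c * (sinh s * sinh t).
  rewrite -mulNr; apply: cosh_chord => //; first by lra.
  by rewrite e0; ring.
have ss := sinh_le_cosh s; have sh0 := le_trans s0 (sinh_ge s0).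
have sx := sinh_ge x0; have st := sinh_ge t0.
have Ex : expR x - x <= 1 + 2 * x ^+ 2.
  by have := @expR_le_quad R x; rewrite x0 /= => /(_ _); lra.
have Et : expR t - t <= 1 + 2 * t ^+ 2.
  by have := @expR_le_quad R t; rewrite t0 /= => /(_ _); lra.
have cs0 := cosh_gt0 s.
have q0 : 0 <= 1 - p by lra.
apply: (@le_trans _ _ (cosh s * (p * (expR x - x) + (1 - p) * (expR t - t)))).
  rewrite -!coshDsinh.
  set P := p * (sinh x - x); set Q := (1 - p) * (sinh t - t).
  have P0 : 0 <= P by rewrite mulr_ge0 ?subr_ge0// ltW.
  have Q0 : 0 <= Q by rewrite mulr_ge0 ?subr_ge0.
  have h : c * sinh s * (P - Q) <= cosh s * (P + Q).
    have : - (P + Q) <= c * (P - Q) <= P + Q by apply/andP; split; nra.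
    move=> /andP[_ h]; rewrite mulrAC -mulrA [_ * sinh s]mulrC.
    rewrite mulrCA; apply: (@le_trans _ _ (sinh s * (P + Q))).
      by rewrite ler_wpM2l.
    by rewrite ler_wpM2r// addr_ge0.
  have h1 := ler_wpM2l (ltW p0) H1; have h0 := ler_wpM2l q0 H0.
  apply: (le_trans (lerD h1 h0)).
  have e : p * sinh x - (1 - p) * sinh t = P - Q by rewrite /P /Q; lra.
  have -> : p * (cosh s * cosh x + c * (sinh s * sinh x)) +
    (1 - p) * (cosh s * cosh t - c * (sinh s * sinh t)) =
    cosh s * (p * cosh x + (1 - p) * cosh t) + c * sinh s * (P - Q).
    by rewrite -e; ring.
  suff -> : cosh s * (p * (cosh x + sinh x - x) + (1 - p) * (cosh t + sinh t - t))
    = cosh s * (p * cosh x + (1 - p) * cosh t) + cosh s * (P + Q) by rewrite lerD2l.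
  by rewrite /P /Q; ring.
rewrite ler_pM2l//.
have h1 := ler_wpM2l (ltW p0) Ex; have h0 := ler_wpM2l q0 Et.
apply: (le_trans (lerD h1 h0)).
apply: (le_trans _ (expR_ge1Dx _)).
have : p * (x ^+ 2) + (1 - p) * t ^+ 2 = (1 - p) * t * (t / p).
  by rewrite tx expr2 mulrA xp; ring.
have : (1 - p) * t * (t / p) <= t ^+ 2 / p.
  rewrite -mulrA expr2 -mulrA ler_piMl//; last by lra.
  by rewrite mulr_ge0// divr_ge0// ltW.
have : 0 <= t ^+ 2 / p by rewrite divr_ge0 ?sqr_ge0// ltW.
lra.
Qed.

Lemma cosh_l2norm_two_point (I : finType) (a v : I -> R) p :
  0 < p <= 1 -> l2norm v / p <= 1 / 2 ->
  p * cosh (l2norm (fun i => a i + (p^-1 - 1) * v i))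
    + (1 - p) * cosh (l2norm (fun i => a i - v i))
  <= cosh (l2norm a) * expR (4 * (l2norm v ^+ 2 / p)).
Proof.
move=> p01 vp; set s := l2norm a; set t := l2norm v.
have s0 : 0 <= s by exact: l2norm_ge0.
have t0 : 0 <= t by exact: l2norm_ge0.
pose d := \sum_i a i * v i.
have [c c1 dc] : exists2 c : R, -1 <= c <= 1 & d = c * s * t.
  have [st0|st0] := eqVneq (s * t) 0.
    (* A zero vector has no angle; both sides vanish for any [c]. *)
    exists 0; first by lra.
    rewrite mul0r mul0r; move/eqP: st0; rewrite mulf_eq0 => /orP[] /eqP z0.
      by rewrite /d big1// => i _; rewrite (l2norm_eq0 z0) mul0r.
    by rewrite /d big1// => i _; rewrite (l2norm_eq0 z0) mulr0.
  exists (d / (s * t)); last by rewrite -mulrA divfK.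
  have stp : 0 < s * t by rewrite lt_def st0 mulr_ge0.
  rewrite ler_pdivlMr// ler_pdivrMr// mul1r mulN1r dot_le andbT.
  rewrite lerNl; have := dot_le (fun i => -1 * a i) v.
  rewrite l2normZ normrN1 mul1r => /(le_trans _); apply.
  by rewrite /d -sumrN; apply: ler_sum => i _; rewrite mulN1r mulNr.
apply: (@cosh_two_point s t c) => //; try exact: l2norm_ge0.
  have -> : 2 * c * s * ((p^-1 - 1) * t) = 2 * (p^-1 - 1) * d by rewrite dc; ring.
  rewrite exprMn !sqr_l2norm /d !mulr_sumr -!big_split.
  by apply: eq_bigr => i _ /=; ring.
have -> : 2 * c * s * t = 2 * d by rewrite dc; ring.
rewrite !sqr_l2norm /d !mulr_sumr -!big_split -sumrB.
by apply: eq_bigr => i _ /=; ring.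
Qed.

End CoshStep.

(** * Expectations over Bernoulli subsets *)

Section BernoulliExpectation.
Variables (R : realType) (X : finType) (p : R).
Implicit Types (f g : {set X} -> R) (S : {set X}) (s : seq X).

Definition Expect f : R := \sum_(S : {set X}) bern p S * f S.

Lemma eq_Expect f g : f =1 g -> Expect f = Expect g.
Proof. by move=> fg; apply: eq_bigr => S _; rewrite fg. Qed.

Lemma sum_set_split (x : X) (g : {set X} -> R) :
  \sum_(S : {set X}) g S = \sum_(S : {set X} | x \notin S) (g S + g (x |: S)).
Proof.
rewrite (bigID (fun S => x \notin S))/= big_split/=; congr (_ + _).
rewrite (reindex_onto (fun S => x |: S) (fun S => S :\ x)) /=; last first.
  by move=> S; rewrite negbK => xS; rewrite finset.setD1K.
apply: eq_bigl => S; rewrite finset.setU11/=; apply/eqP/idP => [<-|xS].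
  by rewrite !inE eqxx.
by rewrite finset.setU1K.
Qed.

Lemma Expect_resample1 x f :
  Expect (fun S => p * f (x |: S) + (1 - p) * f (S :\ x)) = Expect f.
Proof.
rewrite /Expect !(sum_set_split x); apply: eq_bigr => S xS.
pose rest := \prod_(y | y != x) (if y \in S then p else 1 - p).
have bS : bern p S = (1 - p) * rest.
  by rewrite /bern (bigD1 x)//= (negPf xS).
have bxS : bern p (x |: S) = p * rest.
  rewrite /bern (bigD1 x)//= finset.setU11; congr (_ * _).
  by apply: eq_bigr => y yx; rewrite !inE (negPf yx).
have -> : x |: (x |: S) = x |: S by rewrite finset.setUA finset.setUid.
have -> : (x |: S) :\ x = S by rewrite finset.setU1K.
have -> : S :\ x = S.
  by apply/finset.setP => y; rewrite !inE; case: eqP => //= ->; rewrite (negPf xS).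
rewrite bS bxS; ring.
Qed.

(** The conditional expectation of [f] given the coordinates outside [s], unrolled so that
    inductions on [s] peel off one Bernoulli variable at a time; [Expect_resample] is its tower
    property. *)
Fixpoint resample s f S : R :=
  if s is x :: s' then
    p * resample s' f (x |: S) + (1 - p) * resample s' f (S :\ x)
  else f S.

Lemma Expect_resample s f : Expect (resample s f) = Expect f.
Proof. by elim: s => //= x s IH; rewrite (Expect_resample1 x (resample s f)). Qed.

Lemma eq_resample s f g S :
  (forall S', (forall y, y \notin s -> (y \in S') = (y \in S)) -> f S' = g S') ->
  resample s f S = resample s g S.
Proof.
elim: s S => [|x s IH] S fg /=; first exact: fg.
congr (_ * _ + _ * _); apply: IH => S' S'S; apply: fg => y;
  rewrite inE negb_or => /andP[yx ys]; rewrite S'S// !inE (negPf yx)//.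
Qed.

Lemma Expect1 : Expect (fun=> 1) = 1.
Proof.
rewrite /Expect; under eq_bigr do rewrite mulr1.
by rewrite -bigA_distr big1// => x _; rewrite /= addrC subrK.
Qed.

Lemma ExpectD f g : Expect (fun S => f S + g S) = Expect f + Expect g.
Proof. by rewrite -big_split; apply: eq_bigr => S _; rewrite mulrDr. Qed.

Lemma ExpectZ (c : R) f : Expect (fun S => c * f S) = c * Expect f.
Proof. by rewrite mulr_sumr; apply: eq_bigr => S _; rewrite mulrCA. Qed.

Lemma Expect_sum (J : Type) (t : seq J) (P : pred J) (F : J -> {set X} -> R) :
  Expect (fun S => \sum_(j <- t | P j) F j S) = \sum_(j <- t | P j) Expect (F j).
Proof. by rewrite exchange_big; apply: eq_bigr => S _; rewrite mulr_sumr. Qed.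

Hypothesis p01 : 0 < p <= 1.

Lemma bern_ge0 S : 0 <= bern p S.
Proof. by move/andP: p01 => [? ?]; apply: prodr_ge0 => x _; case: ifP => _; lra. Qed.

Lemma le_Expect f g : (forall S, f S <= g S) -> Expect f <= Expect g.
Proof. by move=> fg; apply: ler_sum => S _; rewrite ler_wpM2l// bern_ge0. Qed.

Lemma Expect_le c f : (forall S, f S <= c) -> Expect f <= c.
Proof.
move=> fc; apply: (le_trans (le_Expect (g := fun S => c * 1) _)).
  by move=> S; rewrite mulr1.
by rewrite ExpectZ Expect1 mulr1.
Qed.

Variable I : finType.

Definition centered S x : R := (x \in S)%:R / p - 1.

(** The offset [a] is arbitrary so that the induction can absorb into it the term of the coordinate
    just revealed; each coordinate costs one factor from [cosh_l2norm_two_point]. *)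
Lemma resample_cosh_le s (a : I -> R) (v : X -> I -> R) S :
  uniq s -> (forall x, x \in s -> l2norm (v x) / p <= 1 / 2) ->
  resample s (fun S' =>
      cosh (l2norm (fun i => a i + \sum_(x <- s) centered S' x * v x i))) S
  <= cosh (l2norm a) * expR (4 * \sum_(x <- s) l2norm (v x) ^+ 2 / p).
Proof.
have /andP[p0 p1] := p01; elim: s a S => [|x s IH] a S /=.
  move=> _ _; rewrite big_nil mulr0 expR0 mulr1.
  by rewrite (l2norm_ext (g := a))// => i; rewrite big_nil addr0.
move=> /andP[xs us] vp.
have vps y : y \in s -> l2norm (v y) / p <= 1 / 2.
  by move=> ys; apply: vp; rewrite inE ys orbT.
have key (c : R) S1 : (forall S', (forall y, y \notin s -> (y \in S') = (y \in S1)) ->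
     centered S' x = c) ->
    resample s (fun S' => cosh (l2norm (fun i =>
       a i + \sum_(y <- x :: s) centered S' y * v y i))) S1 <=
    cosh (l2norm (fun i => a i + c * v x i)) *
      expR (4 * \sum_(x <- s) l2norm (v x) ^+ 2 / p).
  move=> hc; apply: le_trans (IH _ S1 us vps).
  rewrite le_eqVlt; apply/orP; left; apply/eqP.
  apply: eq_resample => S' S'S; congr cosh; apply: l2norm_ext => i.
  by rewrite big_cons (hc S')// addrA.
have k1 := key (p^-1 - 1) (x |: S).
have k0 := key (- 1) (S :\ x).
apply: (@le_trans _ _ ((p * cosh (l2norm (fun i => a i + (p^-1 - 1) * v x i))
   + (1 - p) * cosh (l2norm (fun i => a i - v x i))) *
   expR (4 * \sum_(x <- s) l2norm (v x) ^+ 2 / p))).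
  rewrite [leRHS]mulrDl; apply: lerD.
    rewrite -[leRHS]mulrA ler_wpM2l//; first by lra.
    by apply: k1 => S' /(_ x xs); rewrite finset.setU11 /centered => ->; rewrite mul1r.
  rewrite -[leRHS]mulrA ler_wpM2l//; first by lra.
  rewrite (l2norm_ext (g := fun i => a i + (-1) * v x i)); last first.
    by move=> i; rewrite mulN1r.
  by apply: k0 => S' /(_ x xs); rewrite !inE eqxx /centered => ->; rewrite mul0r sub0r.
rewrite big_cons mulrDr expRD mulrA ler_wpM2r ?expR_ge0//.
by apply: cosh_l2norm_two_point => //; apply: vp; rewrite inE eqxx.
Qed.

(* The directions [v x S] may depend on the coordinates of [S] outside [s]:
   conditionally on those coordinates they are deterministic. *)
Lemma Expect_cosh_le s (v : X -> {set X} -> I -> R) (V : R) :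
  uniq s ->
  (forall S S' : {set X}, (forall y, y \notin s -> (y \in S') = (y \in S)) ->
     forall x, x \in s -> v x S' =1 v x S) ->
  (forall S x, x \in s -> l2norm (v x S) / p <= 1 / 2) ->
  (forall S, \sum_(x <- s) l2norm (v x S) ^+ 2 / p <= V) ->
  Expect (fun S => cosh (l2norm (fun i => \sum_(x <- s) centered S x * v x S i)))
  <= expR (4 * V).
Proof.
move=> us vdep vp vV; rewrite -(Expect_resample s); apply: Expect_le => S.
apply: (le_trans _ (_ : expR (4 * \sum_(x <- s) l2norm (v x S) ^+ 2 / p) <= _)).
  have := @resample_cosh_le s (fun=> 0) (fun x => v x S) S us (vp S).
  have -> : l2norm (fun=> 0 : R) = 0 :> R.
    by move=> J; rewrite /l2norm big1 ?sqrtr0// => i _; rewrite expr0n.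
  rewrite cosh0 mul1r; apply: le_trans.
  rewrite le_eqVlt; apply/orP; left; apply/eqP; apply: eq_resample => S' S'S.
  congr cosh; apply: l2norm_ext => i; rewrite add0r.
  by apply: eq_big_seq => x xs; rewrite (vdep S S').
by rewrite ler_expR ler_pM2l.
Qed.

End BernoulliExpectation.

(** * Frobenius norm and operator bounds *)

Section FrobeniusNorm.
Variable R : realType.

Definition fnorm (m n : nat) (M : 'M[R]_(m, n)) : R :=
  l2norm (fun x : 'I_m * 'I_n => M x.1 x.2).

Lemma fnorm_ge0 m n (M : 'M_(m, n)) : 0 <= fnorm M.
Proof. exact: l2norm_ge0. Qed.

Lemma sqr_fnorm m n (M : 'M_(m, n)) : fnorm M ^+ 2 = \sum_i \sum_j M i j ^+ 2.
Proof. by rewrite sqr_l2norm pair_bigA. Qed.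

Lemma fnorm_le_sqr m n m' n' (M : 'M_(m, n)) (M' : 'M_(m', n')) :
  fnorm M ^+ 2 <= fnorm M' ^+ 2 -> fnorm M <= fnorm M'.
Proof. by rewrite ler_pXn2r ?nnegrE ?fnorm_ge0. Qed.

Lemma fnorm_eq_sqr m n m' n' (M : 'M_(m, n)) (M' : 'M_(m', n')) :
  fnorm M ^+ 2 = fnorm M' ^+ 2 -> fnorm M = fnorm M'.
Proof. by move=> e; apply/le_anti/andP; split; apply: fnorm_le_sqr; rewrite e. Qed.

Lemma sqr_fnorm_tr m n (M : 'M_(m, n)) : fnorm M ^+ 2 = \tr (M^T *m M).
Proof.
rewrite sqr_fnorm exchange_big; apply: eq_bigr => j _.
by rewrite mxE; apply: eq_bigr => i _; rewrite mxE expr2.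
Qed.

Lemma fnorm0 m n : fnorm (0 : 'M_(m, n)) = 0.
Proof. by rewrite /fnorm /l2norm big1 ?sqrtr0// => i _; rewrite mxE expr0n. Qed.

Lemma fnorm_eq0 m n (M : 'M_(m, n)) : fnorm M = 0 -> M = 0.
Proof. by move=> /l2norm_eq0 M0; apply/matrixP => i j; rewrite mxE (M0 (i, j)). Qed.

Lemma fnormD m n (M N : 'M_(m, n)) : fnorm (M + N) <= fnorm M + fnorm N.
Proof.
apply: le_trans (l2normD _ _); rewrite le_eqVlt; apply/orP; left; apply/eqP.
by apply: l2norm_ext => x; rewrite mxE.
Qed.

Lemma fnormZ m n (c : R) (M : 'M_(m, n)) : fnorm (c *: M) = `|c| * fnorm M.
Proof. by rewrite -l2normZ; apply: l2norm_ext => x; rewrite mxE. Qed.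

Lemma fnormN m n (M : 'M_(m, n)) : fnorm (- M) = fnorm M.
Proof. by rewrite -scaleN1r fnormZ normrN1 mul1r. Qed.

Lemma fnorm_trmx m n (M : 'M_(m, n)) : fnorm M^T = fnorm M.
Proof.
apply: fnorm_eq_sqr; rewrite !sqr_fnorm exchange_big; apply: eq_bigr => i _.
by apply: eq_bigr => j _; rewrite mxE.
Qed.

Lemma sqr_fnorm_row m n (M : 'M_(m, n)) : fnorm M ^+ 2 = \sum_i fnorm (row i M) ^+ 2.
Proof.
rewrite sqr_fnorm; apply: eq_bigr => i _; rewrite sqr_fnorm big_ord1.
by apply: eq_bigr => j _; rewrite mxE.
Qed.

Lemma sqr_fnorm_col m n (M : 'M_(m, n)) : fnorm M ^+ 2 = \sum_j fnorm (col j M) ^+ 2.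
Proof.
rewrite -fnorm_trmx sqr_fnorm_row; apply: eq_bigr => j _.
by rewrite -tr_col fnorm_trmx.
Qed.

Lemma fnorm_row_le m n (M : 'M_(m, n)) i : fnorm (row i M) <= fnorm M.
Proof.
apply: fnorm_le_sqr; rewrite [leRHS]sqr_fnorm_row (bigD1 i)//= lerDl.
by apply: sumr_ge0 => j _; rewrite sqr_ge0.
Qed.

Lemma fnormM m n k (M : 'M_(m, n)) (N : 'M_(n, k)) :
  fnorm (M *m N) <= fnorm M * fnorm N.
Proof.
rewrite -(@ler_pXn2r _ 2) ?nnegrE ?mulr_ge0 ?fnorm_ge0// exprMn sqr_fnorm.
rewrite (sqr_fnorm_row M) mulr_suml; apply: ler_sum => i _.
rewrite (sqr_fnorm_col N) mulr_sumr; apply: ler_sum => j _.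
rewrite !sqr_fnorm big_ord1; under [in leRHS]eq_bigr do rewrite mxE.
under [X in _ * X]eq_bigr do rewrite big_ord1 mxE.
by rewrite mxE; exact: sqr_dot_le.
Qed.

Lemma fnorm_isoL m r n (W : 'M_(m, r)) (X : 'M_(r, n)) :
  W^T *m W = 1%:M -> fnorm (W *m X) = fnorm X.
Proof.
move=> WW; apply: fnorm_eq_sqr; rewrite !sqr_fnorm_tr trmx_mul.
by rewrite mulmxA -(mulmxA X^T) WW mulmx1.
Qed.

Lemma fnorm_isoRT m r n (W : 'M_(m, r)) (X : 'M_(n, r)) :
  W^T *m W = 1%:M -> fnorm (X *m W^T) = fnorm X.
Proof. by move=> WW; rewrite -fnorm_trmx trmx_mul trmxK fnorm_isoL// fnorm_trmx. Qed.

Lemma sqr_fnorm_proj m r n (W : 'M_(m, r)) (X : 'M_(m, n)) : W^T *m W = 1%:M ->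
  fnorm X ^+ 2 = fnorm (W^T *m X) ^+ 2 + fnorm (X - W *m W^T *m X) ^+ 2.
Proof.
move=> WW; rewrite !sqr_fnorm_tr -mxtraceD; congr (\tr _).
set P := W *m W^T.
have PT : P^T = P by rewrite trmx_mul trmxK.
have PP : P *m P = P by rewrite /P mulmxA -(mulmxA W) WW mulmx1.
have -> : (X - P *m X)^T = X^T - X^T *m P by rewrite linearB/= trmx_mul PT.
have -> : (W^T *m X)^T *m (W^T *m X) = X^T *m P *m X.
  by rewrite trmx_mul trmxK !mulmxA.
rewrite mulmxBl mulmxBr [X in _ - X]mulmxBr.
have -> : X^T *m P *m (P *m X) = X^T *m P *m X.
  by rewrite -mulmxA (mulmxA P) PP mulmxA.
by rewrite subrr subr0 [X^T *m (P *m X)]mulmxA addrC subrK.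
Qed.

Lemma fnorm_isoTL m r n (W : 'M_(m, r)) (X : 'M_(m, n)) :
  W^T *m W = 1%:M -> fnorm (W^T *m X) <= fnorm X.
Proof.
by move=> WW; apply: fnorm_le_sqr; rewrite (sqr_fnorm_proj X WW) lerDl sqr_ge0.
Qed.

Lemma fnorm_isoR m r n (W : 'M_(m, r)) (X : 'M_(n, m)) :
  W^T *m W = 1%:M -> fnorm (X *m W) <= fnorm X.
Proof.
by move=> WW; rewrite -fnorm_trmx trmx_mul -(fnorm_trmx X); exact: fnorm_isoTL.
Qed.

Lemma fnorm_diagR m n (X : 'M_(m, n)) (d : 'rV_n) (c : R) :
  (forall i, `|d 0 i| <= c) -> fnorm (X *m diag_mx d) <= c * fnorm X.
Proof.
move=> dc; case: n X d dc => [|n] X d dc.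
  have -> : X = 0 by apply/matrixP => i [].
  by rewrite mul0mx !fnorm0 mulr0.
have c0 : 0 <= c := le_trans (normr_ge0 _) (dc 0).
rewrite -(@ler_pXn2r _ 2) ?nnegrE ?mulr_ge0 ?fnorm_ge0// exprMn !sqr_fnorm mulr_sumr.
apply: ler_sum => i _; rewrite mulr_sumr; apply: ler_sum => j _.
rewrite mul_mx_diag mxE exprMn mulrC ler_wpM2r ?sqr_ge0//.
by rewrite -(real_normK (num_real (d 0 j))) ler_pXn2r ?nnegrE.
Qed.

Lemma fnorm_diagL m n (X : 'M_(m, n)) (d : 'rV_m) (c : R) :
  (forall i, `|d 0 i| <= c) -> fnorm (diag_mx d *m X) <= c * fnorm X.
Proof.
by move=> dc; rewrite -fnorm_trmx trmx_mul tr_diag_mx -(fnorm_trmx X) fnorm_diagR.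
Qed.

Lemma vnormE m (x : 'cV[R]_m) : vnorm x = fnorm x.
Proof.
apply/eqP; rewrite -(@eqrXn2 _ 2) ?fnorm_ge0 ?sqrtr_ge0// sqr_fnorm.
rewrite sqr_sqrtr ?sumr_ge0// => [|i _]; last exact: sqr_ge0.
by apply/eqP; apply: eq_bigr => i _; rewrite big_ord1.
Qed.

(** Stated for [X] of every width, so that Frobenius norms pass through products directly and no
    supremum has to be handled later. *)
Definition opbound (m n : nat) (M : 'M[R]_(m, n)) (b : R) : Prop :=
  forall q (X : 'M_(n, q)), fnorm (M *m X) <= b * fnorm X.

Lemma opbound_opnorm m n (M : 'M[R]_(m, n)) : opbound M (opnorm M).
Proof.
have cV (x : 'cV_n) : fnorm (M *m x) <= opnorm M * fnorm x.
  have [x0|x0] := eqVneq (fnorm x) 0.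
    by rewrite (fnorm_eq0 x0) mulmx0 !fnorm0 mulr0.
  have xp : 0 < fnorm x by rewrite lt_def x0 fnorm_ge0.
  rewrite -ler_pdivrMr//.
  have -> : fnorm (M *m x) / fnorm x = vnorm (M *m ((fnorm x)^-1 *: x)).
    by rewrite vnormE -scalemxAr fnormZ ger0_norm ?invr_ge0 ?fnorm_ge0// mulrC.
  apply: ub_le_sup.
    exists (fnorm M) => _ [y /= y1 <-]; rewrite vnormE.
    by apply: (le_trans (fnormM _ _)); rewrite -(vnormE y) y1 mulr1.
  exists ((fnorm x)^-1 *: x) => //=.
  by rewrite vnormE fnormZ ger0_norm ?invr_ge0 ?fnorm_ge0// mulVf.
move=> q X.
have [->|X0] := eqVneq X 0; first by rewrite mulmx0 !fnorm0 mulr0.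
(* A nonzero column of [X] reveals the sign of [opnorm M], which is needed before squaring;
   afterwards squared norms add over the columns. *)
have o0 : 0 <= opnorm M.
  have /matrix0Pn[i [j Xij]] := X0.
  have := cV (col j X); have := fnorm_ge0 (M *m col j X).
  move=> /le_trans h /h; rewrite pmulr_lge0// lt_def fnorm_ge0 andbT.
  apply/eqP => /fnorm_eq0/matrixP/(_ i 0); rewrite !mxE => e.
  by rewrite e eqxx in Xij.
rewrite -(@ler_pXn2r _ 2) ?nnegrE ?mulr_ge0 ?fnorm_ge0// exprMn.
rewrite !sqr_fnorm_col mulr_sumr; apply: ler_sum => j _.
by rewrite -exprMn ler_pXn2r ?nnegrE ?mulr_ge0 ?fnorm_ge0// colE -mulmxA -colE cV.
Qed.

End FrobeniusNorm.

(** * Eigenvalues of a perturbed symmetric matrix of low rank *)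

Section EigenvaluePerturbation.
Variable R : realType.

(** The dimension count of both min-max arguments below: it yields a nonzero vector in one subspace
    that is orthogonal to a subspace of smaller dimension. *)
Lemma left_kernel_nonzero (m k : nat) (B : 'M[R]_(m, k)) :
  (k < m)%N -> exists2 y : 'rV_m, y != 0 & y *m B = 0.
Proof.
move=> km; exists (nz_row (kermx B)); last first.
  by apply/sub_kermxP; exact: nz_row_sub.
rewrite nz_row_eq0 -mxrank_eq0 mxrank_ker -lt0n subn_gt0.
exact: leq_ltn_trans (rank_leq_col B) km.
Qed.

Lemma quad_diag m (y d : 'rV[R]_m) :
  (y *m diag_mx d *m y^T) 0 0 = \sum_i d 0 i * y 0 i ^+ 2.
Proof.
rewrite mul_mx_diag mxE; apply: eq_bigr => i _; rewrite !mxE; ring.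
Qed.

Lemma dotmx_le m (x : 'rV[R]_m) (y : 'cV[R]_m) : `|(x *m y) 0 0| <= fnorm x * fnorm y.
Proof.
apply: le_trans (fnormM x y).
exact: (norm_le_l2norm (fun u : 'I_1 * 'I_1 => (x *m y) u.1 u.2) (0, 0)).
Qed.

Lemma quad_opbound m (E : 'M[R]_m) b (x : 'rV_m) : opbound E b ->
  `|(x *m E *m x^T) 0 0| <= b * fnorm x ^+ 2.
Proof.
move=> Eb; rewrite -mulmxA; apply: (le_trans (dotmx_le _ _)).
rewrite expr2 mulrCA ler_wpM2l ?fnorm_ge0//.
by apply: (le_trans (Eb _ _)); rewrite fnorm_trmx.
Qed.

Lemma colsub_iso m k (f : 'I_k -> 'I_m) (W : 'M[R]_m) : injective f ->
  W^T *m W = 1%:M -> (colsub f W)^T *m colsub f W = 1%:M.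
Proof.
move=> fi WW; apply/matrixP => i j; have /matrixP/(_ (f i) (f j)) := WW.
rewrite !mxE (inj_eq fi) => <-; apply: eq_bigr => l _; rewrite !mxE//.
Qed.

Lemma mul_colsub m k q (f : 'I_k -> 'I_m) (W : 'M[R]_(q, m)) (x : 'rV_q) i :
  (x *m colsub f W) 0 i = (x *m W) 0 (f i).
Proof. by rewrite !mxE; apply: eq_bigr => l _; rewrite !mxE. Qed.

Variables (m r : nat) (Z W : 'M[R]_m) (lam : 'I_m -> R).
Hypothesis WW : W^T *m W = 1%:M.
Hypothesis ZW : Z = W *m diag_mx (\row_i lam i) *m W^T.
Hypothesis lam_sorted : forall a b : 'I_m, (a <= b)%N -> lam b <= lam a.

Lemma orth_mulT : W *m W^T = 1%:M.
Proof. exact: mulmx1C. Qed.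

Lemma quadZ (x : 'rV_m) :
  x *m Z *m x^T = (x *m W) *m diag_mx (\row_i lam i) *m (x *m W)^T.
Proof. by rewrite ZW trmx_mul !mulmxA. Qed.

Lemma fnormW (x : 'rV_m) : fnorm x ^+ 2 = \sum_i (x *m W) 0 i ^+ 2.
Proof.
rewrite -(fnorm_isoRT x (_ : W^T^T *m W^T = 1%:M)); last by rewrite trmxK orth_mulT.
by rewrite trmxK sqr_fnorm big_ord1.
Qed.

Variables (U : 'M[R]_(m, r)) (d : 'rV[R]_r) (b : R).
Hypothesis UU : U^T *m U = 1%:M.
Hypothesis db : forall i, 4 * b <= d 0 i.
Let E := Z - U *m diag_mx d *m U^T.
Hypothesis Eb : opbound E b.

Let ZE : Z = U *m diag_mx d *m U^T + E.
Proof. by rewrite /E addrC subrK. Qed.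

(** The span of the top [r + 1] eigenvectors contains a nonzero [x] orthogonal to [U]. On it the
    form of [Z] is that of [E], hence at most [b], and it is at least [lam c] because [c >= r]. *)
Lemma eigenvalue_le (c : 'I_m) : (r <= c)%N -> lam c <= b.
Proof.
move=> rc; have rm : (r.+1 <= m)%N by exact: leq_ltn_trans rc _.
pose W' := colsub (widen_ord rm) W.
have W'W' : W'^T *m W' = 1%:M.
  by apply: colsub_iso => // i j /(congr1 val) /= ij; apply: val_inj.
have [y y0 yU] := left_kernel_nonzero (W'^T *m U) (ltnSn r).
pose x := y *m W'^T.
have xy : fnorm x = fnorm y by apply: fnorm_isoRT.
have yp : 0 < fnorm y.
  by rewrite lt_def fnorm_ge0 andbT; apply: contra_neq y0; exact: fnorm_eq0.
have xZ : (x *m Z *m x^T) 0 0 = (x *m E *m x^T) 0 0.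
  rewrite ZE mulmxDr mulmxDl mxE !mulmxA; have -> : x *m U = 0 by rewrite -mulmxA.
  by rewrite !mul0mx mxE add0r.
have := le_trans (ler_norm _) (quad_opbound x Eb); rewrite -xZ xy.
have xW i : (x *m W) 0 (widen_ord rm i) = y 0 i.
  by rewrite -mul_colsub -/W' -mulmxA W'W' mulmx1.
rewrite quadZ quad_diag => h.
suff : lam c * fnorm y ^+ 2 <= b * fnorm y ^+ 2 by rewrite ler_pM2r// exprn_gt0.
apply: le_trans h; rewrite -xy.
rewrite fnormW mulr_sumr; apply: ler_sum => i _.
have [ir|ri] := leqP i r.
  by rewrite mxE ler_wpM2r ?sqr_ge0// lam_sorted// (leq_trans ir rc).
suff -> : (x *m W) 0 i = 0 by rewrite expr0n !mulr0.
rewrite -mulmxA (_ : W'^T *m W = rowsub (widen_ord rm) 1%:M).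
  rewrite mxE big1// => j _; rewrite !mxE; case: eqP => [e|_]; last by rewrite mulr0.
  by move: ri; rewrite -e /= ltnNge -ltnS ltn_ord.
by rewrite -WW; apply/matrixP => j l; rewrite !mxE; apply: eq_bigr => t _; rewrite !mxE.
Qed.

(** The span of [U] contains a nonzero [x] orthogonal to the first [c] eigenvectors. On it the form
    of [Z] is at most [lam c] and at least [4 b - b]. *)
Lemma eigenvalue_ge (c : 'I_m) : (c < r)%N -> 3 * b <= lam c.
Proof.
move=> cr; have cm : (c <= m)%N by exact: ltnW.
pose W' := colsub (widen_ord cm) W.
have [y y0 yW] := left_kernel_nonzero (U^T *m W') cr.
pose x := y *m U^T.
have xy : fnorm x = fnorm y by apply: fnorm_isoRT.
have yp : 0 < fnorm y.
  by rewrite lt_def fnorm_ge0 andbT; apply: contra_neq y0; exact: fnorm_eq0.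
have xM : 4 * b * fnorm y ^+ 2 <= (x *m (U *m diag_mx d *m U^T) *m x^T) 0 0.
  have -> : x *m (U *m diag_mx d *m U^T) *m x^T = y *m diag_mx d *m y^T.
    rewrite /x trmx_mul trmxK !mulmxA -(mulmxA _ U^T U) UU mulmx1.
    by rewrite -(mulmxA _ U^T U) UU mulmx1.
  rewrite quad_diag sqr_fnorm big_ord1 mulr_sumr; apply: ler_sum => i _.
  by rewrite ler_wpM2r ?sqr_ge0.
have xE := quad_opbound x Eb.
have xZ : (x *m Z *m x^T) 0 0 <= lam c * fnorm y ^+ 2.
  rewrite quadZ quad_diag -xy.
  rewrite fnormW mulr_sumr; apply: ler_sum => i _.
  have [ci|ic] := leqP c i.
    by rewrite mxE ler_wpM2r ?sqr_ge0// lam_sorted.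
  suff -> : (x *m W) 0 i = 0 by rewrite expr0n !mulr0.
  have := mul_colsub (widen_ord cm) W x (Ordinal ic).
  rewrite -/W' -mulmxA yW mxE => e.
  by rewrite (_ : i = widen_ord cm (Ordinal ic)) ?e//; apply: val_inj.
move: xZ; rewrite ZE mulmxDr mulmxDl mxE => xZ.
have : 3 * b * fnorm y ^+ 2 <= lam c * fnorm y ^+ 2.
  move: xE; rewrite xy ler_norml => /andP[xE _]; lra.
by rewrite ler_pM2r// exprn_gt0.
Qed.


End EigenvaluePerturbation.

(** * The projector on the top eigenspace *)

Section TopEigenspace.
Variable R : realType.
Variables (m r : nat) (Z : 'M[R]_m) (U : 'M[R]_(m, r)) (d : 'rV[R]_r) (b : R).
Hypothesis rm : (r <= m)%N.
Hypothesis b0 : 0 < b.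
Hypothesis UU : U^T *m U = 1%:M.
Hypothesis db : forall i, 4 * b <= d 0 i.
Let E := Z - U *m diag_mx d *m U^T.
Hypothesis Eb : opbound E b.

(** Selecting the top eigenvectors by a diagonal matrix makes every candidate projector a conjugate
    [W *m selmx *m W^T], so that comparing two of them is a question of commutation. *)
Definition selmx : 'M[R]_m := diag_mx (\row_(c < m) (c < r)%N%:R).

Lemma topeig_colsub (W : 'M[R]_m) (Uh : 'M[R]_(m, r)) :
  (forall (c : 'I_r) (c' : 'I_m), nat_of_ord c = nat_of_ord c' ->
        forall i, Uh i c = W i c') -> Uh = colsub (widen_ord rm) W.
Proof. by move=> h; apply/matrixP => i c; rewrite mxE (h c (widen_ord rm c)). Qed.

Lemma colsub_proj (W : 'M[R]_m) :
  colsub (widen_ord rm) W *m (colsub (widen_ord rm) W)^T = W *m selmx *m W^T.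
Proof.
rewrite mul_mx_diag; apply/matrixP => i j; rewrite !mxE.
rewrite (bigID (fun c : 'I_m => (c < r)%N))/= [X in _ + X]big1 ?addr0; last first.
  by move=> c /negPf cr; rewrite !mxE cr mulr0 mul0r.
rewrite (big_ord_narrow rm); apply: eq_bigr => c _.
by rewrite !mxE /= ltn_ord mulr1.
Qed.

Lemma topeig_spec (Uh : 'M[R]_(m, r)) : topeig Z Uh ->
  exists L : 'rV[R]_r, [/\ Uh^T *m Uh = 1%:M, Z *m Uh = Uh *m diag_mx L
    & forall i, 3 * b <= L 0 i].
Proof.
move=> [W [lam [WW [ZW [ls /topeig_colsub ->]]]]].
exists (\row_i lam (widen_ord rm i)); split.
- by apply: colsub_iso => // i j /(congr1 val) /= ij; apply: val_inj.
- have ZWW : Z *m W = W *m diag_mx (\row_i lam i).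
    by rewrite ZW -mulmxA WW mulmx1.
  rewrite !mul_mx_diag in ZWW *; apply/matrixP => i c.
  have /matrixP/(_ i (widen_ord rm c)) := ZWW; rewrite !mxE => <-.
  by apply: eq_bigr => t _; rewrite mxE.
- by move=> i; rewrite mxE; apply: (eigenvalue_ge WW ZW ls UU db Eb) => /=.
Qed.

(* The change of basis between two eigenbases of [Z] commutes with [selmx],
   because no eigenvalue above the gap equals one below it. *)
Lemma topeig_proj_unique (Uh1 Uh2 : 'M[R]_(m, r)) :
  topeig Z Uh1 -> topeig Z Uh2 -> Uh1 *m Uh1^T = Uh2 *m Uh2^T.
Proof.
move=> [W1 [lam1 [WW1 [ZW1 [ls1 /topeig_colsub ->]]]]].
move=> [W2 [lam2 [WW2 [ZW2 [ls2 /topeig_colsub ->]]]]].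
rewrite !colsub_proj; pose N := W1^T *m W2.
have LN : diag_mx (\row_i lam1 i) *m N = N *m diag_mx (\row_i lam2 i).
  transitivity (W1^T *m Z *m W2).
    by rewrite ZW1 !mulmxA WW1 mul1mx.
  by rewrite ZW2 !mulmxA -(mulmxA _ _ W2) WW2 mulmx1.
have lo1 := eigenvalue_ge WW1 ZW1 ls1 UU db Eb.
have lo2 := eigenvalue_ge WW2 ZW2 ls2 UU db Eb.
have up1 := eigenvalue_le WW1 ZW1 ls1 Eb.
have up2 := eigenvalue_le WW2 ZW2 ls2 Eb.
have PN : selmx *m N = N *m selmx.
  rewrite mul_diag_mx mul_mx_diag mul_diag_mx mul_mx_diag in LN *.
  apply/matrixP => i j; have /matrixP/(_ i j) := LN.
  move: N {LN} => N; rewrite !mxE => e.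
  have [ir|ri] := ltnP i r; have [jr|rj] := ltnP j r; rewrite ?mul1r ?mulr1 ?mul0r ?mulr0//.
    have := lo1 i ir; have := up2 j rj => h1 h2.
    have : (lam1 i - lam2 j) * N i j = 0 by rewrite mulrBl e mulrC subrr.
    move/eqP; rewrite mulf_eq0 => /orP[/eqP ?|/eqP//]; suff : b <= 0 by rewrite leNgt b0.
    lra.
  have := lo2 j jr; have := up1 i ri => h1 h2.
  have : (lam1 i - lam2 j) * N i j = 0 by rewrite mulrBl e mulrC subrr.
  move/eqP; rewrite mulf_eq0 => /orP[/eqP ?|/eqP//]; suff : b <= 0 by rewrite leNgt b0.
    lra.
have W1N : W1 *m N = W2 by rewrite /N mulmxA (orth_mulT WW1) mul1mx.
transitivity (W1 *m selmx *m W1^T *m (W2 *m W2^T)).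
  by rewrite (orth_mulT WW2) mulmx1.
rewrite mulmxA -(mulmxA _ W1^T W2) -/N -(mulmxA W1) PN mulmxA W1N//.
Qed.

(** In the eigenbasis, entry [(i, j)] of [W^T E U] is [(lam i - d j)] times that of [W^T U]. The
    left side only sees the entries with [i >= r], where the gap is at least [4 b - b]. *)
Lemma topeig_proj_error (Uh : 'M[R]_(m, r)) : topeig Z Uh ->
  fnorm (U - Uh *m Uh^T *m U) <= fnorm (E *m U) / (3 * b).
Proof.
move=> [W [lam [WW [ZW [ls /topeig_colsub ->]]]]].
rewrite colsub_proj; pose N := W^T *m U.
have up := eigenvalue_le WW ZW ls Eb.
have WT : W^T^T *m W^T = 1%:M by rewrite trmxK (orth_mulT WW).
have -> : U - W *m selmx *m W^T *m U = W *m ((1%:M - selmx) *m N).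
  rewrite mulmxBl mul1mx mulmxBr /N !mulmxA (orth_mulT WW) mul1mx//.
rewrite fnorm_isoL// ler_pdivlMr ?mulr_gt0//.
apply: (@le_trans _ _ (fnorm (W^T *m (E *m U)))); last first.
  by rewrite fnorm_isoL.
have -> : W^T *m (E *m U) = diag_mx (\row_i lam i) *m N - N *m diag_mx d.
  rewrite /E mulmxBl mulmxBr /N; congr (_ - _).
    by rewrite ZW !mulmxA WW mul1mx.
  by rewrite -(mulmxA _ _ U) UU mulmx1 !mulmxA.
rewrite mul_diag_mx mul_mx_diag mulmxBl mul1mx mul_diag_mx.
rewrite -(@ler_pXn2r _ 2) ?nnegrE ?mulr_ge0 ?fnorm_ge0 ?(ltW b0)//.
rewrite exprMn mulrC !sqr_fnorm mulr_sumr; apply: ler_sum => i _.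
rewrite mulr_sumr; apply: ler_sum => j _; rewrite !mxE -/N -exprMn.
set t := \sum_j0 _; have [ir|ri] := ltnP i r.
  by rewrite mul1r subrr mulr0 expr0n sqr_ge0.
rewrite mul0r subr0; have h1 := up i ri; have h2 := db j.
have -> : lam i * t - t * d 0 j = (lam i - d 0 j) * t by ring.
have h : 3 * b <= d 0 j - lam i by lra.
rewrite [leLHS]exprMn [leRHS]exprMn ler_wpM2r ?sqr_ge0// -[leRHS]sqrrN opprB.
by rewrite lerXn2r ?nnegrE// ?(le_trans _ h) ?mulr_ge0 ?(ltW b0).
Qed.

End TopEigenspace.

(** * Leave-one-out bounds on the rows of the eigenvectors *)

Section LeaveOneOut.
Variable R : realType.
Variables (m r : nat) (E : 'M[R]_m) (U : 'M[R]_(m, r)) (b u eta : R).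
Hypothesis b0 : 0 < b.
Hypothesis Eb : opbound E b.
Hypothesis Uu : forall i, fnorm (row i U) <= u.
Hypothesis u0 : 0 <= u.
Hypothesis eta0 : 0 <= eta.

Definition dropmx (i : 'I_m) : 'M[R]_m := 1%:M - delta_mx i i.
Definition loomx (i : 'I_m) : 'M[R]_m := dropmx i *m E *m dropmx i.
Definition loopow (i : 'I_m) (t : nat) : 'M[R]_(m, r) :=
  iter t (mulmx (loomx i)) (dropmx i *m U).

Lemma row_delta n (i j : 'I_m) (X : 'M[R]_(m, n)) :
  row j (delta_mx i i *m X) = (i == j)%:R *: row i X.
Proof.
apply/rowP => c; rewrite !mxE (bigD1 i)//= big1 => [|k /negPf ki].
  by rewrite !mxE eqxx andbT addr0 eq_sym.
by rewrite !mxE ki andbF mul0r.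
Qed.

Lemma row_dropmx n (i j : 'I_m) (X : 'M[R]_(m, n)) :
  row j (dropmx i *m X) = (i != j)%:R *: row j X.
Proof.
rewrite mulmxBl mul1mx linearB/= row_delta; case: eqP => [->|_]/=.
  by rewrite scale1r subrr scale0r.
by rewrite scale0r subr0 scale1r.
Qed.

Lemma fnorm_dropmx n (i : 'I_m) (X : 'M[R]_(m, n)) : fnorm (dropmx i *m X) <= fnorm X.
Proof.
apply: fnorm_le_sqr; rewrite !sqr_fnorm_row; apply: ler_sum => j _.
rewrite row_dropmx fnormZ; case: (i != j); rewrite ?normr1 ?mul1r//.
by rewrite normr0 mul0r expr0n sqr_ge0.
Qed.

Lemma loomx_opbound i : opbound (loomx i) b.
Proof.
move=> q X; rewrite /loomx -!mulmxA; apply: (le_trans (fnorm_dropmx _ _)).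
by apply: (le_trans (Eb _)); rewrite ler_wpM2l ?fnorm_dropmx// ltW.
Qed.

Lemma drop_split n i (X : 'M[R]_(m, n)) : X = dropmx i *m X + delta_mx i i *m X.
Proof. by rewrite mulmxBl mul1mx subrK. Qed.

Lemma delta_outer n i (X : 'M[R]_(m, n)) :
  delta_mx i i *m X = delta_mx i 0 *m row i X :> 'M_(m, n).
Proof. by rewrite rowE mulmxA mul_delta_mx. Qed.

(** Column [i] of [E] without its diagonal entry: the steps by which a walk leaves [i]. *)
Definition loocol i : 'cV[R]_m := dropmx i *m E *m delta_mx i 0.

Lemma fnorm_delta_col i : fnorm (delta_mx i 0 : 'cV[R]_m) = 1.
Proof.
apply/eqP; rewrite -(@eqrXn2 _ 2) ?fnorm_ge0// sqr_fnorm expr1n (bigD1 i)//=.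
rewrite big_ord1 mxE !eqxx big1 ?addr0 ?expr1n// => j /negPf ji.
by rewrite big_ord1 mxE ji expr0n.
Qed.

Lemma fnorm_loocol i : fnorm (loocol i) <= b.
Proof.
rewrite /loocol -mulmxA; apply: (le_trans (fnorm_dropmx _ _)).
by apply: (le_trans (Eb _)); rewrite fnorm_delta_col mulr1.
Qed.

Lemma drop_mul n i (X : 'M[R]_(m, n)) :
  dropmx i *m (E *m X) = loomx i *m (dropmx i *m X) + loocol i *m row i X.
Proof.
have JJ : dropmx i *m dropmx i = dropmx i.
  rewrite /dropmx mulmxBl mul1mx mulmxBr mulmx1 mul_delta_mx subrr subr0//.
rewrite {1}(drop_split i X) !mulmxDr delta_outer /loomx /loocol; congr (_ + _).
  by rewrite -!mulmxA (mulmxA (dropmx i) (dropmx i)) JJ.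
by rewrite !mulmxA.
Qed.

Lemma row_mul_split n i (X : 'M[R]_(m, n)) :
  row i (E *m X) = row i E *m (dropmx i *m X) + E i i *: row i X.
Proof.
rewrite row_mul {1}(drop_split i X) mulmxDr delta_outer; congr (_ + _).
have -> : E i i *: row i X = (E i i)%:M *m row i X by rewrite mul_scalar_mx.
rewrite mulmxA; congr (_ *m _); rewrite -colE.
by apply/matrixP => k l; rewrite !ord1 !mxE.
Qed.

Lemma fnorm_row_mul n i (X : 'M[R]_(m, n)) : fnorm (row i E *m X) <= b * fnorm X.
Proof. by rewrite -row_mul; apply: (le_trans (fnorm_row_le _ _)); exact: Eb. Qed.

Variable T : nat.
Hypothesis eta1 : eta <= 1 / 3.
Hypothesis diag_small : forall i, `|E i i| <= eta * b.
(** With [diag_small], this is where the probabilistic input enters. The number [h] is any bound on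
    the rows, so the hypothesis presupposes no incoherence of [loopow]. *)
Hypothesis row_small : forall i t h, (t < T)%N ->
  (forall j, fnorm (row j (loopow i t)) <= h) ->
  fnorm (row i E *m loopow i t) <= eta * b * h.

Let G (t : nat) : 'M[R]_(m, r) := iter t (mulmx E) U.
Let K i t := dropmx i *m G t - loopow i t.

Let KS i t : K i t.+1 = loomx i *m K i t + loocol i *m row i (G t).
Proof. by rewrite /K /G /= drop_mul mulmxBr addrAC. Qed.

Lemma loopow_row_le i j t (B : R) :
  fnorm (row j (G t)) <= B -> fnorm (K i t) <= B ->
  fnorm (row j (loopow i t)) <= 2 * B.
Proof.
move=> Gt Kt; have B0 : 0 <= B := le_trans (fnorm_ge0 _) Kt.
have -> : loopow i t = dropmx i *m G t - K i t by rewrite /K opprB addrC subrK.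
rewrite linearB/=; apply: (le_trans (fnormD _ _)); rewrite fnormN row_dropmx.
have -> : 2 * B = B + B by ring.
apply: lerD; last exact: le_trans (fnorm_row_le _ _) Kt.
rewrite fnormZ; case: (i != j); rewrite ?normr1 ?mul1r//.
by rewrite normr0 mul0r.
Qed.

(* [K i t] collects the walks that visit [i]; splitting a walk started at [i]
   at its returns to [i] bounds row [i] of [E ^ t U] by the term
   [row i E *m loopow i t], whose two factors are independent, and by [K]. *)
Lemma power_incoherent t : (t <= T)%N ->
  (forall i, fnorm (row i (G t)) <= (2 * b) ^+ t * u) /\
  (forall i, fnorm (K i t) <= (2 * b) ^+ t * u).
Proof.
elim: t => [|t IH] tT.
  split=> i; rewrite expr0 mul1r//.
  by rewrite /K /= subrr fnorm0 (le_trans (fnorm_ge0 _) (Uu i)).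
have [Gt Kt] := IH (ltnW tT).
have B0 : 0 <= (2 * b) ^+ t * u by rewrite mulr_ge0 ?exprn_ge0 ?mulr_ge0 ?(ltW b0).
have e2 : (2 * b) ^+ t.+1 * u = 2 * (b * ((2 * b) ^+ t * u)) by rewrite exprS; ring.
split=> i; rewrite e2.
  rewrite /G iterS -/(G t) row_mul_split.
  have -> : dropmx i *m G t = loopow i t + K i t by rewrite /K addrC subrK.
  have Hj j := loopow_row_le (Gt j) (Kt i).
  rewrite mulmxDr.
  have h1 := row_small tT Hj.
  have h2 := le_trans (fnorm_row_mul i (K i t)) (ler_wpM2l (ltW b0) (Kt i)).
  have h3 : fnorm (E i i *: row i (G t)) <= eta * b * ((2 * b) ^+ t * u).
    by rewrite fnormZ ler_pM ?normr_ge0 ?fnorm_ge0.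
  apply: (le_trans (fnormD _ _)); apply: (le_trans (lerD (fnormD _ _) (lexx _))).
  apply: (le_trans (lerD (lerD h1 h2) h3)).
  set B := (2 * b) ^+ t * u in B0 *.
  have bB : 0 <= b * B by rewrite mulr_ge0// ltW.
  have : eta * (b * B) <= 1 / 3 * (b * B) by rewrite ler_wpM2r.
  lra.
rewrite KS; apply: (le_trans (fnormD _ _)).
have h1 := le_trans (loomx_opbound i (K i t)) (ler_wpM2l (ltW b0) (Kt i)).
have h2 : fnorm (loocol i *m row i (G t)) <= b * ((2 * b) ^+ t * u).
  by apply: (le_trans (fnormM _ _)); rewrite ler_pM ?fnorm_ge0 ?fnorm_loocol.
by apply: (le_trans (lerD h1 h2)); lra.
Qed.

Lemma loopow_incoherent i j t : (t <= T)%N ->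
  fnorm (row j (loopow i t)) <= 2 * ((2 * b) ^+ t * u).
Proof.
by move=> /power_incoherent[Gt Kt]; exact: loopow_row_le (Gt j) (Kt i).
Qed.

Variables (Uh : 'M[R]_(m, r)) (B : 'M[R]_r) (L : 'rV[R]_r) (beta : R).
(** The eigenvector equation of [Z = U D U^T + E], with [B] in the role of [D U^T Uh]. *)
Hypothesis UhL : (E *m Uh + U *m B) = Uh *m diag_mx L.
Hypothesis UhUh : Uh^T *m Uh = 1%:M.
Hypothesis L3 : forall c, 3 * b <= L 0 c.
Hypothesis Bbeta : forall y : 'rV[R]_r, fnorm (y *m B) <= beta * fnorm y.
Hypothesis beta0 : 0 <= beta.

Let LV : 'M[R]_r := diag_mx (\row_c (L 0 c)^-1).

Let L0 c : 0 < L 0 c.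
Proof. by apply: lt_le_trans (L3 c); rewrite mulr_gt0. Qed.

Let LLV : diag_mx L *m LV = 1%:M.
Proof.
rewrite mulmx_diag -diag_const_mx; congr diag_mx.
by apply/rowP => c; rewrite !mxE mulfV// gt_eqF.
Qed.

Let LV_le n (X : 'M[R]_(n, r)) : fnorm (X *m LV) <= (3 * b)^-1 * fnorm X.
Proof.
apply: fnorm_diagR => c; rewrite mxE ger0_norm ?invr_ge0 ?(ltW (L0 c))//.
by rewrite lef_pV2 ?posrE ?mulr_gt0.
Qed.

Let Bt t : 'M[R]_r := iter t.+1 (fun X => X *m LV) B.

Let Bt_le t (y : 'rV[R]_r) : fnorm (y *m Bt t) <= ((3 * b)^-1) ^+ t.+1 * beta * fnorm y.
Proof.
have b3 : 0 <= (3 * b)^-1 by rewrite invr_ge0 mulr_ge0 ?(ltW b0).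
have step n : (forall y : 'rV[R]_r, fnorm (y *m iter n (fun X => X *m LV) B) <=
    ((3 * b)^-1) ^+ n * beta * fnorm y).
  elim: n => [|n IH] z; first by rewrite expr0 mul1r.
  rewrite iterS mulmxA; apply: (le_trans (LV_le _)).
  by rewrite exprS -!mulrA ler_wpM2l// mulrA.
exact: step.
Qed.

(** Partial Neumann sum obtained by iterating [Uh = (U B + E Uh) L^-1] away from row [i]. It
    contains only powers of the reduced matrix, the terms to which [row_small] applies; [rest]
    collects the truncation and the feedback through row [i]. *)
Let approx i t : 'M[R]_(m, r) := \sum_(s < t) loopow i s *m Bt s.
Let rest i t := dropmx i *m Uh - approx i t.

Let drop_Uh i : dropmx i *m Uh = (dropmx i *m U *m B + loomx i *m (dropmx i *m Uh)
  + loocol i *m row i Uh) *m LV.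
Proof.
rewrite -[LHS]mulmx1 -LLV mulmxA -(mulmxA (dropmx i)) -UhL mulmxDr drop_mul.
by rewrite addrC addrA (mulmxA (dropmx i) U).
Qed.

Let restS i t : rest i t.+1 = (loomx i *m rest i t + loocol i *m row i Uh) *m LV.
Proof.
have zE (V : zmodType) (a1 a2 a3 x : V) : a1 + a2 + a3 - (a1 + x) = a2 - x + a3.
  by rewrite -[a1 + a2 + a3]addrA opprD addrACA subrr add0r addrAC.
rewrite /rest /approx big_ord_recl {1}drop_Uh mulmxBr !(mulmxDl _ _ LV) mulNmx.
have -> : loopow i (ord0 : 'I_t.+1) *m Bt (ord0 : 'I_t.+1) = dropmx i *m U *m B *m LV.
  by rewrite /= /loopow /Bt /= mulmxA.
rewrite zE; congr (_ - _ + _).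
rewrite mulmx_sumr mulmx_suml; apply: eq_bigr => s _.
by rewrite /= /bump /= add1n /loopow /Bt !iterS !mulmxA.
Qed.

(** One step divides by [3 b] a quantity of at most [b] times the previous remainder plus [b] times
    the norm of row [i]; the coefficient [1 / 2] is the fixed point of [y = (y + 1) / 3]. *)
Let rest_le i t :
  fnorm (rest i t) <= 3^-1 ^+ t * Num.sqrt r%:R + fnorm (row i Uh) / 2.
Proof.
have b3 : 0 < 3 * b by rewrite mulr_gt0.
elim: t => [|t IH].
  rewrite /rest /approx big_ord0 subr0 expr0 mul1r.
  have h : fnorm Uh = Num.sqrt r%:R.
    apply/eqP; rewrite -(@eqrXn2 _ 2) ?fnorm_ge0 ?sqrtr_ge0// sqr_fnorm_tr UhUh.
    by rewrite mxtrace1 sqr_sqrtr ?ler0n.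
  apply: (le_trans (fnorm_dropmx _ _)); rewrite h.
  by rewrite lerDl divr_ge0 ?fnorm_ge0.
rewrite restS; apply: (le_trans (LV_le _)); rewrite ler_pdivrMl//.
apply: (le_trans (fnormD _ _)).
have h1 := le_trans (loomx_opbound i (rest i t)) (ler_wpM2l (ltW b0) IH).
have h2 : fnorm (loocol i *m row i Uh) <= b * fnorm (row i Uh).
  by apply: (le_trans (fnormM _ _)); rewrite ler_wpM2r ?fnorm_ge0 ?fnorm_loocol.
apply: (le_trans (lerD h1 h2)); rewrite exprS.
by rewrite le_eqVlt; apply/orP; left; apply/eqP; field.
Qed.

(** The rows of [loopow i s] grow like [(2 b) ^ s] while [Bt s] decays like [(3 b) ^ (- s - 1)]: a
    geometric series of ratio [2 / 3]. *)
Let approx_le i t : (t <= T)%N ->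
  fnorm (row i E *m approx i t) <= 2 * eta * beta * u * (1 - (2 / 3) ^+ t).
Proof.
elim: t => [|t IH] tT.
  by rewrite /approx big_ord0 mulmx0 fnorm0 expr0 subrr mulr0.
rewrite /approx big_ord_recr/= mulmxDr mulmxA; apply: (le_trans (fnormD _ _)).
have h1 := IH (ltnW tT).
have h2 := row_small tT (fun j => loopow_incoherent i j (ltnW tT)).
have h3 := Bt_le t (row i E *m loopow i t).
have b3 : 0 < (3 * b)^-1 by rewrite invr_gt0 mulr_gt0.
have h4 : fnorm (row i E *m loopow i t *m Bt t) <=
    (3 * b)^-1 ^+ t.+1 * beta * (eta * b * (2 * ((2 * b) ^+ t * u))).
  by apply: (le_trans h3); rewrite ler_wpM2l// mulr_ge0// exprn_ge0// ltW.
apply: (le_trans (lerD h1 h4)).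
have -> : (3 * b)^-1 ^+ t.+1 * beta * (eta * b * (2 * ((2 * b) ^+ t * u))) =
   2 / 3 * eta * beta * u * (2 / 3) ^+ t.
  have -> : (2 / 3 : R) ^+ t = (3 * b)^-1 ^+ t * (2 * b) ^+ t.
    by rewrite -exprMn; congr (_ ^+ _); field; rewrite gt_eqF.
  by rewrite exprS; field; rewrite gt_eqF.
by rewrite exprS le_eqVlt; apply/orP; left; apply/eqP; field.
Qed.

(** Row [i] of the eigenvector equation. The eigenvalues give [3], from which the diagonal entry of
    [E] takes [eta] and the feedback in [rest] takes [1 / 2]. *)
Lemma row_eigenvectors_le i : fnorm (row i Uh) * (5 / 2 - eta) * b <=
  beta * u * (1 + 2 * eta) + b * (3^-1 ^+ T * Num.sqrt r%:R).
Proof.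
have e : row i Uh *m diag_mx L = row i U *m B + E i i *: row i Uh
    + row i E *m approx i T + row i E *m rest i T.
  have dU : dropmx i *m Uh = approx i T + rest i T by rewrite /rest addrC subrK.
  have zE (V : zmodType) (w x y z : V) : x + y + z + w = w + z + x + y.
    by rewrite addrC -!addrA; congr (_ + _); rewrite addrA addrC.
  by rewrite -row_mul -UhL linearD/= row_mul_split dU mulmxDr (row_mul i U) zE.
have lo : 3 * b * fnorm (row i Uh) <= fnorm (row i Uh *m diag_mx L).
  have := LV_le (row i Uh *m diag_mx L); rewrite -mulmxA LLV mulmx1.
  by rewrite ler_pdivlMl ?mulr_gt0.
have h1 : fnorm (row i U *m B) <= beta * u.
  by apply: (le_trans (Bbeta _)); rewrite ler_wpM2l.
have h2 : fnorm (E i i *: row i Uh) <= eta * b * fnorm (row i Uh).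
  by rewrite fnormZ ler_wpM2r ?fnorm_ge0.
have h3 : fnorm (row i E *m approx i T) <= 2 * eta * beta * u.
  apply: (le_trans (approx_le i (leqnn T))).
  rewrite ler_piMr ?mulr_ge0// gerBl exprn_ge0//; lra.
have h4 := le_trans (fnorm_row_mul i (rest i T)) (ler_wpM2l (ltW b0) (rest_le i T)).
move: lo; rewrite e => /le_trans/(_ (fnormD _ _)).
move=> /le_trans/(_ (lerD (fnormD _ _) (lexx _))).
move=> /le_trans/(_ (lerD (lerD (fnormD _ _) (lexx _)) (lexx _))).
move=> /le_trans/(_ (lerD (lerD (lerD h1 h2) h3) h4)) h.
lra.
Qed.

End LeaveOneOut.

(** * Entries and rows of the wedge noise *)

Section WedgeNoise.
Variable R : realType.
Variables (m l : nat) (A : 'M[R]_(m, l)) (p : R).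
Implicit Types (i j : 'I_m) (c : 'I_l) (S : {set wT m l}).

(* The set of sampled triples is indexed by [i <= j]; [wtri] makes the triple
   attached to an entry of the symmetric noise matrix independent of the order. *)
Definition sort3 i c j : 'I_m * 'I_l * 'I_m :=
  if (i <= j)%N then (i, c, j) else (j, c, i).

Lemma sort3_le i c j : ((sort3 i c j).1.1 <= (sort3 i c j).2)%N.
Proof. by rewrite /sort3; case: (leqP i j) => [|/ltnW]. Qed.

Definition wtri i c j : wT m l := exist _ (sort3 i c j) (sort3_le i c j).

Lemma wtri_val (w : wT m l) : wtri (val w).1.1 (val w).1.2 (val w).2 = w.
Proof.
by case: w => -[[i c] j] /= ij; apply: val_inj; rewrite /= /sort3 ij.
Qed.

Lemma wtriC i c j : wtri i c j = wtri j c i.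
Proof.
apply: val_inj; rewrite /= /sort3; case: (ltngtP i j) => //= ij.
by rewrite (val_inj ij).
Qed.

Lemma sum_wtri (f : wT m l -> R) i j : (i <= j)%N ->
  \sum_(w : wT m l | ((val w).1.1 == i) && ((val w).2 == j)) f w
  = \sum_c f (wtri i c j).
Proof.
move=> ij; rewrite (reindex_onto (fun c => wtri i c j) (fun w => (val w).1.2)).
  apply: eq_bigl => c; rewrite /= /sort3 ij /= !eqxx//.
by move=> w /andP[/eqP <- /eqP <-]; exact: wtri_val.
Qed.

Lemma wedge_entry S i j :
  wedge p A S i j = \sum_c (wtri i c j \in S)%:R / p * A i c * A j c.
Proof.
pose a (w : wT m l) := (w \in S)%:R / p * A (val w).1.1 (val w).1.2 * A (val w).2 (val w).1.2.
have Zw w i' j' : wedgeZ p A S w i' j' =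
    if ((val w).1.1 == i') && ((val w).2 == j') then a w else 0.
  rewrite /wedgeZ /a [(val w).1.1 == _]eq_sym [(val w).2 == _]eq_sym.
  case: (w \in S); rewrite !mxE; case: ifP => _; rewrite ?mulr1 ?mulr0 ?mul0r ?div0r ?mul1r//.
rewrite /wedge mxE !summxE.
have -> : \sum_(w : wT m l | ((val w).1.1 < (val w).2)%N)
     (wedgeZ p A S w + (wedgeZ p A S w)^T) i j =
  (if (i < j)%N then \sum_c a (wtri i c j) else 0) +
  (if (j < i)%N then \sum_c a (wtri j c i) else 0).
  under eq_bigr do rewrite mxE [X in _ + X]mxE !Zw.
  rewrite big_split/= -!big_mkcondr/=; congr (_ + _).
    case: ltnP => ij; last first.
      rewrite big_pred0// => w; apply/negP => /andP[+ /andP[/eqP e1 /eqP e2]].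
      by rewrite e1 e2 ltnNge ij.
    rewrite -sum_wtri ?(ltnW ij)//; apply: eq_bigl => w.
    by apply: andb_idl => /andP[/eqP -> /eqP ->].
  case: ltnP => ij; last first.
    rewrite big_pred0// => w; apply/negP => /andP[+ /andP[/eqP e1 /eqP e2]].
    by rewrite e1 e2 ltnNge ij.
  rewrite -sum_wtri ?(ltnW ij)//; apply: eq_bigl => w.
  by apply: andb_idl => /andP[/eqP -> /eqP ->].
have -> : \sum_(w : wT m l | nat_of_ord (val w).1.1 == nat_of_ord (val w).2)
     wedgeZ p A S w i j = if i == j then \sum_c a (wtri i c j) else 0.
  under eq_bigr do rewrite Zw.
  rewrite -big_mkcondr/=; case: eqP => ij; last first.
    rewrite big_pred0// => w; apply/negP => /andP[+ /andP[/eqP e1 /eqP e2]].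
    by rewrite e1 e2 => /eqP /val_inj.
  rewrite ij -sum_wtri//; apply: eq_bigl => w.
  by apply: andb_idl => /andP[/eqP -> /eqP ->].
have [ij|ji|/val_inj ij] := ltngtP i j.
- have -> : (i == j) = false by apply/negbTE; rewrite neq_ltn ij.
  rewrite !addr0; apply: eq_bigr => c _; rewrite /a /= /sort3 (ltnW ij)//.
- have -> : (i == j) = false by apply/negbTE; rewrite neq_ltn ji orbT.
  rewrite add0r addr0; apply: eq_bigr => c _.
  by rewrite (wtriC i) /a /= /sort3 (ltnW ji)/= mulrAC.
- rewrite ij eqxx !add0r; apply: eq_bigr => c _.
  by rewrite /a /= /sort3 leqnn.
Qed.

Definition noise S : 'M[R]_m := wedge p A S - A *m A^T.

Lemma noise_entry S i j :
  noise S i j = \sum_c centered p S (wtri i c j) * A i c * A j c.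
Proof.
have -> : noise S i j = wedge p A S i j - (A *m A^T) i j by rewrite /noise !mxE.
rewrite wedge_entry mxE -sumrB; apply: eq_bigr => c _.
by rewrite mxE /centered; ring.
Qed.

Lemma wtri_inj i : injective (fun x : 'I_l * 'I_m => wtri i x.1 x.2).
Proof.
move=> [c j] [c' j'] /(congr1 val) /=; rewrite /sort3 /=.
case: leqP => ij; case: leqP => ij' [].
- by move=> -> ->.
- by move=> e -> e'; rewrite e' e.
- by move=> e -> e'; rewrite e e'.
- by move=> -> ->.
Qed.

(** The triples with endpoint [i]: all the randomness of row [i] of the noise, and by symmetry of
    column [i]. *)
Definition rowtri i : seq (wT m l) :=
  [seq wtri i x.1 x.2 | x <- enum {: 'I_l * 'I_m}].

Lemma rowtri_uniq i : uniq (rowtri i).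
Proof. by rewrite map_inj_uniq ?enum_uniq//; exact: wtri_inj. Qed.

Lemma rowtri_notin i a c b : a != i -> b != i -> wtri a c b \notin rowtri i.
Proof.
move=> ai bi; apply/mapP => -[[c' j] _ /(congr1 val) /=]; rewrite /sort3.
by case: leqP => _; case: leqP => _ [] e1 _ e2; move: ai bi; rewrite ?e1 ?e2 eqxx ?andbF.
Qed.

Definition other i (w : wT m l) : 'I_m :=
  if (val w).1.1 == i then (val w).2 else (val w).1.1.

Lemma other_wtri i c j : other i (wtri i c j) = j.
Proof. by rewrite /other /= /sort3; case: leqP => //= ij; rewrite ?eqxx//; case: eqP. Qed.

Lemma wtri_col i c j : (val (wtri i c j)).1.2 = c.
Proof. by rewrite /= /sort3; case: leqP. Qed.

(** Given the triples outside [rowtri i], [H] is frozen and the product is a sum over [rowtri i] of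
    centered variables times the vectors [A i c * A j c] times [row j H]. After [h] bounds the rows
    of [H], the sum of squares splits into a column bound times a row bound of [A]. *)
Lemma Expect_cosh_row (i : 'I_m) (q : nat) (H : {set wT m l} -> 'M[R]_(m, q))
    (th h Lm colb rowb : R) :
  0 < p <= 1 -> 0 <= th -> 0 <= h -> 0 <= colb ->
  (forall S S' : {set wT m l},
     (forall y, y \notin rowtri i -> (y \in S') = (y \in S)) -> H S' = H S) ->
  (forall S j, fnorm (row j (H S)) <= h) ->
  (forall c j, `|A i c * A j c| <= Lm) ->
  (forall c, \sum_j A j c ^+ 2 <= colb) ->
  \sum_c A i c ^+ 2 <= rowb ->
  th * Lm * h / p <= 1 / 2 ->
  Expect p (fun S => cosh (th * fnorm (row i (noise S) *m H S)))
    <= expR (4 * (th ^+ 2 * h ^+ 2 * colb * rowb / p)).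
Proof.
move=> p01 th0 h0 cb0 Hdep Hh AL Acol Arow small.
have /andP[p0 p1] := p01.
pose v (w : wT m l) S (x : 'I_1 * 'I_q) :=
  th * (A i (val w).1.2 * A (other i w) (val w).1.2) * row (other i w) (H S) x.1 x.2.
have vE c j S : l2norm (v (wtri i c j) S) = `|th * (A i c * A j c)| * fnorm (row j (H S)).
  by rewrite /v other_wtri wtri_col l2normZ.
rewrite (@eq_Expect _ _ _ _ (fun S => cosh (l2norm (fun x =>
    \sum_(w <- rowtri i) centered p S w * v w S x)))); last first.
  move=> S; congr cosh; rewrite -[th]ger0_norm// -l2normZ; apply: l2norm_ext => x.
  rewrite big_map big_enum_cond/=.
  rewrite -(pair_bigA _ (fun c j => centered p S (wtri i c j) * v (wtri i c j) S x))/=.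
  rewrite exchange_big/= mxE mulr_sumr.
  apply: eq_bigr => j _; rewrite [row i _ _ _]mxE noise_entry mulr_suml mulr_sumr.
  by apply: eq_bigr => c _; rewrite /v other_wtri wtri_col mxE; ring.
apply: Expect_cosh_le => //; first exact: rowtri_uniq.
- by move=> S S' SS' w _ x; rewrite /v (Hdep S S').
- move=> S _ /mapP[[c j] _ ->]; rewrite vE /=; apply: le_trans small.
  rewrite ler_pM2r ?invr_gt0// normrM ger0_norm//.
  by rewrite ler_pM ?mulr_ge0 ?normr_ge0 ?fnorm_ge0// ler_wpM2l.
move=> S; rewrite big_map big_enum_cond/= -(pair_bigA _ (fun c j => l2norm (v (wtri i c j) S) ^+ 2 / p))/=.
apply: (@le_trans _ _ (\sum_c \sum_j th ^+ 2 * h ^+ 2 * A i c ^+ 2 * A j c ^+ 2 / p)).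
  apply: ler_sum => c _; apply: ler_sum => j _.
  rewrite ler_pM2r ?invr_gt0// vE exprMn real_normK ?num_real//.
  have -> : th ^+ 2 * h ^+ 2 * A i c ^+ 2 * A j c ^+ 2 = (th * (A i c * A j c)) ^+ 2 * h ^+ 2.
    by ring.
  by rewrite ler_wpM2l ?sqr_ge0// ler_pXn2r ?nnegrE ?fnorm_ge0.
have t0 : 0 <= th ^+ 2 * h ^+ 2 by rewrite mulr_ge0 ?sqr_ge0.
have -> : \sum_c \sum_j th ^+ 2 * h ^+ 2 * A i c ^+ 2 * A j c ^+ 2 / p =
    th ^+ 2 * h ^+ 2 / p * \sum_c A i c ^+ 2 * \sum_j A j c ^+ 2.
  rewrite mulr_sumr; apply: eq_bigr => c _; rewrite mulr_sumr mulr_sumr.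
  by apply: eq_bigr => j _; ring.
rewrite [leRHS](_ : _ = th ^+ 2 * h ^+ 2 / p * (rowb * colb)); last by ring.
rewrite ler_wpM2l ?divr_ge0 ?(ltW p0)//.
apply: (@le_trans _ _ ((\sum_c A i c ^+ 2) * colb)); last by rewrite ler_wpM2r.
by rewrite mulr_suml; apply: ler_sum => c _; rewrite ler_wpM2l ?sqr_ge0.
Qed.

End WedgeNoise.

(** * Largest row norm and indicators of tail events *)

Section RowMax.
Variable R : realType.

Lemma fnorm_row_sqrt m n (M : 'M[R]_(m, n)) i :
  fnorm (row i M) = Num.sqrt (\sum_c M i c ^+ 2).
Proof.
rewrite -[LHS]ger0_norm ?fnorm_ge0// -sqrtr_sqr sqr_fnorm big_ord1.
by congr Num.sqrt; apply: eq_bigr => c _; rewrite mxE.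
Qed.

Lemma fnorm_row_norm2inf m n (M : 'M[R]_(m, n)) i : fnorm (row i M) <= norm2inf M.
Proof.
rewrite fnorm_row_sqrt /norm2inf.
exact: (le_bigmax_cond 0 (fun i => Num.sqrt (\sum_c M i c ^+ 2))).
Qed.

Lemma norm2inf_ge0 m n (M : 'M[R]_(m, n)) : 0 <= norm2inf M.
Proof. exact: bigmax_ge_id. Qed.

Lemma norm2inf_le m n (M : 'M[R]_(m, n)) h : 0 <= h ->
  (forall i, fnorm (row i M) <= h) -> norm2inf M <= h.
Proof.
move=> h0 Mh; apply/bigmax_leP; split => // i _; rewrite -fnorm_row_sqrt//.
Qed.

Lemma indicator_homo (P Q : Prop) : (P -> Q) -> `[< P >]%:R <= `[< Q >]%:R :> R.
Proof. by move=> PQ; case: asboolP => [/PQ hQ|_]; rewrite ?ler0n// asboolT. Qed.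

(** Chernoff's device with [2 * cosh] in place of the exponential, which accounts for the factor 2
    in the tail bounds. *)
Lemma indicator_le_cosh (th t x : R) : 0 <= th ->
  `[< t < x >]%:R <= 2 * expR (- (th * t)) * cosh (th * x).
Proof.
move=> th0; case: asboolP => [tx|_]; last first.
  exact: (mulr_ge0 (mulr_ge0 (ler0n _ 2) (expR_ge0 _)) (ltW (cosh_gt0 _))).
have h : expR (th * t) <= expR (th * x) by rewrite ler_expR ler_wpM2l// ltW.
have := le_trans h (expR_le_cosh _); rewrite expRN mulrAC ler_pdivlMr ?expR_gt0//.
by rewrite mul1r.
Qed.

End RowMax.

(** * A single mode: noise, incoherence and projector *)

Section SingularValueDecomposition.
Variable R : realType.
Variables (m l r : nat) (A : 'M[R]_(m, l)).
Variables (U : 'M[R]_(m, r)) (V : 'M[R]_(l, r)) (s : nat -> R).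
Hypothesis r0 : (0 < r)%N.
Hypothesis UU : U^T *m U = 1%:M.
Hypothesis VV : V^T *m V = 1%:M.
Hypothesis s0 : forall i, (i < r)%N -> 0 < s i.
Hypothesis sS : forall i, (i.+1 < r)%N -> s i.+1 <= s i.
Hypothesis svd : A = U *m diag_mx (\row_(i < r) s i) *m V^T.

Lemma sv_homo i j : (i <= j)%N -> (j < r)%N -> s j <= s i.
Proof.
move=> ij; rewrite -(subnKC ij); elim: (j - i)%N => [|k IH]; first by rewrite addn0.
by rewrite addnS => h; apply: (le_trans (sS h)); exact: IH (ltnW h).
Qed.

Let D := diag_mx (\row_(i < r) s i).

Lemma sv_le0 (i : 'I_r) : `|(\row_(i < r) s i) 0 i| <= s 0%N.
Proof. by rewrite mxE ger0_norm ?(ltW (s0 _))// sv_homo. Qed.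

Lemma sv0_gt0 : 0 < s 0%N. Proof. exact: s0. Qed.

Lemma svr_gt0 : 0 < s r.-1. Proof. by rewrite s0// prednK. Qed.

Lemma svr_le (i : 'I_r) : s r.-1 <= s i.
Proof. by rewrite sv_homo ?prednK// -ltnS prednK. Qed.

Lemma fnorm_row_svd i : fnorm (row i A) <= s 0%N * fnorm (row i U).
Proof.
rewrite svd !row_mul fnorm_isoRT//; apply: fnorm_diagR; exact: sv_le0.
Qed.

Lemma fnorm_col_svd c : fnorm (col c A) <= s 0%N * fnorm (row c V).
Proof.
have -> : col c A = U *m (D *m (row c V)^T).
  by rewrite svd tr_row colE -!mulmxA -colE.
rewrite fnorm_isoL// -(fnorm_trmx (row c V)); apply: fnorm_diagL; exact: sv_le0.
Qed.

Lemma entry_svd i c : `|A i c| <= s 0%N * fnorm (row i U) * fnorm (row c V).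
Proof.
have -> : A i c = (row i U *m D *m (row c V)^T) 0 0.
  by rewrite svd !mxE; apply: eq_bigr => k _; rewrite !mxE; congr (_ * _);
    apply: eq_bigr => t _; rewrite !mxE.
apply: (le_trans (dotmx_le _ _)); rewrite fnorm_trmx ler_wpM2r ?fnorm_ge0//.
apply: fnorm_diagR; exact: sv_le0.
Qed.

Lemma gram_svd : A *m A^T = U *m diag_mx (\row_(i < r) s i ^+ 2) *m U^T.
Proof.
rewrite svd !trmx_mul trmxK tr_diag_mx !mulmxA -(mulmxA _ V^T V) VV mulmx1.
rewrite -(mulmxA U) mulmx_diag; congr (_ *m diag_mx _ *m _).
by apply/rowP => i; rewrite !mxE expr2.
Qed.

Lemma sv0_le_fnorm : s 0%N <= fnorm A.
Proof.
have -> : fnorm A = fnorm D by rewrite svd fnorm_isoRT// fnorm_isoL.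
have := norm_le_l2norm (fun x : 'I_r * 'I_r => D x.1 x.2) (Ordinal r0, Ordinal r0).
by rewrite /= !mxE eqxx mulr1n ger0_norm// ltW// s0.
Qed.

Lemma sqr_fnorm_U : fnorm U ^+ 2 = r%:R.
Proof. by rewrite sqr_fnorm_tr UU mxtrace1. Qed.

Lemma norm2inf_U_ge : r%:R <= m%:R * norm2inf U ^+ 2.
Proof.
rewrite -sqr_fnorm_U sqr_fnorm_row.
apply: (le_trans (ler_sum _ (_ : forall i, _ -> _ <= norm2inf U ^+ 2))).
  by move=> i _; rewrite ler_pXn2r ?nnegrE ?fnorm_ge0 ?norm2inf_ge0// fnorm_row_norm2inf.
by rewrite sumr_const card_ord mulr_natl.
Qed.

Lemma iso_leq : (r <= m)%N.
Proof.
have : \rank (U^T *m U) = r by rewrite UU mxrank1.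
by move=> <-; apply: (leq_trans (mxrankM_maxr _ _)); exact: rank_leq_row.
Qed.

Variables (p v2 w2 ell : R).
Hypothesis p01 : 0 < p <= 1.
Hypothesis Vv : forall c, fnorm (row c V) ^+ 2 <= v2.
Hypothesis v20 : 0 <= v2.
Hypothesis uv : norm2inf U ^+ 2 * v2 <= w2.
Hypothesis ell0 : 0 < ell.

Let u := norm2inf U.
Let E := noise A p.

Let p0 : 0 < p. Proof. by case/andP: p01. Qed.

Lemma entry_prod_le i c j : `|A i c * A j c| <= s 0%N ^+ 2 * fnorm (row i U) * u * v2.
Proof.
rewrite normrM; apply: (le_trans (ler_pM _ _ (entry_svd i c) (entry_svd j c))) => //.
rewrite [leLHS](_ : _ = s 0%N ^+ 2 * fnorm (row i U) * (fnorm (row j U) * fnorm (row c V) ^+ 2)).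
  rewrite -[leRHS]mulrA ler_wpM2l ?(mulr_ge0 (sqr_ge0 _) (fnorm_ge0 _))//.
  by rewrite ler_pM ?fnorm_ge0 ?sqr_ge0// fnorm_row_norm2inf.
by ring.
Qed.

Lemma col_sqr_le c : \sum_j A j c ^+ 2 <= s 0%N ^+ 2 * v2.
Proof.
have -> : \sum_j A j c ^+ 2 = fnorm (col c A) ^+ 2.
  by rewrite sqr_fnorm; apply: eq_bigr => j _; rewrite big_ord1 mxE.
apply: (@le_trans _ _ ((s 0%N * fnorm (row c V)) ^+ 2)).
  rewrite ler_pXn2r ?nnegrE ?fnorm_ge0 ?mulr_ge0 ?fnorm_ge0 ?(ltW sv0_gt0)//.
  exact: fnorm_col_svd.
by rewrite exprMn ler_wpM2l ?sqr_ge0.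
Qed.

Lemma row_sqr_le i : \sum_c A i c ^+ 2 <= s 0%N ^+ 2 * fnorm (row i U) ^+ 2.
Proof.
have -> : \sum_c A i c ^+ 2 = fnorm (row i A) ^+ 2.
  by rewrite sqr_fnorm big_ord1; apply: eq_bigr => j _; rewrite mxE.
rewrite -exprMn ler_pXn2r ?nnegrE ?fnorm_ge0 ?mulr_ge0 ?fnorm_ge0 ?(ltW sv0_gt0)//.
exact: fnorm_row_svd.
Qed.

Lemma row_noise_cosh i q (H : {set wT m l} -> 'M[R]_(m, q)) (th h : R) :
  0 <= th -> 0 <= h ->
  (forall S S' : {set wT m l},
     (forall y, y \notin rowtri l i -> (y \in S') = (y \in S)) -> H S' = H S) ->
  (forall S j, fnorm (row j (H S)) <= h) ->
  th * (s 0%N ^+ 2 * fnorm (row i U) * u * v2) * h / p <= 1 / 2 ->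
  Expect p (fun S => cosh (th * fnorm (row i (E S) *m H S)))
    <= expR (4 * (th ^+ 2 * h ^+ 2 * (s 0%N ^+ 2 * v2)
                   * (s 0%N ^+ 2 * fnorm (row i U) ^+ 2) / p)).
Proof.
move=> th0 h0 Hd Hh sm.
apply: (Expect_cosh_row p01 th0 h0 _ Hd Hh (entry_prod_le i) col_sqr_le (row_sqr_le i) sm).
by rewrite mulr_ge0 ?sqr_ge0.
Qed.

Lemma noise_row0 i S : fnorm (row i U) = 0 -> row i (E S) = 0.
Proof.
move=> ui0; apply/rowP => j; rewrite [LHS]mxE [RHS]mxE.
have Ai c : A i c = 0.
  apply/eqP; rewrite -normr_le0; apply: (le_trans (entry_svd i c)).
  by rewrite ui0 mulr0 mul0r.
by rewrite /E noise_entry big1// => c _; rewrite Ai mulr0 mul0r.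
Qed.

(* Row [i] is weighted by its leverage score [|U_i|^2 / r]: its fluctuations are
   proportional to [|U_i|], so all rescaled rows obey the same bound. *)
Lemma noise_mode_cosh (eps : R) : 0 < eps -> eps <= 1 -> eps ^+ 2 = ell * w2 / p ->
  Expect p (fun S => cosh (ell / 2 *
     (fnorm (E S *m U) / (s 0%N ^+ 2 * Num.sqrt r%:R * eps)))) <= expR ell.
Proof.
move=> e0 e1 e2; have sp := sv0_gt0.
have rp : 0 < r%:R :> R by rewrite ltr0n.
have srp : 0 < Num.sqrt r%:R :> R by rewrite sqrtr_gt0.
have dp : 0 < s 0%N ^+ 2 * Num.sqrt r%:R * eps.
  by rewrite mulr_gt0// mulr_gt0// exprn_gt0.
(* At this scale the common exponent of the rescaled rows, [4 th ^ 2 (s 0) ^ 4 w2 / p], equals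
   [ell], and the summands are at most [eps / 2 <= 1 / 2]; both use [eps ^ 2 = ell w2 / p]. *)
pose th := ell / 2 / (s 0%N ^+ 2 * eps).
have th0 : 0 < th.
  by rewrite divr_gt0 ?divr_gt0// mulr_gt0// exprn_gt0.
pose z i S := th / fnorm (row i U) * fnorm (row i (E S) *m U).
apply: (@le_trans _ _ (Expect p (fun S =>
    \sum_i (fnorm (row i U) ^+ 2 / r%:R) * cosh (z i S)))).
  apply: le_Expect => // S; apply: cosh_jensen.
  - by move=> i; rewrite divr_ge0 ?sqr_ge0.
  - by rewrite -mulr_suml -sqr_fnorm_row sqr_fnorm_U mulfV// gt_eqF.
  - by move=> i; rewrite mulr_ge0 ?fnorm_ge0// divr_ge0 ?fnorm_ge0 ?(ltW th0).
  - by rewrite mulr_ge0 ?divr_ge0 ?fnorm_ge0 ?(ltW ell0) ?(ltW dp).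
  rewrite [leLHS](_ : _ = th ^+ 2 / r%:R * fnorm (E S *m U) ^+ 2); last first.
    have rr : r%:R = Num.sqrt r%:R ^+ 2 :> R by rewrite sqr_sqrtr// ltW.
    move: (Num.sqrt r%:R) rr srp {dp} => q -> q0; rewrite /th; field.
    by rewrite !gt_eqF.
  rewrite sqr_fnorm_row mulr_sumr; apply: ler_sum => i _; rewrite row_mul.
  have [ui0|ui0] := eqVneq (fnorm (row i U)) 0.
    rewrite (noise_row0 S ui0) mul0mx fnorm0 expr0n mulr0.
    by rewrite ui0 expr0n !mul0r.
  by rewrite le_eqVlt /z; apply/orP; left; apply/eqP; field; rewrite ui0 gt_eqF.
rewrite Expect_sum.
apply: (@le_trans _ _ (\sum_i (fnorm (row i U) ^+ 2 / r%:R) * expR ell)); last first.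
  by rewrite -!mulr_suml -sqr_fnorm_row sqr_fnorm_U mulfV ?gt_eqF// mul1r.
apply: ler_sum => i _; rewrite ExpectZ.
have [ui0|ui0] := eqVneq (fnorm (row i U)) 0; first by rewrite ui0 expr0n !mul0r.
rewrite ler_wpM2l ?divr_ge0 ?sqr_ge0//.
have uip : 0 < fnorm (row i U) by rewrite lt_def ui0 fnorm_ge0.
have wp : w2 / p = eps ^+ 2 / ell by rewrite e2; field; rewrite !gt_eqF.
apply: (le_trans (row_noise_cosh (H := fun=> U) (h := u) _ _ _ _ _)) => //.
- by rewrite divr_ge0 ?fnorm_ge0 ?(ltW th0).
- exact: norm2inf_ge0.
- by move=> _ j; exact: fnorm_row_norm2inf.
- rewrite [leLHS](_ : _ = th * s 0%N ^+ 2 * (u ^+ 2 * v2) / p); last first.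
    by field; rewrite ui0 gt_eqF.
  apply: (@le_trans _ _ (th * s 0%N ^+ 2 * w2 / p)).
    by rewrite ler_pM2r ?invr_gt0// ler_wpM2l// mulr_ge0 ?sqr_ge0 ?(ltW th0).
  rewrite -mulrA wp [leLHS](_ : _ = eps / 2); first by lra.
  by rewrite /th; field; rewrite !gt_eqF.
rewrite ler_expR [leLHS](_ : _ = 4 * th ^+ 2 * s 0%N ^+ 4 * (u ^+ 2 * v2) / p); last first.
  by field; rewrite ui0 gt_eqF.
apply: (@le_trans _ _ (4 * th ^+ 2 * s 0%N ^+ 4 * w2 / p)).
  rewrite ler_pM2r ?invr_gt0// ler_wpM2l//.
  by rewrite mulr_ge0 ?exprn_ge0 ?(ltW sp)// mulr_ge0 ?sqr_ge0.
rewrite -mulrA wp le_eqVlt; apply/orP; left; apply/eqP.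
by rewrite /th; field; rewrite !gt_eqF.
Qed.

Variable kap : R.
Hypothesis kap1 : 1 <= kap.
Hypothesis skap : s 0%N <= kap * s r.-1.
Hypothesis pbig : 64 * 500 ^+ 2 * kap ^+ 4 * ell * w2 <= p.

Let b := s r.-1 ^+ 2 / 4.

Let b0 : 0 < b. Proof. by rewrite divr_gt0// exprn_gt0// svr_gt0. Qed.

Let kap0 : 0 < kap. Proof. exact: lt_le_trans kap1. Qed.

Lemma sv0_sqr_le : s 0%N ^+ 2 <= 4 * b * kap ^+ 2.
Proof.
have -> : 4 * b * kap ^+ 2 = (kap * s r.-1) ^+ 2 by rewrite /b; field.
by rewrite ler_pXn2r ?nnegrE ?mulr_ge0 ?(ltW sv0_gt0) ?(ltW svr_gt0) ?(ltW kap0).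
Qed.

(** The threshold scales with [H]. Dividing [H] by its own largest row, which also ignores the
    triples of [rowtri i], makes the rows at most 1, so one tail bound serves whatever the size of
    [H]. *)
Lemma row_noise_tail i q (H : {set wT m l} -> 'M[R]_(m, q)) :
  (forall S S' : {set wT m l},
     (forall y, y \notin rowtri l i -> (y \in S') = (y \in S)) -> H S' = H S) ->
  Expect p (fun S => `[< 1 / 50 * b * norm2inf (H S) < fnorm (row i (E S) *m H S) >]%:R)
  <= 2 * expR (- (9 * ell)).
Proof.
move=> Hd; pose H' S := (norm2inf (H S))^-1 *: H S.
have H'1 S j : fnorm (row j (H' S)) <= 1.
  rewrite linearZ/= fnormZ ger0_norm ?invr_ge0 ?norm2inf_ge0//.
  have [->|n0] := eqVneq (norm2inf (H S)) 0; first by rewrite invr0 mul0r.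
  by rewrite ler_pdivrMl ?mulr1 ?fnorm_row_norm2inf// lt_def n0 norm2inf_ge0.
have H'd (S S' : {set wT m l}) : (forall y, y \notin rowtri l i -> (y \in S') = (y \in S)) -> H' S' = H' S.
  by move=> SS'; rewrite /H' (Hd S S').
(* The threshold [b / 50] then contributes [- 10 ell] to the exponent. The cosh moment costs [ell]
   exactly when [64 * 500 ^ 2 * kap ^ 4 * ell * w2 <= p]: this is the origin of the constant in
   [pbig]. *)
pose th := 500 * ell / b.
have th0 : 0 < th by rewrite divr_gt0// mulr_gt0.
have imp S : 1 / 50 * b * norm2inf (H S) < fnorm (row i (E S) *m H S) ->
    1 / 50 * b < fnorm (row i (E S) *m H' S).
  move=> lt; have n0 : 0 < norm2inf (H S).
    rewrite lt_def norm2inf_ge0 andbT; apply/eqP => n0; move: lt.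
    have HS0 : H S = 0.
      apply/row_matrixP => j; rewrite row0; apply: fnorm_eq0; apply/le_anti.
      by rewrite fnorm_ge0 -n0 fnorm_row_norm2inf.
    by rewrite n0 HS0 mulmx0 fnorm0 mulr0 ltxx.
  rewrite -scalemxAr fnormZ ger0_norm ?invr_ge0 ?norm2inf_ge0//.
  by rewrite ltr_pdivlMl// mulrC.
apply: (@le_trans _ _ (Expect p (fun S => 2 * expR (- (th * (1 / 50 * b))) *
    cosh (th * fnorm (row i (E S) *m H' S))))).
  apply: le_Expect => // S; apply: le_trans (indicator_le_cosh _ _ (ltW th0)).
  exact/indicator_homo/imp.
have uiu : fnorm (row i U) * u * v2 <= w2.
  by apply: le_trans uv; rewrite ler_wpM2r// ler_wpM2r ?norm2inf_ge0// fnorm_row_norm2inf.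
have ui2 : fnorm (row i U) ^+ 2 * v2 <= w2.
  apply: le_trans uv; rewrite ler_wpM2r//.
  by rewrite ler_pXn2r ?nnegrE ?fnorm_ge0 ?norm2inf_ge0// fnorm_row_norm2inf.
pose y := kap ^+ 4 * ell * w2 / p.
have yp : 64 * 500 ^+ 2 * y <= 1.
  rewrite /y !mulrA ler_pdivrMr// mul1r; apply: le_trans pbig.
  by rewrite le_eqVlt !mulrA eqxx.
have k24 : kap ^+ 2 <= kap ^+ 4 by rewrite ler_weXn2l.
have Lsmall : th * (s 0%N ^+ 2 * fnorm (row i U) * u * v2) * 1 / p <= 1 / 2.
  apply: (@le_trans _ _ (th * (4 * b * kap ^+ 4 * w2) / p)).
    rewrite mulr1 ler_pM2r ?invr_gt0// ler_pM2l//.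
    rewrite -[leLHS]mulrA -[leLHS]mulrA (mulrA _ u); apply: ler_pM => //.
    - exact: sqr_ge0.
    - by rewrite mulr_ge0// mulr_ge0 ?fnorm_ge0 ?norm2inf_ge0.
    - apply: (le_trans sv0_sqr_le); rewrite ler_pM2l// mulr_gt0//.
  rewrite [leLHS](_ : _ = 2000 * y); last by rewrite /th /y; field; rewrite !gt_eqF.
  by move: yp; rewrite /y; lra.
have := row_noise_cosh (ltW th0) ler01 H'd H'1 Lsmall.
rewrite ExpectZ => h.
have V4 : 4 * (th ^+ 2 * 1 ^+ 2 * (s 0%N ^+ 2 * v2) * (s 0%N ^+ 2 * fnorm (row i U) ^+ 2) / p) <= ell.
  apply: (@le_trans _ _ (4 * (th ^+ 2 * ((4 * b * kap ^+ 2) ^+ 2 * w2)) / p)).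
    rewrite [leRHS](_ : _ = 4 * (th ^+ 2 * ((4 * b * kap ^+ 2) ^+ 2 * w2) / p)); last by ring.
    rewrite ler_pM2l// ler_pM2r ?invr_gt0// expr1n mulr1 -mulrA ler_wpM2l ?sqr_ge0//.
    rewrite [leLHS](_ : _ = (s 0%N ^+ 2) ^+ 2 * (fnorm (row i U) ^+ 2 * v2)); last by ring.
    apply: ler_pM => //; first exact: sqr_ge0.
      by rewrite mulr_ge0 ?sqr_ge0.
    rewrite ler_pXn2r ?nnegrE ?sqr_ge0 ?sv0_sqr_le//.
    exact: le_trans (sqr_ge0 _) sv0_sqr_le.
  rewrite [leLHS](_ : _ = 64 * 500 ^+ 2 * y * ell); last first.
    by rewrite /th /y; field; rewrite !gt_eqF.
  by rewrite ler_piMl// ltW.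
apply: (@le_trans _ _ (2 * expR (- (th * (1 / 50 * b))) * expR ell)).
  rewrite ler_wpM2l ?mulr_ge0 ?expR_ge0//; apply: (le_trans h).
  by rewrite ler_expR.
rewrite -mulrA -expRD le_eqVlt; apply/orP; left; apply/eqP; congr (_ * expR _).
by rewrite /th; field; rewrite gt_eqF.
Qed.

Lemma loomx_entry (F : 'M[R]_m) i a c :
  loomx F i a c = (i != a)%:R * ((i != c)%:R * F a c).
Proof.
have dropE n (X : 'M[R]_(m, n)) x y : (dropmx R i *m X) x y = (i != x)%:R * X x y.
  by have /rowP/(_ y) := row_dropmx i x X; rewrite !mxE.
rewrite /loomx -mulmxA dropE; congr (_ * _).
have -> : (F *m dropmx R i) a c = (dropmx R i *m F^T) c a.
  rewrite -[LHS]/((F *m dropmx R i) a c) -[F *m _]trmxK mxE trmx_mul.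
  by congr ((_ *m _) c a); rewrite /dropmx linearB/= trmx1 trmx_delta.
by rewrite dropE mxE.
Qed.

(** The independence behind leave-one-out: the entries that survive the removal of row and column
    [i] come from triples without endpoint [i]. *)
Lemma loomx_noise_eq i (S S' : {set wT m l}) :
  (forall y, y \notin rowtri l i -> (y \in S') = (y \in S)) ->
  loomx (E S') i = loomx (E S) i.
Proof.
move=> SS'; apply/matrixP => a c; rewrite !loomx_entry.
have [_|ia] := eqVneq i a; first by rewrite /= !mul0r.
have [_|ic] := eqVneq i c; first by rewrite /= !mul0r !mulr0.
congr (_ * (_ * _)); rewrite /E !noise_entry; apply: eq_bigr => t _.
by rewrite /centered SS'// rowtri_notin// eq_sym.
Qed.

Lemma loopow_noise_eq i t (S S' : {set wT m l}) :
  (forall y, y \notin rowtri l i -> (y \in S') = (y \in S)) ->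
  loopow (E S') U i t = loopow (E S) U i t.
Proof. by move=> SS'; rewrite /loopow (loomx_noise_eq SS'). Qed.

(** The random hypotheses of the leave-one-out analysis with [eta = 1 / 50] and [m + 5] powers; the
    length is chosen in [loo_good_incoherent]. *)
Definition loo_good (S : {set wT m l}) : Prop :=
  (forall i, `|noise A p S i i| <= 1 / 50 * b) /\
  (forall i (t : 'I_(m + 5)), fnorm (row i (noise A p S) *m loopow (noise A p S) U i t)
     <= 1 / 50 * b * norm2inf (loopow (noise A p S) U i t)).

Lemma Expect_loo_bad : Expect p (fun S => `[< ~ loo_good S >]%:R)
  <= (m * (m + 6))%:R * (2 * expR (- (9 * ell))).
Proof.
(* The diagonal entry is row [i] times a basis vector, so [row_noise_tail] with a constant [H]
   covers it too; each row thus has [1 + (m + 5)] events. *)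
pose dg i (S : {set wT m l}) : R :=
  `[< 1 / 50 * b * norm2inf (delta_mx i 0 : 'cV[R]_m) <
      fnorm (row i (E S) *m (delta_mx i 0 : 'cV[R]_m)) >]%:R.
pose rw i (t : 'I_(m + 5)) (S : {set wT m l}) : R :=
  `[< 1 / 50 * b * norm2inf (loopow (E S) U i t) <
      fnorm (row i (E S) *m loopow (E S) U i t) >]%:R.
apply: (@le_trans _ _ (Expect p (fun S => \sum_i (dg i S + \sum_t rw i t S)))).
  apply: le_Expect => // S; case: asboolP => [bad|_]; last first.
    by apply: sumr_ge0 => i _; rewrite addr_ge0 ?ler0n// sumr_ge0// => t _; rewrite ler0n.
  rewrite leNgt; apply/negP => lt1; apply: bad.
  have key i : dg i S = 0 /\ forall t, rw i t S = 0.
    have : dg i S + \sum_t rw i t S < 1.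
      apply: le_lt_trans lt1; rewrite [leRHS](bigD1 i)//= lerDl sumr_ge0// => j _.
      by rewrite addr_ge0 ?ler0n// sumr_ge0// => t _; rewrite ler0n.
    have rw0 t : 0 <= rw i t S by rewrite ler0n.
    have sm0 : 0 <= \sum_t rw i t S by rewrite sumr_ge0.
    move=> lt; split.
      move: lt; rewrite /dg; case: asboolP => // _ /=; rewrite -subr_gt0 opprD addrA subrr add0r.
      by rewrite oppr_gt0 ltNge sm0.
    move=> t; have : rw i t S < 1.
      apply: le_lt_trans lt; rewrite (bigD1 t)//= addrCA lerDl addr_ge0 ?ler0n//.
      by rewrite sumr_ge0.
    by rewrite /rw; case: asboolP => //=; rewrite ltxx.
  split=> [i|i t]; last first.
    have [_ /(_ t)] := key i; rewrite /rw; case: asboolP => //= [_ /eqP|/negP].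
      by rewrite oner_eq0.
    by rewrite -leNgt.
  have [+ _] := key i; rewrite /dg; case: asboolP => //= [_ /eqP|/negP].
    by rewrite oner_eq0.
  rewrite -leNgt => + _.
  have -> : row i (E S) *m delta_mx i 0 = (E S i i)%:M.
    by rewrite -colE; apply/matrixP => x y; rewrite !ord1 [LHS]mxE [RHS]mxE mxE.
  have -> : fnorm ((E S i i)%:M : 'M_1) = `|E S i i|.
    rewrite -[LHS]ger0_norm ?fnorm_ge0// -sqrtr_sqr sqr_fnorm !big_ord1 [_%:M _ _]mxE.
    by rewrite sqrtr_sqr.
  move=> h; apply: (le_trans h); rewrite ler_piMr//.
    by rewrite mulr_ge0 ?(ltW b0)// divr_ge0.
  by apply: norm2inf_le => // j; apply: (le_trans (fnorm_row_le _ _)); rewrite fnorm_delta_col.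
rewrite Expect_sum.
apply: (@le_trans _ _ (\sum_(i < m) (m + 6)%:R * (2 * expR (- (9 * ell))))); last first.
  by rewrite sumr_const card_ord -[leLHS]mulr_natl natrM mulrA.
apply: ler_sum => i _; rewrite ExpectD Expect_sum.
rewrite (_ : m + 6 = 1 + (m + 5))%N; last by rewrite addnCA.
rewrite natrD mulrDl mul1r; apply: lerD; first exact: (row_noise_tail (H := fun=> _)).
apply: (@le_trans _ _ (\sum_(t < m + 5) (2 * expR (- (9 * ell))))); last first.
  by rewrite sumr_const card_ord -[leLHS]mulr_natl.
by apply: ler_sum => t _; apply: row_noise_tail => S S'; exact: loopow_noise_eq.
Qed.

Lemma sv_sqr_ge (c : 'I_r) : 4 * b <= (\row_(c < r) s c ^+ 2) 0 c.
Proof.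
rewrite mxE /b mulrC divfK ?pnatr_eq0// ler_pXn2r ?nnegrE ?svr_le ?(ltW svr_gt0)//.
by rewrite ltW// s0.
Qed.

Lemma loo_good_incoherent S (Uh : 'M[R]_(m, r)) i :
  opbound (noise A p S) b -> loo_good S -> topeig (wedge p A S) Uh ->
  fnorm (row i Uh) ^+ 2 <= 3 * kap ^+ 4 * u ^+ 2.
Proof.
move=> Eb [gd gr] te.
move: (Eb); rewrite /noise gram_svd => Eb'.
have [L [UhUh ZUh L3]] := topeig_spec iso_leq UU sv_sqr_ge Eb' te.
pose B := diag_mx (\row_(c < r) s c ^+ 2) *m (U^T *m Uh).
have UhL : noise A p S *m Uh + U *m B = Uh *m diag_mx L.
  by rewrite -ZUh /noise gram_svd mulmxBl /B !mulmxA subrK.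
have Bb (y : 'rV[R]_r) : fnorm (y *m B) <= 4 * b * kap ^+ 2 * fnorm y.
  rewrite /B !mulmxA; apply: (le_trans (fnorm_isoR _ UhUh)); rewrite fnorm_isoRT//.
  apply: (le_trans (fnorm_diagR (c := s 0%N ^+ 2) _ _)).
    move=> c; rewrite mxE ger0_norm ?sqr_ge0// ler_pXn2r ?nnegrE ?sv_homo//.
      by rewrite ltW// s0.
    exact: ltW sv0_gt0.
  by rewrite ler_wpM2r ?fnorm_ge0 ?sv0_sqr_le.
have Bb0 : 0 <= 4 * b * kap ^+ 2 by exact: le_trans (sqr_ge0 _) sv0_sqr_le.
have eta0 : 0 <= 1 / 50 :> R by rewrite divr_ge0.
have eta1 : 1 / 50 <= 1 / 3 :> R by lra.
have rs i' t h : (t < m + 5)%N -> (forall j, fnorm (row j (loopow (noise A p S) U i' t)) <= h) ->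
    fnorm (row i' (noise A p S) *m loopow (noise A p S) U i' t) <= 1 / 50 * b * h.
  move=> tT hh; apply: (le_trans (gr i' (Ordinal tT))) => /=.
  rewrite ler_wpM2l ?(mulr_ge0 eta0 (ltW b0))//; apply: norm2inf_le => //.
  exact: le_trans (fnorm_ge0 _) (hh i').
have := row_eigenvectors_le b0 Eb (fnorm_row_norm2inf U) (norm2inf_ge0 U) eta0 eta1
  gd rs UhL UhUh L3 Bb Bb0 i.
rewrite -/u; set x := fnorm _.
have x0 : 0 <= x by exact: fnorm_ge0.
have u0 : 0 <= u by exact: norm2inf_ge0.
(* Incoherence cannot be too good: [r <= m u ^ 2] gives [sqrt r <= m u]. Then [3 ^ m >= m] absorbs
   [m], and the five extra powers give [1 / 243]. *)
have tail : 3^-1 ^+ (m + 5) * Num.sqrt r%:R <= 1 / 100 * u.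
  have mp : (0 < m)%N by exact: leq_trans r0 iso_leq.
  apply: (@le_trans _ _ (3^-1 ^+ (m + 5) * (m%:R * u))).
    rewrite ler_wpM2l ?exprn_ge0 ?invr_ge0//.
    rewrite -(@ler_pXn2r _ 2) ?nnegrE ?sqrtr_ge0 ?mulr_ge0// sqr_sqrtr ?ler0n//.
    apply: (le_trans norm2inf_U_ge); rewrite exprMn ler_wpM2r ?sqr_ge0//.
    by rewrite expr2 ler_peMr ?ler0n// ler1n.
  rewrite mulrA ler_wpM2r// exprD.
  have : 3^-1 ^+ m * m%:R <= 1 :> R.
    rewrite exprVn ler_pdivrMl ?exprn_gt0// mulr1 -natrX ler_nat.
    by rewrite ltnW// ltn_expl.
  rewrite mulrAC; move: (_ * m%:R) => z zl.
  have : 3^-1 ^+ 5 <= 1 / 100 :> R by rewrite !exprS expr0; lra.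
  have : 0 <= 3^-1 ^+ 5 :> R by rewrite exprn_ge0// invr_ge0.
  by move: (3^-1 ^+ 5) => w w0 w1; nra.
have tb := ler_wpM2l (ltW b0) tail => /le_trans /(_ (lerD (lexx _) tb)).
have k1 : 1 <= kap ^+ 2 by rewrite exprn_ege1.
have -> : x * (5 / 2 - 1 / 50) * b = b * (x * (5 / 2 - 1 / 50)) by ring.
have -> : 4 * b * kap ^+ 2 * u * (1 + 2 * (1 / 50)) + b * (1 / 100 * u) =
  b * (4 * kap ^+ 2 * u * (1 + 2 * (1 / 50)) + 1 / 100 * u) by ring.
rewrite ler_pM2l// => h.
have uk : u <= kap ^+ 2 * u by rewrite ler_peMl.
(* [4.17 / 2.48 < 1.7] and [1.7 ^ 2 < 3], which stays below the budget factor 4 used for the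
   diagonal of the projectors. *)
have hx : x <= 17 / 10 * (kap ^+ 2 * u) by lra.
have : x ^+ 2 <= (17 / 10 * (kap ^+ 2 * u)) ^+ 2.
  by rewrite ler_pXn2r ?nnegrE// (le_trans x0).
move=> /le_trans; apply.
have -> : (17 / 10 * (kap ^+ 2 * u)) ^+ 2 = 289 / 100 * (kap ^+ 4 * u ^+ 2) by field.
rewrite -[leRHS]mulrA ler_wpM2r ?mulr_ge0 ?exprn_ge0 ?(ltW kap0)//; lra.
Qed.

Lemma wedge_proj_unique S (Uh1 Uh2 : 'M[R]_(m, r)) :
  opbound (noise A p S) b -> topeig (wedge p A S) Uh1 -> topeig (wedge p A S) Uh2 ->
  Uh1 *m Uh1^T = Uh2 *m Uh2^T.
Proof.
rewrite /noise gram_svd => Eb; exact: (topeig_proj_unique iso_leq b0 UU sv_sqr_ge Eb).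
Qed.

Lemma wedge_iso S (Uh : 'M[R]_(m, r)) :
  opbound (noise A p S) b -> topeig (wedge p A S) Uh -> Uh^T *m Uh = 1%:M.
Proof.
rewrite /noise gram_svd => Eb te.
by have [L []] := topeig_spec iso_leq UU sv_sqr_ge Eb te.
Qed.

(** [A] is [U] times [D V^T], so the error of projecting [U] is transferred to [A] at the price of
    the largest singular value. *)
Lemma wedge_proj_error S (Uh : 'M[R]_(m, r)) :
  opbound (noise A p S) b -> topeig (wedge p A S) Uh ->
  fnorm (A - Uh *m Uh^T *m A) <= s 0%N * (fnorm (noise A p S *m U) / (3 * b)).
Proof.
rewrite /noise gram_svd => Eb te.
have := topeig_proj_error iso_leq b0 UU sv_sqr_ge Eb te.
rewrite -gram_svd => h; apply: le_trans (ler_wpM2l (ltW sv0_gt0) h).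
rewrite {1 2}svd !mulmxA -!mulmxBl fnorm_isoRT//.
apply: fnorm_diagR; exact: sv_le0.
Qed.

End SingularValueDecomposition.

(** * Sums of products over dependent functions *)

Section DependentProducts.
Variable R : realType.

Lemma sum_dffun_prod (I : finType) (T_ : I -> finType) (F : forall i, T_ i -> R) :
  \sum_(f : {dffun forall i, T_ i}) \prod_i F i (f i) = \prod_i \sum_(x : T_ i) F i x.
Proof.
pose P_ i : {ffun T_ i -> R} := [ffun x => F i x].
rewrite (reindex (@dffun_of_fprod I T_)); last exact/onW_bij/dffun_of_fprod_bij.
transitivity (\sum_(t : fprod T_) \prod_(i in I) P_ i (t i)).
  by apply: eq_bigr => t _; apply: eq_bigr => i _; rewrite /P_ !ffunE.
rewrite big_fprod; transitivity (\prod_i \sum_(j in tagged_with T_ i) untag 0 (P_ i) j).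
  by rewrite bigA_distr_big_dep.
by apply: eq_bigr => i _; rewrite -(big_tag P_); apply: eq_bigr => x _; rewrite ffunE.
Qed.

End DependentProducts.

(** * Unfoldings and multi-mode products *)

Section TensorOps.
Variable R : realType.
Variables (k : nat) (n : 'I_k -> nat).
Hypothesis n0 : forall t, (0 < n t)%N.
Implicit Types (x y : idx k n) (Y : idx k n -> R).

Lemma setj_same x j (i : 'I_(n j)) : setj x i j = i.
Proof.
by rewrite /setj ffunE; case: eqP => // e; rewrite (eq_irrelevance e (erefl j)).
Qed.

Lemma setj_other x j (i : 'I_(n j)) t : j != t -> setj x i t = x t.
Proof. by rewrite /setj ffunE; case: eqP => // ->; rewrite eqxx. Qed.

Lemma setj_setj x j (i i' : 'I_(n j)) : setj (setj x i) i' = setj x i'.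
Proof.
apply/ffunP => t; have [e|jt] := eqVneq j t; last by rewrite !setj_other.
by case: _ / e; rewrite !setj_same.
Qed.

Lemma setj_id x j : setj x (x j) = x.
Proof.
apply/ffunP => t; have [e|jt] := eqVneq j t; last by rewrite !setj_other.
by case: _ / e; rewrite setj_same.
Qed.

Definition colof (j : 'I_k) x : colT k n j :=
  exist _ (setj x (Ordinal (n0 j))) (introT eqP (congr1 (@nat_of_ord _) (setj_same x (Ordinal (n0 j))))).

Lemma unfoldE Y j x : unfold Y j (x j) (enum_rank (colof j x)) = Y x.
Proof. by rewrite mxE enum_rankK /= setj_setj setj_id. Qed.

Lemma sum_unfold (f : idx k n -> R) (j : 'I_k) :
  \sum_x f x = \sum_(i < n j) \sum_(c < #|{: colT k n j}|) f (setj (val (enum_val c)) i).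
Proof.
rewrite pair_bigA /=.
apply: (reindex (fun z : 'I_(n j) * 'I_#|{: colT k n j}| => setj (val (enum_val z.2)) z.1)).
apply: onW_bij; exists (fun x => (x j, enum_rank (colof j x))).
  move=> [i c] /=; rewrite setj_same; congr (_, _).
  rewrite -[RHS]enum_valK; congr enum_rank; apply: val_inj => /=.
  rewrite setj_setj; have /eqP e := valP (enum_val c).
  have -> : Ordinal (n0 j) = val (enum_val c) j by apply: val_inj.
  exact: setj_id.
by move=> x /=; rewrite enum_rankK /= setj_setj setj_id.
Qed.

Lemma frob_l2norm Y : frob Y = l2norm Y. Proof. by []. Qed.

Lemma frob_unfold Y j : frob Y = fnorm (unfold Y j).
Proof.
rewrite frob_l2norm -[LHS]ger0_norm ?l2norm_ge0// -sqrtr_sqr.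
rewrite -[RHS]ger0_norm ?fnorm_ge0// -[RHS]sqrtr_sqr sqr_l2norm sqr_fnorm.
rewrite (sum_unfold _ j); congr Num.sqrt; apply: eq_bigr => i _.
by apply: eq_bigr => c _; rewrite mxE.
Qed.

Lemma unfold_mode_prod j (M : 'M[R]_(n j)) Y :
  unfold (mode_prod M Y) j = M *m unfold Y j.
Proof.
apply/matrixP => i c; rewrite !mxE /mode_prod setj_same; apply: eq_bigr => i' _.
by rewrite mxE setj_setj.
Qed.

Lemma unfoldB Y Y' j : unfold (fun x => Y x - Y' x) j = unfold Y j - unfold Y' j.
Proof. by apply/matrixP => i c; rewrite !mxE. Qed.

Variable Q : forall j : 'I_k, 'M[R]_(n j).

Definition fold_modes (s : seq 'I_k) Y :=
  foldl (fun Y' j => mode_prod (Q j) Y') Y s.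

Lemma eq_fold_modes s Y Y' : Y =1 Y' -> fold_modes s Y =1 fold_modes s Y'.
Proof. by move=> /funext ->. Qed.

Lemma fold_modes_sum s (J : finType) (c : J -> R) (F : J -> idx k n -> R) x :
  fold_modes s (fun x => \sum_j c j * F j x) x = \sum_j c j * fold_modes s (F j) x.
Proof.
elim: s F x => //= j s IH F x; rewrite -IH; apply: eq_fold_modes => {}x.
rewrite /mode_prod; under eq_bigr do rewrite mulr_sumr.
rewrite exchange_big; apply: eq_bigr => t _; rewrite mulr_sumr.
by apply: eq_bigr => i _; rewrite mulrCA.
Qed.

Lemma fold_modesB s Y Y' x :
  fold_modes s (fun x => Y x - Y' x) x = fold_modes s Y x - fold_modes s Y' x.
Proof.
have := fold_modes_sum s (fun b : bool => if b then 1 else -1)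
  (fun b => if b then Y else Y') x.
rewrite big_bool/= mul1r mulN1r => <-; apply: eq_fold_modes => y.
by rewrite big_bool/= mul1r mulN1r.
Qed.

Lemma fold_modes_prod s (f : forall t, 'I_(n t) -> R) x : uniq s ->
  fold_modes s (fun y => \prod_t f t (y t)) x =
  \prod_t (if t \in s then \sum_i Q t (x t) i * f t i else f t (x t)).
Proof.
elim: s f x => //= j s IH f x /andP[js us].
pose g t (i : 'I_(n t)) := if t == j then \sum_i' Q t i i' * f t i' else f t i.
rewrite (@eq_fold_modes _ _ (fun y => \prod_t g t (y t))); last first.
  move=> y; rewrite /mode_prod [RHS](bigD1 j)//= {1}/g eqxx mulr_suml.
  apply: eq_bigr => i _; rewrite (bigD1 j)//= setj_same mulrA; congr (_ * _).
  by apply: eq_bigr => t tj; rewrite setj_other 1?eq_sym// /g (negPf tj).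
rewrite IH//; apply: eq_bigr => t _; rewrite inE /g.
by have [e|tj] := eqVneq t j; [rewrite e (negPf js)|].
Qed.

(** [Y] is a combination of point masses; a point mass is a product of one-variable functions, on
    which the modes act factor by factor. *)
Lemma multi_modeE Y y :
  multi_mode Y Q y = \sum_x Y x * \prod_t Q t (y t) (x t).
Proof.
pose d x y := \prod_t ((y t == x t)%:R : R).
have dE x y' : d x y' = (x == y')%:R.
  rewrite /d; case: eqP => [->|xy]; first by rewrite big1// => t _; rewrite eqxx.
  apply/eqP; rewrite prodf_seq_eq0; apply/hasP.
  have [t tn|h] := pickP (fun t => y' t != x t).
    by exists t; rewrite ?mem_index_enum//= (negPf tn).
  by case: xy; apply/ffunP => t; have /negbFE/eqP := h t.
have -> : multi_mode Y Q y = fold_modes (enum 'I_k) (fun y => \sum_x Y x * d x y) y.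
  apply: eq_fold_modes => z; rewrite (bigD1 z)//= big1 ?addr0.
    by rewrite dE eqxx mulr1.
  by move=> x /negPf xz; rewrite dE xz mulr0.
rewrite fold_modes_sum; apply: eq_bigr => x _; congr (_ * _).
rewrite /d (fold_modes_prod (fun t i => (i == x t)%:R)) ?enum_uniq//.
apply: eq_bigr => t _; rewrite mem_enum (bigD1 (x t))//= eqxx mulr1 big1 ?addr0//.
by move=> i /negPf ->; rewrite mulr0.
Qed.

Hypothesis Qcontr : forall j q (X : 'M[R]_(n j, q)), fnorm (Q j *m X) <= fnorm X.

Lemma frob_fold_modes s Y : frob (fold_modes s Y) <= frob Y.
Proof.
elim: s Y => //= j s IH Y; apply: (le_trans (IH _)).
by rewrite !(frob_unfold _ j) unfold_mode_prod Qcontr.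
Qed.

(** Telescoping over the modes: each step leaves the residual of one mode of [Y] itself, pushed
    through the remaining projections, which are contractions. *)
Lemma frob_sub_multi_mode Y :
  frob (fun x => Y x - multi_mode Y Q x) <=
  \sum_j fnorm (unfold Y j - Q j *m unfold Y j).
Proof.
have -> : \sum_j fnorm (unfold Y j - Q j *m unfold Y j) =
    \sum_(j <- enum 'I_k) fnorm (unfold Y j - Q j *m unfold Y j).
  by rewrite big_enum.
rewrite /multi_mode.
elim: (enum 'I_k) Y => [|j s IH] Y /=.
  rewrite big_nil /frob big1 ?sqrtr0// => x _; rewrite subrr expr0n//.
pose Y1 := mode_prod (Q j) Y.
rewrite big_cons addrC.
have -> : (fun x => Y x - fold_modes s Y1 x) =
  (fun x => (Y x - fold_modes s Y x) + fold_modes s (fun x => Y x - Y1 x) x).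
  by apply/funext => x; rewrite fold_modesB addrA subrK.
rewrite frob_l2norm; apply: (le_trans (l2normD _ _)); apply: lerD; first exact: IH.
apply: (le_trans (frob_fold_modes s _)).
by rewrite (frob_unfold _ j) unfoldB unfold_mode_prod.
Qed.

End TensorOps.

(** * Expectation over the wedge samples of all modes *)

Section OutcomeExpectation.
Variable R : realType.
Variables (k : nat) (n : 'I_k -> nat) (p q : R).
Hypothesis p01 : 0 < p <= 1.
Hypothesis q01 : 0 < q <= 1.

Notation wsets := {dffun forall j : 'I_k, {set wT (n j) #|{: colT k n j}|}}.

Definition Expect_wedges (f : wsets -> R) : R :=
  \sum_(w : wsets) (\prod_j bern p (w j)) * f w.

Lemma weight_ge0 (w : wsets) : 0 <= \prod_j bern p (w j).
Proof. by apply: prodr_ge0 => j _; exact: bern_ge0. Qed.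

Lemma le_Expect_wedges f g : (forall w, f w <= g w) ->
  Expect_wedges f <= Expect_wedges g.
Proof. by move=> fg; apply: ler_sum => w _; rewrite ler_wpM2l ?weight_ge0. Qed.

Lemma Expect_wedgesD f g :
  Expect_wedges (fun w => f w + g w) = Expect_wedges f + Expect_wedges g.
Proof. by rewrite -big_split; apply: eq_bigr => w _; rewrite mulrDr. Qed.

Lemma Expect_wedgesZ c f : Expect_wedges (fun w => c * f w) = c * Expect_wedges f.
Proof. by rewrite mulr_sumr; apply: eq_bigr => w _; rewrite mulrCA. Qed.

Lemma Expect_wedges_sum (J : finType) (F : J -> wsets -> R) :
  Expect_wedges (fun w => \sum_j F j w) = \sum_j Expect_wedges (F j).
Proof. by rewrite exchange_big; apply: eq_bigr => w _; rewrite mulr_sumr. Qed.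

Lemma Expect_wedges_prod (F : forall j : 'I_k, {set wT (n j) #|{: colT k n j}|} -> R) :
  Expect_wedges (fun w => \prod_j F j (w j)) = \prod_j Expect p (F j).
Proof.
rewrite /Expect_wedges /Expect.
rewrite -(sum_dffun_prod (fun j (S : {set wT (n j) #|{: colT k n j}|}) => bern p S * F j S)).
by apply: eq_bigr => w _; rewrite big_split.
Qed.

Lemma Expect_wedges_marg (F : forall j : 'I_k, {set wT (n j) #|{: colT k n j}|} -> R) j :
  Expect_wedges (fun w => F j (w j)) = Expect p (F j).
Proof.
pose G t S := if t == j then F t S else 1.
transitivity (Expect_wedges (fun w => \prod_t G t (w t))).
  apply: eq_bigr => w _; congr (_ * _); rewrite (bigD1 j)//= {1}/G eqxx big1 ?mulr1//.
  by move=> t /negPf tj; rewrite /G tj.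
rewrite Expect_wedges_prod (bigD1 j)//= {1}/G eqxx big1 ?mulr1//.
by move=> t /negPf tj; rewrite /G tj Expect1.
Qed.

Lemma Expect_wedges1 : Expect_wedges (fun=> 1) = 1.
Proof.
have := Expect_wedges_prod (fun _ _ => 1).
rewrite [RHS]big1 => [e|j _]; last by rewrite Expect1.
by rewrite -[RHS]e; apply: eq_bigr => w _; rewrite [\prod_(j < k) 1]big1.
Qed.

Lemma Expect_wedges_le f c : (forall w, f w <= c) -> Expect_wedges f <= c.
Proof.
move=> fc; rewrite -[c]mulr1 -Expect_wedges1 -Expect_wedgesZ.
by apply: le_Expect_wedges => w; rewrite mulr1.
Qed.

Lemma probE (Ev : outcome n -> Prop) :
  prob p q Ev = Expect_wedges (fun w => Expect q (fun S => `[< Ev (w, S) >]%:R)).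
Proof.
rewrite /prob big_mkcond /=.
under eq_bigr do rewrite [X in Ev X]surjective_pairing.
rewrite -(pair_bigA _ (fun w S => if `[< Ev (w, S) >] then
  (\prod_j bern p (w j)) * bern q S else 0)) /=.
apply: eq_bigr => w _; rewrite mulr_sumr; apply: eq_bigr => S _.
by case: ifP; rewrite ?mulr1 ?mulr0.
Qed.

(** Two events concern the wedge samples only. The third is bounded for each fixed wedge sample,
    which is where the independence of the entry sampling is used. *)
Lemma prob_union (Ev : outcome n -> Prop) (E1 E2 : wsets -> Prop)
    (E3 : outcome n -> Prop) (c1 c2 c3 : R) :
  (forall w S, Ev (w, S) -> [\/ E1 w, E2 w | E3 (w, S)]) ->
  Expect_wedges (fun w => `[< E1 w >]%:R) <= c1 ->
  Expect_wedges (fun w => `[< E2 w >]%:R) <= c2 ->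
  (forall w, Expect q (fun S => `[< E3 (w, S) >]%:R) <= c3) ->
  prob p q Ev <= c1 + c2 + c3.
Proof.
move=> cover h1 h2 h3; rewrite probE.
apply: (@le_trans _ _ (Expect_wedges (fun w => (`[< E1 w >]%:R + `[< E2 w >]%:R) + c3))).
  apply: le_Expect_wedges => w.
  apply: (@le_trans _ _ (Expect q (fun S =>
      (`[< E1 w >]%:R + `[< E2 w >]%:R) * 1 + `[< E3 (w, S) >]%:R))).
    apply: le_Expect => // S; rewrite mulr1; case: asboolP => [/cover h|_]; last first.
      by rewrite !addr_ge0 ?ler0n.
    have i0 (P : Prop) : 0 <= `[< P >]%:R :> R by rewrite ler0n.
    have iT (P : Prop) : P -> `[< P >]%:R = 1 :> R by move=> hP; rewrite asboolT.
    have := i0 (E1 w); have := i0 (E2 w); have := i0 (E3 (w, S)).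
    by rewrite (erefl : true%:R = 1 :> R); case: h => /iT -> ? ? ?; lra.
  by rewrite ExpectD ExpectZ Expect1 mulr1 lerD2l.
rewrite !Expect_wedgesD; apply: lerD; first exact: lerD.
exact: Expect_wedges_le.
Qed.

End OutcomeExpectation.

(** * Sampling error of the entries for fixed projectors *)

Section EntrySampling.
Variable R : realType.
Variables (k : nat) (n : 'I_k -> nat) (q : R) (T : idx k n -> R).
Hypothesis q01 : 0 < q <= 1.
Variable Q : forall j : 'I_k, 'M[R]_(n j).
Hypothesis QT : forall j, (Q j)^T = Q j.
Hypothesis QQ : forall j, Q j *m Q j = Q j.

Lemma proj_diag_sqr j i : \sum_i' Q j i' i ^+ 2 = Q j i i.
Proof.
rewrite -[in RHS]QQ mxE; apply: eq_bigr => i' _.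
by rewrite expr2; congr (_ * _); rewrite -{1}QT mxE.
Qed.

Lemma proj_diag_ge0 j i : 0 <= Q j i i.
Proof. by rewrite -proj_diag_sqr sumr_ge0// => i' _; exact: sqr_ge0. Qed.

(** Entry [x] contributes [T x] times the tensor product of the columns [x j] of the [Q j]. As each
    [Q j] is a symmetric idempotent, the squared norm of that product is the product of the diagonal
    entries: [G] bounds it pointwise, and summed over [x] it becomes the product of the traces. *)
Lemma sampling_tail (B2 G rk th t : R) : 0 <= th -> 0 <= B2 ->
  (forall x, T x ^+ 2 <= B2) -> (forall x : idx k n, \prod_j Q j (x j) (x j) <= G) ->
  \prod_j \tr (Q j) <= rk ->
  th ^+ 2 * (B2 * G) / q ^+ 2 <= 1 / 4 ->
  Expect q (fun S => `[< t < frob (multi_mode (fun x => T x - q^-1 * POmega S T x) Q) >]%:R)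
  <= 2 * expR (- (th * t) + 4 * (th ^+ 2 * (B2 * rk) / q)).
Proof.
move=> th0 B20 TB QG Qrk small; have /andP[q0 q1] := q01.
pose v (x : idx k n) (S : {set idx k n}) (y : idx k n) :=
  - th * T x * \prod_j Q j (y j) (x j).
have vE x S : l2norm (v x S) ^+ 2 = th ^+ 2 * T x ^+ 2 * \prod_j Q j (x j) (x j).
  rewrite sqr_l2norm; transitivity
    (\sum_(y : idx k n) th ^+ 2 * T x ^+ 2 * \prod_j (Q j (y j) (x j)) ^+ 2).
    by apply: eq_bigr => y _; rewrite /v exprMn -prodrXl; ring.
  rewrite -mulr_sumr (sum_dffun_prod (fun j i => Q j i (x j) ^+ 2)); congr (_ * _).
  by apply: eq_bigr => j _; rewrite proj_diag_sqr.
have QP0 x : 0 <= \prod_j Q j (x j) (x j) by apply: prodr_ge0 => j _; exact: proj_diag_ge0.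
have q20 : 0 <= 1 / 2 * q by rewrite mulr_ge0 ?divr_ge0 ?(ltW q0).
apply: (@le_trans _ _ (Expect q (fun S => 2 * expR (- (th * t)) *
   cosh (l2norm (fun y => \sum_(x <- enum {: idx k n}) centered q S x * v x S y))))).
  apply: le_Expect => // S; apply: le_trans (indicator_le_cosh _ _ th0) _.
  rewrite le_eqVlt; apply/orP; left; apply/eqP; congr (_ * cosh _).
  rewrite frob_l2norm -[th]ger0_norm// -l2normZ; apply: l2norm_ext => y.
  rewrite big_enum multi_modeE mulr_sumr; apply: eq_bigr => x _.
  by rewrite /v /POmega /centered; case: (x \in S); rewrite /=; field; rewrite gt_eqF.
rewrite ExpectZ expRD mulrA ler_wpM2l ?mulr_ge0 ?expR_ge0//.
apply: Expect_cosh_le => //; first exact: enum_uniq.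
- move=> S x _; rewrite ler_pdivrMr// -(@ler_pXn2r _ 2) ?nnegrE ?l2norm_ge0//.
  rewrite vE exprMn; apply: (@le_trans _ _ (th ^+ 2 * (B2 * G))).
    rewrite -mulrA ler_wpM2l ?sqr_ge0// ler_pM ?sqr_ge0//.
  move: small; rewrite ler_pdivrMr ?exprn_gt0// => /le_trans; apply.
  by rewrite le_eqVlt; apply/orP; left; apply/eqP; field.
move=> S; rewrite big_enum -mulr_suml ler_pM2r ?invr_gt0//.
apply: (@le_trans _ _ (\sum_(x : idx k n) th ^+ 2 * B2 * \prod_j Q j (x j) (x j))).
  apply: ler_sum => x _; rewrite vE ler_wpM2r// ler_wpM2l ?sqr_ge0//.
rewrite -mulr_sumr (sum_dffun_prod (fun j i => Q j i i)) [leRHS]mulrA ler_wpM2l//.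
by rewrite mulr_ge0 ?sqr_ge0.
Qed.

End EntrySampling.

(** Tangent line at the mean; the linear corrections sum to zero. *)
Lemma expR_mean_le (R : realType) (k : nat) (z : 'I_k -> R) : (0 < k)%N ->
  expR ((\sum_j z j) / k%:R) <= (\sum_j expR (z j)) / k%:R.
Proof.
move=> k0; have kp : 0 < k%:R :> R by rewrite ltr0n.
set m := _ / _; rewrite ler_pdivlMr//.
have h j : expR m * (1 + (z j - m)) <= expR (z j).
  rewrite -[in leRHS](subrK m (z j)) expRD [leRHS]mulrC.
  by rewrite ler_wpM2l ?expR_ge0 ?expR_ge1Dx.
apply: le_trans (ler_sum _ (fun j _ => h j)); rewrite -mulr_sumr ler_wpM2l ?expR_ge0//.
rewrite big_split/= sumrB !sumr_const card_ord -[1 *+ k]/(k%:R) lerDl.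
have -> : m *+ k = \sum_j z j by rewrite -mulr_natr /m divfK// gt_eqF.
by rewrite subrr.
Qed.

(** The number [m (m + 6)] of leave-one-out events of one mode, times the factor 2 of their tail
    bound. *)
Lemma union_count_le (N m : nat) : (2 <= N)%N -> (m <= N)%N -> (m * (m + 6) * 2 <= N ^ 5)%N.
Proof.
move=> N2 mN; rewrite (_ : N ^ 5 = N * (N * (N * N)) * N)%N; last by rewrite !expnS expn0 !mulnA !muln1.
apply: leq_mul => //; apply: leq_mul => //.
apply: (leq_trans (leq_add mN (leqnn 6))); apply: (@leq_trans (N * 4)).
  by rewrite mulnS leq_add2l (@leq_mul 2 3).
by rewrite leq_mul2l (@leq_mul 2 2) ?orbT.
Qed.

(** * Assembly of the completion error bound *)

Section Completion.
Variable R : realType.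
Variables (k : nat) (n : 'I_k -> nat) (T : idx k n -> R) (r : nat).
Variables (U : forall j : 'I_k, 'M[R]_(n j, r)).
Variables (V : forall j : 'I_k, 'M[R]_(#|{: colT k n j}|, r)).
Variables (s : 'I_k -> nat -> R) (mu1 mu2 a p q : R).
Hypothesis k2 : (2 <= k)%N.
Hypothesis n0 : forall t, (0 < n t)%N.
Hypothesis r0 : (0 < r)%N.
Hypothesis a2 : 2 <= a.
Hypothesis p01 : 0 < p <= 1.
Hypothesis q01 : 0 < q <= 1.
Hypothesis UU : forall j, (U j)^T *m U j = 1%:M.
Hypothesis VV : forall j, (V j)^T *m V j = 1%:M.
Hypothesis s0 : forall j i, (i < r)%N -> 0 < s j i.
Hypothesis sS : forall j i, (i.+1 < r)%N -> s j i.+1 <= s j i.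
Hypothesis svd : forall j,
  unfold T j = U j *m diag_mx (\row_(i < r) s j i) *m (V j)^T.
Hypothesis Uinc : forall j, norm2inf (U j) ^+ 2 <= mu1 * (r%:R / (n j)%:R).
Hypothesis Vinc : forall j,
  norm2inf (V j) ^+ 2 <= mu2 * (r%:R / (\prod_(t < k | t != j) n t)%:R).
Let kappa := \big[Num.max/0]_(j < k) (s j 0%N / s j r.-1).
Let nmax := (\max_(t < k) n t)%N.
Let ntot := (\prod_(t < k) n t)%N.
Hypothesis nmax2 : (2 <= nmax)%N.
Hypothesis pbig0 :
  64 * 500 ^+ 2 * kappa ^+ 4 * a * mu1 * mu2 * ((r%:R ^+ 2 * ln nmax%:R) / ntot%:R) <= p.
Hypothesis qbig0 : a * (k.-1)%:R * ln nmax%:R / ntot%:R <= q.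

Let x := ln (nmax%:R : R).
Let ell := a * x.
(** The product of the two incoherence bounds. Since [n j * Nj j = ntot] it is the same for every
    mode, and it governs both samplings. *)
Let w2 := mu1 * mu2 * r%:R ^+ 2 / ntot%:R.
Let eps := Num.sqrt (a * mu1 * mu2 * r%:R ^+ 2 * x / (p * ntot%:R)).
Let b j := s j r.-1 ^+ 2 / 4.
Let E j S := noise (unfold T j) p S.
Let F := frob T.

Let j0 : 'I_k := Ordinal (ltnW k2).

Let p0 : 0 < p. Proof. by case/andP: p01. Qed.
Let q0 : 0 < q. Proof. by case/andP: q01. Qed.
Let a0 : 0 < a. Proof. by apply: lt_le_trans a2. Qed.
Let rp : 0 < r%:R :> R. Proof. by rewrite ltr0n. Qed.
Let r1 : 1 <= r%:R :> R. Proof. by rewrite ler1n. Qed.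
Let nmaxp : 0 < nmax%:R :> R. Proof. by rewrite ltr0n ltnW. Qed.
Let x0 : 0 < x. Proof. by rewrite ln_gt0// ltr1n. Qed.
Let ell0 : 0 < ell. Proof. by rewrite mulr_gt0. Qed.
Let nn0 j : 0 < (n j)%:R :> R. Proof. by rewrite ltr0n. Qed.
Let n_le j : (n j <= nmax)%N. Proof. exact: leq_bigmax. Qed.
Let ntot0 : 0 < ntot%:R :> R.
Proof. by rewrite ltr0n prodn_gt0. Qed.
Let nmaxE : nmax%:R = expR x. Proof. by rewrite lnK ?posrE. Qed.

Let Nj j := ((\prod_(t < k | t != j) n t)%N%:R : R).
Let Nj0 j : 0 < Nj j. Proof. by rewrite ltr0n prodn_cond_gt0. Qed.
Let ntotE j : ntot%:R = (n j)%:R * Nj j.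
Proof. by rewrite -natrM /ntot (bigD1 j). Qed.

(** The squared row norms of [U j] sum to [r], so the largest is at least their average
    [r / n j]. *)
Lemma mu1_ge1 : 1 <= mu1.
Proof.
have h := norm2inf_U_ge (UU j0).
have := le_trans h (ler_wpM2l (ltW (nn0 j0)) (Uinc j0)).
rewrite [leRHS](_ : _ = mu1 * r%:R); last by field; rewrite gt_eqF.
by rewrite -[leLHS]mul1r ler_pM2r.
Qed.

Lemma mu2_gt0 : 0 < mu2.
Proof.
have h := norm2inf_U_ge (VV j0).
have := lt_le_trans rp (le_trans h (ler_wpM2l (ler0n _ _) (Vinc j0))).
move=> h1; rewrite ltNge; apply/negP => m0; move: h1; rewrite ltNge; case/negP.
rewrite mulr_ge0_le0 ?ler0n// mulr_le0_ge0// divr_ge0 ?ler0n//.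
Qed.

Let mu10 : 0 < mu1. Proof. exact: lt_le_trans mu1_ge1. Qed.

Let w20 : 0 < w2.
Proof. by rewrite divr_gt0// mulr_gt0 ?exprn_gt0// mulr_gt0// mu2_gt0. Qed.

Let v2 j := mu2 * (r%:R / Nj j).
Let v20 j : 0 <= v2 j. Proof. exact: le_trans (sqr_ge0 _) (Vinc j). Qed.

Let Vv j c : fnorm (row c (V j)) ^+ 2 <= v2 j.
Proof.
apply: le_trans (Vinc j).
by rewrite ler_pXn2r ?nnegrE ?fnorm_ge0 ?norm2inf_ge0// fnorm_row_norm2inf.
Qed.

Let uv j : norm2inf (U j) ^+ 2 * v2 j <= w2.
Proof.
apply: (le_trans (ler_wpM2r (v20 j) (Uinc j))).
rewrite le_eqVlt /w2 /v2 (ntotE j); apply/orP; left; apply/eqP; field.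
by rewrite -/(Nj j) !gt_eqF.
Qed.

Let svr0 j : 0 < s j r.-1. Proof. exact: (svr_gt0 r0 (s0 j)). Qed.
Let sv00 j : 0 < s j 0%N. Proof. exact: s0. Qed.

Let kappa_ge j : s j 0%N / s j r.-1 <= kappa.
Proof. exact: (le_bigmax_cond 0 (fun j => s j 0%N / s j r.-1)). Qed.

Let skap j : s j 0%N <= kappa * s j r.-1.
Proof. by rewrite -ler_pdivrMr. Qed.

Let kappa1 : 1 <= kappa.
Proof.
apply: le_trans (kappa_ge j0); rewrite ler_pdivlMr// mul1r.
exact: (svr_le r0 (sS j0) (Ordinal r0)).
Qed.

Let kappa0 : 0 < kappa. Proof. exact: lt_le_trans kappa1. Qed.

Let pbig : 64 * 500 ^+ 2 * kappa ^+ 4 * ell * w2 <= p.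
Proof.
apply: le_trans pbig0; rewrite le_eqVlt /ell /w2 -/x; apply/orP; left; apply/eqP.
by field; rewrite gt_eqF.
Qed.

Let eps2 : eps ^+ 2 = ell * w2 / p.
Proof.
rewrite /eps sqr_sqrtr.
  by rewrite /ell /w2; field; rewrite !gt_eqF.
rewrite divr_ge0 ?mulr_ge0 ?sqr_ge0 ?(ltW a0) ?(ltW mu10) ?(ltW mu2_gt0) ?(ltW x0) ?(ltW p0) ?(ltW ntot0)//.
Qed.

Let eps0 : 0 < eps.
Proof.
by rewrite sqrtr_gt0 divr_gt0 ?mulr_gt0 ?exprn_gt0 ?mu2_gt0.
Qed.

Let eps1 : eps <= 1.
Proof.
rewrite -(@ler_pXn2r _ 2) ?nnegrE ?(ltW eps0)// eps2 expr1n ler_pdivrMr// mul1r.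
apply: le_trans pbig; rewrite -[leRHS]mulrA ler_peMl ?(mulr_ge0 (ltW ell0) (ltW w20))//.
have k4 : 1 <= kappa ^+ 4 by rewrite exprn_ege1.
by rewrite mulr_ege1// mulr_ege1 ?exprn_ege1// ler1n.
Qed.

Let yerr (w : {dffun forall j : 'I_k, {set wT (n j) #|{: colT k n j}|}}) j : R :=
  fnorm (E (w j) *m U j) / (s j 0%N ^+ 2 * Num.sqrt r%:R * eps).

(** If the average of [yerr] exceeds 4, the average of [exp (ell / 2 * yerr)] exceeds [exp (2 ell)],
    whereas each cosh moment is at most [exp ell]; Markov's inequality leaves [2 exp (- ell)]. *)
Lemma noise_event : Expect_wedges p (fun w => `[< 4 * k%:R < \sum_j yerr w j >]%:R)
  <= 2 * expR (- ell).
Proof.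
have kp : 0 < k%:R :> R by rewrite ltr0n ltnW.
apply: (@le_trans _ _ (Expect_wedges p (fun w =>
   \sum_j 2 * expR (- (2 * ell)) / k%:R * cosh (ell / 2 * yerr w j)))).
  apply: le_Expect_wedges => // w; rewrite -mulr_sumr.
  have pos : 0 <= \sum_j cosh (ell / 2 * yerr w j).
    by rewrite sumr_ge0// => j _; rewrite ltW ?cosh_gt0.
  have c0 : 0 <= 2 * expR (- (2 * ell)) / k%:R by rewrite divr_ge0 ?mulr_ge0 ?expR_ge0 ?ler0n.
  case: asboolP => [lt|_]; last exact: mulr_ge0.
  have h : expR (2 * ell) <= expR ((\sum_j ell / 2 * yerr w j) / k%:R).
    rewrite ler_expR ler_pdivlMr// -mulr_sumr.
    have := ler_wpM2l (ltW ell0) (ltW lt); lra.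
  have := le_trans h (expR_mean_le _ (ltnW k2)).
  rewrite ler_pdivlMr// => h1.
  have h2 : \sum_j expR (ell / 2 * yerr w j) <= \sum_j 2 * cosh (ell / 2 * yerr w j).
    by apply: ler_sum => j _; exact: expR_le_cosh.
  have := le_trans h1 h2; rewrite -mulr_sumr.
  rewrite expRN => h3; rewrite (erefl : true%:R = 1 :> R).
  rewrite [leRHS](_ : _ = (2 * \sum_j cosh (ell / 2 * yerr w j)) / (expR (2 * ell) * k%:R)).
    by rewrite ler_pdivlMr ?mul1r// mulr_gt0 ?expR_gt0.
  by field; rewrite !gt_eqF ?expR_gt0.
rewrite Expect_wedges_sum.
apply: (@le_trans _ _ (\sum_(j < k) 2 * expR (- (2 * ell)) / k%:R * expR ell)).
  apply: ler_sum => j _; rewrite Expect_wedgesZ ler_wpM2l//.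
    by rewrite divr_ge0 ?mulr_ge0 ?expR_ge0 ?ler0n.
  rewrite (Expect_wedges_marg p (fun j S => cosh (ell / 2 *
    (fnorm (E S *m U j) / (s j 0%N ^+ 2 * Num.sqrt r%:R * eps)))) j).
  exact: (noise_mode_cosh r0 (UU j) (VV j) (s0 j) (sS j) (svd j) p01 (@Vv j) (v20 j) (uv j)
    ell0 eps0 eps1 eps2).
rewrite sumr_const card_ord -[leLHS]mulr_natl.
have -> : - (2 * ell) = - ell + - ell by ring.
rewrite expRD [in leLHS]expRN le_eqVlt; apply/orP; left; apply/eqP.
by rewrite expRN; field; rewrite !gt_eqF ?expR_gt0.
Qed.

Notation wset j := {set wT (n j) #|{: colT k n j}|}.
Let wsets := {dffun forall j : 'I_k, {set wT (n j) #|{: colT k n j}|}}.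

Let good j (S : {set wT (n j) #|{: colT k n j}|}) : Prop :=
  loo_good (unfold T j) (U j) (s j) p S.

(** [nmax ^ 5 = exp (5 x)] is at most [exp (5 / 2 ell)] because [a >= 2], and
    [9 - 5 / 2 = 13 / 2]. *)
Lemma mode_bad_le j :
  Expect p (fun S : wset j => `[< ~ good S >]%:R) <= expR (- (13 / 2 * ell)).
Proof.
apply: (le_trans (Expect_loo_bad r0 (UU j) (VV j) (s0 j) (sS j) (svd j) p01 (@Vv j) (v20 j)
  (uv j) ell0 kappa1 (skap j) pbig)).
have e1 : (n j * (n j + 6))%:R * 2 <= expR (5 / 2 * ell).
  apply: (@le_trans _ _ (nmax ^ 5)%N%:R).
    by rewrite -natrM ler_nat union_count_le.
  rewrite natrX nmaxE -expRM_natl ler_expR /ell.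
  have : 2 * x <= a * x by rewrite ler_pM2r.
  lra.
have -> : expR (- (13 / 2 * ell)) = expR (5 / 2 * ell) * expR (- (9 * ell)).
  by rewrite -expRD; congr expR; field.
by rewrite mulrA ler_wpM2r ?expR_ge0.
Qed.

(* Diagonal entries of [Q j] are at most [fac w j * cell j]: the leave-one-out
   bound loses a factor 3 / 4 against the budget [cell j], the trivial bound 1
   exceeds it by at most [nmax]. *)
Let fac (w : wsets) j : R := 3 / 4 * (if `[< good (w j) >] then 1 else nmax%:R).

Lemma coherent_event : Expect_wedges p (fun w => `[< 1 < \prod_j fac w j >]%:R)
  <= expR (- ell).
Proof.
have x2 : 2 * x <= ell by rewrite /ell ler_pM2r.
have fac0 w j : 0 <= fac w j.
  by rewrite mulr_ge0 ?divr_ge0//; case: ifP => _; rewrite ?ler0n.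
have [knmax|nmaxk] := leqP k nmax.
  apply: (@le_trans _ _ (Expect_wedges p (fun w => \sum_j `[< ~ good (w j) >]%:R))).
    apply: le_Expect_wedges => // w.
    have [h|/existsNP[j hj]] := pselect (forall j, good (w j)).
      have le1 : \prod_j fac w j <= 1.
        by apply: prodr_ile1 => j _; rewrite fac0 /fac asboolT//=; lra.
      rewrite asboolF; last by apply/negP; rewrite -leNgt.
      by rewrite sumr_ge0// => j _; rewrite ler0n.
    apply: (@le_trans _ _ `[< ~ good (w j) >]%:R); first by apply: indicator_homo => _.
    by rewrite [leRHS](bigD1 j)//= lerDl sumr_ge0// => t _; rewrite ler0n.
  rewrite Expect_wedges_sum.
  apply: (@le_trans _ _ (\sum_(j < k) expR (- (13 / 2 * ell)))).
    apply: ler_sum => j _; rewrite (Expect_wedges_marg p (fun j (S : wset j) => `[< ~ good S >]%:R) j).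
    exact: mode_bad_le.
  rewrite sumr_const card_ord -[leLHS]mulr_natl.
  apply: (@le_trans _ _ (expR x * expR (- (13 / 2 * ell)))).
    by rewrite ler_wpM2r ?expR_ge0// -nmaxE ler_nat.
  by rewrite -expRD ler_expR; have := ell0; lra.
(* Markov's inequality is applied to the [M]-th power of the product. [M <= 13 / 2 a] lets the
   probability of a bad mode pay for [nmax ^ M], and [M >= 6 a] turns [(3 / 4) ^ M] into
   [exp (- 3 / 2 a)]; [a >= 2] leaves room for an integer in between. *)
pose M := (Num.truncn (6 * a)).+1.
have M1 : 6 * a <= M%:R.
  have /truncn_itv/andP[_ /ltW] : 0 <= 6 * a by rewrite mulr_ge0// ltW.
  by [].
have M2 : M%:R <= 13 / 2 * a.
  have /truncn_itv/andP[+ _] : 0 <= 6 * a by rewrite mulr_ge0// ltW.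
  by rewrite /M -natr1; have := a2; lra.
apply: (@le_trans _ _ (Expect_wedges p (fun w => \prod_j (fac w j) ^+ M))).
  apply: le_Expect_wedges => // w; rewrite prodrXl; case: asboolP => [lt|_].
    by rewrite exprn_ege1// ltW.
  by rewrite exprn_ge0// prodr_ge0.
rewrite (Expect_wedges_prod p (fun j (S : wset j) =>
   (3 / 4 * (if `[< good S >] then 1 else nmax%:R)) ^+ M)).
have fj j : 0 <= Expect p (fun S : wset j =>
   (3 / 4 * (if `[< good S >] then 1 else nmax%:R)) ^+ M) <= expR (- a).
  apply/andP; split.
    apply: sumr_ge0 => S _; rewrite mulr_ge0 ?bern_ge0// exprn_ge0//.
    by rewrite mulr_ge0 ?divr_ge0//; case: ifP => _; rewrite ?ler0n.
  apply: (@le_trans _ _ (Expect p (fun S : wset j =>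
     (3 / 4) ^+ M * (1 + nmax%:R ^+ M * `[< ~ good S >]%:R)))).
    apply: le_Expect => // S; rewrite exprMn ler_wpM2l ?exprn_ge0 ?divr_ge0//.
    have [g|g] := pselect (good S).
      by rewrite asboolT// expr1n lerDl mulr_ge0 ?exprn_ge0 ?ler0n.
    by rewrite asboolF// (asboolT g) mulr1 lerDr.
  rewrite ExpectZ ExpectD Expect1 ExpectZ.
  have h1 : nmax%:R ^+ M * Expect p (fun S : wset j => `[< ~ good S >]%:R) <= 1.
    apply: (le_trans (ler_wpM2l _ (mode_bad_le j))); first by rewrite exprn_ge0 ?ler0n.
    rewrite nmaxE -expRM_natl -expRD expR_le1 /ell.
    have := ler_wpM2r (ltW x0) M2; lra.
  have h2 : (3 / 4) ^+ M <= expR (- (3 / 2 * a)).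
    apply: (@le_trans _ _ (expR (- (1 / 4)) ^+ M)).
      rewrite ler_pXn2r ?nnegrE ?divr_ge0 ?expR_ge0//.
      by apply: le_trans (expR_ge1Dx _); lra.
    rewrite -expRM_natl ler_expR; lra.
  have h3 : 2 <= expR (1 / 2 * a).
    by apply: le_trans (expR_ge1Dx _); have := a2; lra.
  apply: (@le_trans _ _ (expR (- (3 / 2 * a)) * 2)).
    apply: ler_pM => //; first by rewrite exprn_ge0 ?divr_ge0.
      rewrite addr_ge0// mulr_ge0 ?exprn_ge0 ?ler0n//.
      by apply: sumr_ge0 => S _; rewrite mulr_ge0 ?bern_ge0 ?ler0n.
    lra.
  apply: (@le_trans _ _ (expR (- (3 / 2 * a)) * expR (1 / 2 * a))).
    by rewrite ler_wpM2l ?expR_ge0.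
  by rewrite -expRD ler_expR; have := a0; lra.
apply: (@le_trans _ _ (\prod_(j < k) expR (- a))).
  by apply: ler_prod => j _; exact: fj.
(* Each mode contributes [exp (- a)], and there are [k > nmax >= ln nmax] of them. *)
rewrite prodr_const card_ord -expRM_natl ler_expR mulrN lerN2 /ell mulrC ler_pM2r//.
apply: (@le_trans _ _ nmax%:R); last by rewrite ler_nat ltnW.
by rewrite ltW// ln_sublinear.
Qed.

Let F0 : 0 < F.
Proof.
rewrite /F (frob_unfold n0 T j0); apply: lt_le_trans (sv00 j0) _.
exact: (sv0_le_fnorm r0 (UU j0) (VV j0) (s0 j0) (svd j0)).
Qed.

Let sv0F j : s j 0%N <= F.
Proof.
rewrite /F (frob_unfold n0 T j).
exact: (sv0_le_fnorm r0 (UU j) (VV j) (s0 j) (svd j)).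
Qed.

Lemma entry_sqr_le y : T y ^+ 2 <= F ^+ 2 * w2.
Proof.
rewrite -(unfoldE n0 T j0 y) -real_normK ?num_real//.
set i := y j0; set c := enum_rank _.
have h := entry_svd (s0 j0) (sS j0) (svd j0) i c.
have sU0 : 0 <= s j0 0%N * fnorm (row i (U j0)) * fnorm (row c (V j0)).
  by rewrite mulr_ge0 ?fnorm_ge0// mulr_ge0 ?fnorm_ge0 ?(ltW (sv00 j0)).
apply: (@le_trans _ _ ((s j0 0%N * fnorm (row i (U j0)) * fnorm (row c (V j0))) ^+ 2)).
  by rewrite ler_pXn2r ?nnegrE.
rewrite 2!exprMn -mulrA; apply: ler_pM; rewrite ?sqr_ge0//.
- by rewrite mulr_ge0 ?sqr_ge0.
- by rewrite ler_pXn2r ?nnegrE ?(ltW (sv00 j0)) ?(ltW F0).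
apply: le_trans (uv j0); apply: ler_pM; rewrite ?sqr_ge0//.
by rewrite ler_pXn2r ?nnegrE ?fnorm_ge0 ?norm2inf_ge0// fnorm_row_norm2inf.
Qed.

Let cond (w : wsets) : Prop := forall j, opbound (E (w j)) (b j).

Lemma proj_diagE m' (M : 'M[R]_(m', r)) i : (M *m M^T) i i = fnorm (row i M) ^+ 2.
Proof.
by rewrite sqr_fnorm big_ord1 mxE; apply: eq_bigr => c _; rewrite !mxE expr2.
Qed.

Let cell j := 4 * kappa ^+ 4 * mu1 * r%:R / (n j)%:R.

Let cell0 j : 0 < cell j.
Proof. by rewrite divr_gt0// mulr_gt0// mulr_gt0// mulr_gt0// exprn_gt0. Qed.

Lemma proj_diag_le (w : wsets) j (Uh : 'M[R]_(n j, r)) i : cond w ->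
  topeig (wedge p (unfold T j) (w j)) Uh -> (Uh *m Uh^T) i i <= fac w j * cell j.
Proof.
move=> cw te; rewrite proj_diagE.
have UhUh := wedge_iso r0 (UU j) (VV j) (s0 j) (sS j) (svd j) (cw j) te.
rewrite /fac; have [g|g] := pselect (good (w j)).
  rewrite asboolT// mulr1.
  apply: (le_trans (loo_good_incoherent r0 (UU j) (VV j) (s0 j) (sS j) (svd j) kappa1 (skap j) i (cw j) g te)).
  apply: (@le_trans _ _ (3 * kappa ^+ 4 * (mu1 * (r%:R / (n j)%:R)))).
    by rewrite ler_wpM2l// mulr_ge0 ?exprn_ge0 ?(ltW kappa0).
  by rewrite le_eqVlt /cell; apply/orP; left; apply/eqP; field; rewrite gt_eqF.
rewrite asboolF//.
apply: (@le_trans _ _ 1).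
  rewrite -(expr1n _ 2) ler_pXn2r ?nnegrE ?fnorm_ge0// rowE.
  apply: (le_trans (fnorm_isoR _ UhUh)); rewrite -fnorm_trmx trmx_delta.
  by rewrite fnorm_delta_col.
rewrite [leRHS](_ : _ = 3 * (nmax%:R / (n j)%:R) * (kappa ^+ 4 * mu1 * r%:R)); last first.
  by rewrite /cell; field; rewrite gt_eqF.
rewrite mulr_ege1//.
  have : 1 <= nmax%:R / (n j)%:R :> R by rewrite ler_pdivlMr// mul1r ler_nat.
  lra.
by rewrite mulr_ege1// mulr_ege1 ?mu1_ge1// exprn_ege1.
Qed.

Let L' := a * (k.-1)%:R * x.
(** The second term of the error bound; the square root of [r ^ (k + 3)] is [r] to the power
    [1.5 + k / 2]. In [tau2], the [k]-th power is the product of the numerators of the [cell j]. *)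
Let tau := 2 ^+ k * Num.sqrt (r%:R ^+ (k + 3)) * kappa ^+ (2 * k)
  * Num.sqrt (a * (k.-1)%:R * mu1 ^+ k.+1 * mu2 * x / (q * ntot%:R)) * F.

Let ell_le : ell <= L'.
Proof.
rewrite /L' mulrAC ler_peMr ?(ltW ell0)// ler1n.
by move: k2; case: (k) => [|[]].
Qed.

Let L'0 : 0 < L'. Proof. exact: lt_le_trans ell_le. Qed.

Let tau2 : tau ^+ 2 = (4 * kappa ^+ 4 * mu1 * r%:R) ^+ k * r%:R * (L' * (F ^+ 2 * w2) / q).
Proof.
rewrite /tau !exprMn sqr_sqrtr ?exprn_ge0 ?ler0n// sqr_sqrtr; last first.
  rewrite divr_ge0 ?mulr_ge0 ?exprn_ge0 ?ler0n ?(ltW a0) ?(ltW mu10) ?(ltW mu2_gt0) ?(ltW x0) ?(ltW q0) ?(ltW ntot0)//.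
have -> : (2 ^+ k) ^+ 2 = 4 ^+ k :> R by rewrite exprAC; congr (_ ^+ _); ring.
have -> : (kappa ^+ (2 * k)) ^+ 2 = kappa ^+ k * (kappa ^+ k * (kappa ^+ k * kappa ^+ k)).
  by rewrite -exprM -!exprD; congr (_ ^+ _); rewrite mulnC !mul2n -!addnn !addnA.
rewrite exprD [mu1 ^+ k.+1]exprS /w2 /L'; field; rewrite !gt_eqF//.
Qed.

Let tau0 : 0 < tau.
Proof.
have : 0 < tau ^+ 2.
  rewrite tau2 mulr_gt0//.
    by rewrite mulr_gt0// exprn_gt0// mulr_gt0// mulr_gt0// mulr_gt0// exprn_gt0.
  by rewrite divr_gt0// mulr_gt0// mulr_gt0// exprn_gt0.
have : 0 <= tau.
  rewrite /tau mulr_ge0 ?(ltW F0)// mulr_ge0 ?sqrtr_ge0// mulr_ge0 ?exprn_ge0 ?(ltW kappa0)//.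
  by rewrite mulr_ge0 ?sqrtr_ge0// exprn_ge0.
by rewrite le_eqVlt => /predU1P[<-|//]; rewrite expr0n ltxx.
Qed.

Let Qof (Uh : forall j : 'I_k, 'M[R]_(n j, r)) j := Uh j *m (Uh j)^T.

Let E3 (w : outcome n) : Prop := [/\ cond w.1, \prod_j fac w.1 j <= 1
  & exists2 Uh : forall j : 'I_k, 'M[R]_(n j, r),
     (forall j, topeig (wedge p (unfold T j) (w.1 j)) (Uh j))
     & 4 * tau < frob (multi_mode (fun y => T y - q^-1 * POmega w.2 T y) (Qof Uh))].

Lemma sampling_event (w : wsets) :
  Expect q (fun S => `[< E3 (w, S) >]%:R) <= 2 * expR (- ell).
Proof.
have e0 := expR_ge0 (- ell).
have [[cw fw [Uh te]]|no] := pselect [/\ cond w, \prod_j fac w j <= 1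
  & exists Uh : forall j : 'I_k, 'M[R]_(n j, r),
     forall j, topeig (wedge p (unfold T j) (w j)) (Uh j)]; last first.
  apply: Expect_le => // S; rewrite asboolF ?mulr_ge0// => -[cw fw [Uh te _]].
  by apply: no; split => //; exists Uh.
have iso j := wedge_iso r0 (UU j) (VV j) (s0 j) (sS j) (svd j) (cw j) (te j).
have QT j : (Qof Uh j)^T = Qof Uh j by rewrite trmx_mul trmxK.
have QQ j : Qof Uh j *m Qof Uh j = Qof Uh j.
  by rewrite /Qof mulmxA -(mulmxA (Uh j)) iso mulmx1.
(* The threshold [4 tau] then contributes [- 2 L'] to the exponent, of which the variance gives back
   at most [L']; finally [ell <= L']. *)
pose th := L' / (2 * tau).
pose B2 := F ^+ 2 * w2.
pose G := (4 * kappa ^+ 4 * mu1 * r%:R) ^+ k / ntot%:R.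
have K1 : 1 <= (4 * kappa ^+ 4 * mu1 * r%:R) ^+ k.
  rewrite exprn_ege1// mulr_ege1// mulr_ege1 ?mu1_ge1// mulr_ege1 ?exprn_ege1//.
  by rewrite ler1n.
have B20 : 0 < B2 by rewrite mulr_gt0// exprn_gt0.
have QG (y : idx k n) : \prod_j Qof Uh j (y j) (y j) <= G.
  apply: (@le_trans _ _ (\prod_j (fac w j * cell j))).
    apply: ler_prod => j _; rewrite proj_diag_le ?(te j)// andbT.
    by rewrite proj_diagE sqr_ge0.
  rewrite big_split/=; have -> : G = \prod_j cell j.
    rewrite /G /cell -[X in X ^+ _]/(4 * kappa ^+ 4 * mu1 * r%:R) prodf_div.
    by rewrite prodr_const card_ord /ntot natr_prod.
  by rewrite ler_piMl// prodr_ge0// => j _; exact: ltW.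
have Qrk : \prod_j \tr (Qof Uh j) <= r%:R ^+ k.
  rewrite (eq_bigr (fun=> r%:R)) ?prodr_const ?card_ord// => j _.
  by rewrite mxtrace_mulC iso mxtrace1.
have tn0 : tau != 0 by rewrite gt_eqF.
(* The lower bound on [q] enters here, as [L' / ntot <= q]; it keeps single summands small. *)
have small : th ^+ 2 * (B2 * G) / q ^+ 2 <= 1 / 4.
  have -> : th ^+ 2 * (B2 * G) / q ^+ 2 = 1 / 4 * ((L' ^+ 2 * B2 * G / q ^+ 2) / tau ^+ 2).
    by rewrite /th; field; rewrite tn0 gt_eqF.
  rewrite ler_piMr ?divr_ge0// ler_pdivrMr ?exprn_gt0// mul1r tau2 -/B2.
  have -> : L' ^+ 2 * B2 * G / q ^+ 2 =
      (4 * kappa ^+ 4 * mu1 * r%:R) ^+ k * (L' / ntot%:R / q) * (L' * B2 / q).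
    by rewrite /G; field; rewrite !gt_eqF.
  rewrite ler_wpM2r ?(divr_ge0 (mulr_ge0 (ltW L'0) (ltW B20)) (ltW q0))//.
  rewrite ler_wpM2l ?(le_trans ler01 K1)//; apply: le_trans r1.
  by rewrite ler_pdivrMr// mul1r.
have th0 : 0 < th by rewrite divr_gt0// mulr_gt0.
apply: (@le_trans _ _ (Expect q (fun S =>
    `[< 4 * tau < frob (multi_mode (fun y => T y - q^-1 * POmega S T y) (Qof Uh)) >]%:R))).
  (* The event may pick another eigenbasis for each [S]; all of them give the projectors of the
     fixed [Uh]. *)
  apply: le_Expect => // S; apply: indicator_homo => -[_ _ [Uh' te' lt]].
  have -> : Qof Uh = Qof Uh'; last exact: lt.
  apply: functional_extensionality_dep => j.
  exact: (wedge_proj_unique r0 (UU j) (VV j) (s0 j) (sS j) (svd j) (cw j) (te j) (te' j)).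
apply: (le_trans (sampling_tail q01 QT QQ (4 * tau) (ltW th0) (ltW B20) entry_sqr_le QG Qrk small)).
rewrite ler_pM2l// ler_expR.
have -> : th * (4 * tau) = 2 * L' by rewrite /th; field.
suff : 4 * (th ^+ 2 * (B2 * r%:R ^+ k) / q) <= L' by have := ell_le; lra.
have -> : 4 * (th ^+ 2 * (B2 * r%:R ^+ k) / q) =
    L' * ((L' * B2 / q * r%:R ^+ k) / tau ^+ 2).
  by rewrite /th; field; rewrite tn0 gt_eqF.
rewrite ler_piMr ?(ltW L'0)// ler_pdivrMr ?exprn_gt0// mul1r tau2 -/B2 [leLHS]mulrC.
rewrite ler_wpM2r ?(divr_ge0 (mulr_ge0 (ltW L'0) (ltW B20)) (ltW q0))//.
rewrite exprMn [leLHS](_ : _ = 1 * r%:R ^+ k * 1); last by ring.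
rewrite ler_pM ?ler_wpM2r ?mulr_ge0 ?exprn_ge0 ?ler0n//.
by rewrite exprn_ege1// mulr_ege1 ?mu1_ge1// mulr_ege1 ?exprn_ege1// ler1n.
Qed.

(** The constant 5 is [2 + 1 + 2], from the noise, coherence and sampling events; 6 dominates
    [4 / 3 * 4] for the projection error and 4 for the sampling error. *)
Lemma completion_bound : prob p q (fun w : outcome n =>
    let Z := fun j : 'I_k => wedge p (unfold T j) (w.1 j) in
    (forall j, 4 * opnorm (Z j - unfold T j *m (unfold T j)^T) <= s j r.-1 ^+ 2)
    /\
    exists Uh : forall j : 'I_k, 'M[R]_(n j, r),
      (forall j, topeig (Z j) (Uh j)) /\
      let Y := fun x => q^-1 * POmega w.2 T x in
      let That := multi_mode Y (fun j => Uh j *m (Uh j)^T) in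
      6 * (k%:R * Num.sqrt r%:R * kappa ^+ 2
             * Num.sqrt (a * mu1 * mu2 * r%:R ^+ 2 * ln nmax%:R / (p * ntot%:R))
           + 2 ^+ k * Num.sqrt (r%:R ^+ (k + 3)) * kappa ^+ (2 * k)
             * Num.sqrt (a * (k.-1)%:R * mu1 ^+ k.+1 * mu2 * ln nmax%:R
                          / (q * ntot%:R)))
        * frob T
      < frob (fun x => T x - That x))
  <= 5 * nmax%:R `^ (- a).
Proof.
have -> : 5 * nmax%:R `^ (- a) = 2 * expR (- ell) + expR (- ell) + 2 * expR (- ell).
  have -> : nmax%:R `^ (- a) = expR (- ell).
    by rewrite /powR gt_eqF// mulNr.
  by ring.
apply: (prob_union p01 q01 (E3 := E3) _ noise_event coherent_event sampling_event).
move=> w S /= [cw0 [Uh [te lt]]].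
have cw : cond w.
  move=> j q' X; apply: (le_trans (opbound_opnorm _ _)); rewrite ler_wpM2r ?fnorm_ge0//.
  by rewrite /b ler_pdivlMr// mulrC.
have [e1|/negP] := pselect (4 * k%:R < \sum_j yerr w j); first exact: Or31.
rewrite -leNgt => y4.
have [e2|/negP] := pselect (1 < \prod_j fac w j); first exact: Or32.
rewrite -leNgt => f1; apply: Or33; split => //; exists Uh => //.
rewrite ltNge; apply/negP => h3; move: lt; rewrite ltNge; case/negP.
have iso j := wedge_iso r0 (UU j) (VV j) (s0 j) (sS j) (svd j) (cw j) (te j).
have Qc j q' (X : 'M[R]_(n j, q')) : fnorm (Qof Uh j *m X) <= fnorm X.
  by rewrite /Qof -mulmxA fnorm_isoL// fnorm_isoTL.
set That := multi_mode _ _.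
have -> : (fun y => T y - That y) = (fun y => (T y - multi_mode T (Qof Uh) y) +
    multi_mode (fun y => T y - q^-1 * POmega S T y) (Qof Uh) y).
  apply/funext => y.
  rewrite [X in _ = _ + X](fold_modesB (Qof Uh) (enum 'I_k) T (fun y => q^-1 * POmega S T y)).
  by rewrite addrA subrK.
apply: (le_trans (l2normD _ _)).
have h1 : frob (fun y => T y - multi_mode T (Qof Uh) y) <=
    4 / 3 * (kappa ^+ 2 * Num.sqrt r%:R * eps * F) * (4 * k%:R).
  apply: (le_trans (frob_sub_multi_mode n0 Qc T)).
  have ge : 0 <= 4 / 3 * (kappa ^+ 2 * Num.sqrt r%:R * eps * F).
    rewrite mulr_ge0 ?divr_ge0// mulr_ge0 ?(ltW F0)// mulr_ge0 ?(ltW eps0)//.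
    by rewrite mulr_ge0 ?sqrtr_ge0 ?sqr_ge0.
  apply: le_trans (ler_wpM2l ge y4); rewrite mulr_sumr; apply: ler_sum => j _.
  apply: (le_trans (wedge_proj_error r0 (UU j) (VV j) (s0 j) (sS j) (svd j) (cw j) (te j))).
  have srp : 0 < Num.sqrt r%:R :> R by rewrite sqrtr_gt0.
  have yE : fnorm (noise (unfold T j) p (w j) *m U j) =
      yerr w j * (s j 0%N ^+ 2 * Num.sqrt r%:R * eps).
    rewrite /yerr divfK// gt_eqF// mulr_gt0// mulr_gt0// exprn_gt0//.
  have y0 : 0 <= yerr w j.
    rewrite /yerr divr_ge0 ?fnorm_ge0// ltW// mulr_gt0// mulr_gt0// exprn_gt0//.
  rewrite yE.
  have bj : 0 < b j by rewrite divr_gt0// exprn_gt0.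
  (* Two of the three factors [s j 0] are traded for [4 b kappa ^ 2], which cancels the gap [3 b]
     and leaves [4 / 3 kappa ^ 2]; the third is at most [F]. *)
  have s2 := sv0_sqr_le r0 (s0 j) kappa1 (skap j).
  have K0 : 0 <= yerr w j * Num.sqrt r%:R * eps / (3 * b j).
    apply: divr_ge0; last by rewrite ltW// mulr_gt0.
    by rewrite mulr_ge0 ?(ltW eps0)// mulr_ge0 ?(ltW srp).
  rewrite [leLHS](_ : _ = s j 0%N * (s j 0%N ^+ 2 * (yerr w j * Num.sqrt r%:R * eps / (3 * b j)))).
    apply: (@le_trans _ _ (F * (4 * b j * kappa ^+ 2 * (yerr w j * Num.sqrt r%:R * eps / (3 * b j))))).
      apply: ler_pM => //; first exact: ltW.
        by rewrite mulr_ge0 ?sqr_ge0.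
      by rewrite ler_wpM2r.
    by rewrite le_eqVlt; apply/orP; left; apply/eqP; field; rewrite gt_eqF.
  by rewrite /b; field; rewrite gt_eqF.
apply: (le_trans (lerD h1 h3)).
rewrite -/x -/eps -/F mulrDr mulrDl; apply: lerD.
  have : 0 <= kappa ^+ 2 * Num.sqrt r%:R * eps * F * k%:R.
    rewrite mulr_ge0 ?ler0n// mulr_ge0 ?(ltW F0)// mulr_ge0 ?(ltW eps0)//.
    by rewrite mulr_ge0 ?sqrtr_ge0 ?sqr_ge0.
  lra.
rewrite -[leRHS]mulrA -/tau ler_pM2r//; lra.
Qed.

End Completion.

Theorem theoremC3 (R : realType) :
  exists C0 C C' : R, 0 < C0 /\ 0 < C /\ 0 < C' /\
  forall (k : nat) (n : 'I_k -> nat) (T : idx k n -> R) (r : nat)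
    (U : forall j : 'I_k, 'M[R]_(n j, r))
    (V : forall j : 'I_k, 'M[R]_(#|{: colT k n j}|, r))
    (s : 'I_k -> nat -> R) (mu1 mu2 a p q : R),
  (2 <= k)%N -> (forall t, 0 < n t)%N -> (0 < r)%N ->
  2 <= a -> 0 < p <= 1 -> 0 < q <= 1 ->
  (* rank r unfoldings with compact SVD A^(j) = U^(j) Sigma^(j) V^(j)^T *)
  (forall j, \rank (unfold T j) = r) ->
  (forall j,
     (U j)^T *m U j = 1%:M /\ (V j)^T *m V j = 1%:M /\
     (forall i, (i < r)%N -> 0 < s j i) /\
     (forall i, (i.+1 < r)%N -> s j i.+1 <= s j i) /\
     unfold T j = U j *m diag_mx (\row_(i < r) s j i) *m (V j)^T) ->
  (* incoherence *)
  (forall j,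
     norm2inf (U j) ^+ 2 <= mu1 * (r%:R / (n j)%:R) /\
     norm2inf (V j) ^+ 2 <= mu2 * (r%:R / (\prod_(t < k | t != j) n t)%:R)) ->
  let kappa := \big[Num.max/0]_(j < k) (s j 0%N / s j r.-1) in
  let nmax := (\max_(t < k) n t)%N in
  let ntot := (\prod_(t < k) n t)%N in
  C0 * kappa ^+ 4 * a * mu1 * mu2 * ((r%:R ^+ 2 * ln nmax%:R) / ntot%:R) <= p ->
  a * (k.-1)%:R * ln nmax%:R / ntot%:R <= q ->
  prob p q (fun w : outcome n =>
    let Z := fun j : 'I_k => wedge p (unfold T j) (w.1 j) in
    (* assumption lambda_r^(j) >= 4 ||Z^(j) - A^(j) A^(j)^T|| for all j *)
    (forall j, 4 * opnorm (Z j - unfold T j *m (unfold T j)^T) <= s j r.-1 ^+ 2)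
    /\
    (* ... and yet, for some admissible choice of the top-r eigenvectors,
       the error bound fails *)
    exists Uh : forall j : 'I_k, 'M[R]_(n j, r),
      (forall j, topeig (Z j) (Uh j)) /\
      let Y := fun x => q^-1 * POmega w.2 T x in
      let That := multi_mode Y (fun j => Uh j *m (Uh j)^T) in
      C * (k%:R * Num.sqrt r%:R * kappa ^+ 2
             * Num.sqrt (a * mu1 * mu2 * r%:R ^+ 2 * ln nmax%:R / (p * ntot%:R))
           + 2 ^+ k * Num.sqrt (r%:R ^+ (k + 3)) * kappa ^+ (2 * k)
             * Num.sqrt (a * (k.-1)%:R * mu1 ^+ k.+1 * mu2 * ln nmax%:R
                          / (q * ntot%:R)))
        * frob T
      < frob (fun x => T x - That x))
  <= C' * nmax%:R `^ (- a).
Proof.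
exists (64 * 500 ^+ 2), 6, 5; split; first by rewrite mulr_gt0// exprn_gt0.
split=> //; split=> //.
move=> k n T r U V s mu1 mu2 a p q k2 n0 r0 a2 p01 q01 _ svd inc kappa nmax ntot hp hq.
have [nmax2|nmax1] := leqP 2 nmax.
  apply: (completion_bound (U := U) (V := V) k2 n0 r0 a2 p01 q01) => // j.
  - by have [] := svd j.
  - by have [_ []] := svd j.
  - by have [_ [_ []]] := svd j.
  - by have [_ [_ [_ []]]] := svd j.
  - by have [_ [_ [_ []]]] := svd j.
  - by have [] := inc j.
  - by have [] := inc j.
(* If every dimension is 1, the logarithm vanishes, but the claimed bound is 5 and a probability is
   at most 1. *)
have -> : nmax = 1%N.
  apply/eqP; rewrite eqn_leq -ltnS nmax1 /=.
  exact: leq_trans (n0 (Ordinal (ltnW k2))) (leq_bigmax (Ordinal (ltnW k2))).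
rewrite powR1 mulr1 (probE p q); apply: (@le_trans _ _ 1); last by rewrite ler1n.
apply: Expect_wedges_le => // w; apply: Expect_le => // S.
by case: asboolP => _; rewrite ?ler01.
Qed.
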